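(* Let $\mathfrak{C}$ be an $A$-coring such that ${}_A\mathfrak{C}$ and $\mathfrak{C}_A$ are flat. (1) There is an exact sequence of groups $$1\to\mathrm{Inn}_k^r(\mathfrak{C})\to\mathrm{Aut}_k(\mathfrak{C})\xrightarrow{\ \Omega\ }\mathrm{Pic}_k^r(\mathfrak{C}),$$ where $\Omega(f)=({}_f\mathfrak{C})$ and $\mathrm{Inn}_k^r(\mathfrak{C})$ is the set of $f=(\varphi,\rho)\in\mathrm{Aut}_k(\mathfrak{C})$ such that there is an invertible $p\in\mathfrak{C}^*$ with $\sum\varphi(c_{(1)})p(c_{(2)})=\sum p(c_{(1)})c_{(2)}$ for every $c\in\mathfrak{C}$. In particular, there is a monomorphism from the quotient group $\mathrm{Out}_k^r(\mathfrak{C}):=\mathrm{Aut}_k(\mathfrak{C})/\mathrm{Inn}_k^r(\mathfrak{C})$ to $\mathrm{Pic}_k^r(\mathfrak{C})$. (2) If $\mathfrak{D}$ is a $B$-coring, flat on both sides over $B$, and $\mathfrak{C}$ and $\mathfrak{D}$ are Morita-Takeuchi right equivalent, then $\mathrm{Pic}_k^r(\mathfrak{C})\simeq\mathrm{Pic}_k^r(\mathfrak{D})$.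
   Context: $k$ is a commutative ring; $A,B$ are associative unital $k$-algebras. An $A$-coring is an $A$-bimodule $\mathfrak{C}$ with $A$-bimodule maps $\Delta:\mathfrak{C}\to\mathfrak{C}\otimes_A\mathfrak{C}$, $c\mapsto\sum c_{(1)}\otimes c_{(2)}$ (coassociative), and $\epsilon:\mathfrak{C}\to A$ (counit). $\mathcal M^{\mathfrak C}$ is the category of right $\mathfrak C$-comodules. A $(\mathfrak C,\mathfrak D)$-bicomodule is an $(A,B)$-bimodule with compatible left $\mathfrak C$- and right $\mathfrak D$-coactions which are bimodule maps. $M\square_{\mathfrak{C}}N=\ker(\rho_M\otimes_AN-M\otimes_A\lambda_N)\subset M\otimes_AN$. $\mathfrak C^*=\mathrm{Hom}_{-A}(\mathfrak C,A)$ (right $A$-linear maps) is a $k$-algebra with product $(f*^rg)(c)=\sum g(f(c_{(1)})c_{(2)})$ and unit $\epsilon$; ''invertible'' refers to this algebra. $\mathrm{Aut}_k(\mathfrak C)$ is the group of pairs $f=(\varphi,\rho)$ with $\rho:A\to A$ a $k$-algebra automorphism and $\varphi:\mathfrak C\to\mathfrak C$ a bijective additive map with $\varphi(aca')=\rho(a)\varphi(c)\rho(a')$, $\Delta(\varphi(c))=\sum\varphi(c_{(1)})\otimes_A\varphi(c_{(2)})$ and $\epsilon\varphi=\rho\epsilon$. For such $f$, ${}_f\mathfrak C$ is (up to isomorphism) the $\mathfrak C$-bicomodule equal to $\mathfrak C$ as a right comodule, with left $A$-action $a\cdot c=\rho^{-1}(a)c$ and left coaction $c\mapsto\sum\varphi(c_{(1)})\otimes_Ac_{(2)}$.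 A $(\mathfrak C,\mathfrak D)$-bicomodule $X$ is right invertible if $-\square_{\mathfrak C}X:\mathcal M^{\mathfrak C}\to\mathcal M^{\mathfrak D}$ is an equivalence; $\mathfrak C$ and $\mathfrak D$ are Morita-Takeuchi right equivalent if such an $X$ exists. $\mathrm{Pic}_k^r(\mathfrak C)$ is the group of isomorphism classes $(X)$ of right invertible $\mathfrak C$-bicomodules with $(X_1)(X_2)=(X_1\square_{\mathfrak C}X_2)$. *)

(* Defs.v *)
From HB Require Import structures.
From mathcomp Require Import all_boot ssralg.
From mathcomp Require Import boolp.

Set Implicit Arguments.
Unset Strict Implicit.
Unset Printing Implicit Defensive.

Import GRing.Theory.
Local Open Scope ring_scope.
Local Open Scope quotient_scope.

(* An algebra is given by a central ring morphism rather than by algType, so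
   that the zero algebra is allowed and k is always an algebra over itself. *)
Record kalg (k : comPzRingType) := KAlg {
  kalg_ring :> pzRingType;
  kalg_map : {rmorphism k -> kalg_ring};
  kalg_central : forall x a, kalg_map x * a = a * kalg_map x }.

Definition kself (k : comPzRingType) : kalg k :=
  @KAlg k k idfun (fun x a => mulrC x a).

Record bimod_axioms (k : comPzRingType) (A B : kalg k) (V : zmodType)
    (l : A -> V -> V) (r : V -> B -> V) : Prop := BimodAxioms {
  bimod_lDr : forall a u v, l a (u + v) = l a u + l a v;
  bimod_lDl : forall a b v, l (a + b) v = l a v + l b v;
  bimod_lA : forall a b v, l a (l b v) = l (a * b) v;
  bimod_l1 : forall v, l 1 v = v;
  bimod_rDl : forall u v b, r (u + v) b = r u b + r v b;
  bimod_rDr : forall v a b, r v (a + b) = r v a + r v b;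
  bimod_rA : forall v a b, r (r v a) b = r v (a * b);
  bimod_r1 : forall v, r v 1 = v;
  bimod_lr : forall a v b, r (l a v) b = l a (r v b);
  bimod_k : forall x v, l (kalg_map A x) v = r v (kalg_map B x) }.

(* bimod (kself k) A is the type of right A-modules and bimod A (kself k) that
   of left A-modules: by bimod_k the action of k is determined by that of A. *)
Record bimod (k : comPzRingType) (A B : kalg k) := Bimod {
  bimod_sort :> zmodType;
  lact : A -> bimod_sort -> bimod_sort;
  ract : bimod_sort -> B -> bimod_sort;
  bimodP : bimod_axioms lact ract }.

Arguments lact {k A B b} _ _ : simpl never.
Arguments ract {k A B b} _ _ : simpl never.

Notation "a *> m" := (lact a m) (at level 40, m at level 39).
Notation "m <* b" := (ract m b) (at level 40, b at level 39).

Section BimodTheory.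
Variables (k : comPzRingType) (A B : kalg k) (M : bimod A B).
Implicit Types (m n : M) (a : A) (b : B).

Lemma lactDr a m n : a *> (m + n) = a *> m + a *> n.
Proof. exact: (bimod_lDr (bimodP M)). Qed.
Lemma lactDl (a a' : A) m : (a + a') *> m = a *> m + a' *> m.
Proof. exact: (bimod_lDl (bimodP M)). Qed.
Lemma lactA (a a' : A) m : a *> (a' *> m) = (a * a') *> m.
Proof. exact: (bimod_lA (bimodP M)). Qed.
Lemma lact1 m : 1 *> m = m.
Proof. exact: (bimod_l1 (bimodP M)). Qed.
Lemma ractDl m n b : (m + n) <* b = m <* b + n <* b.
Proof. exact: (bimod_rDl (bimodP M)). Qed.
Lemma ractDr m (b b' : B) : m <* (b + b') = m <* b + m <* b'.
Proof. exact: (bimod_rDr (bimodP M)). Qed.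
Lemma ractA m (b b' : B) : m <* b <* b' = m <* (b * b').
Proof. exact: (bimod_rA (bimodP M)). Qed.
Lemma ract1 m : m <* 1 = m.
Proof. exact: (bimod_r1 (bimodP M)). Qed.
Lemma lractA a m b : (a *> m) <* b = a *> (m <* b).
Proof. exact: (bimod_lr (bimodP M)). Qed.
Lemma lract_k (x : k) m : kalg_map A x *> m = m <* kalg_map B x.
Proof. exact: (bimod_k (bimodP M)). Qed.
Lemma lact0 a : a *> (0 : M) = 0.
Proof. by apply: (addrI (a *> 0)); rewrite -lactDr !addr0. Qed.
Lemma ract0 b : (0 : M) <* b = 0.
Proof. by apply: (addrI (0 <* b)); rewrite -ractDl !addr0. Qed.
Lemma lactN a m : a *> (- m) = - (a *> m).
Proof. by apply: (addrI (a *> m)); rewrite -lactDr !subrr lact0. Qed.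
Lemma ractN b m : (- m) <* b = - (m <* b).
Proof. by apply: (addrI (m <* b)); rewrite -ractDl !subrr ract0. Qed.
End BimodTheory.

Record bhom (k : comPzRingType) (A B : kalg k) (M N : bimod A B) := BHom {
  bhom_fun :> M -> N;
  bhomD : forall m n, bhom_fun (m + n) = bhom_fun m + bhom_fun n;
  bhomL : forall a m, bhom_fun (a *> m) = a *> bhom_fun m;
  bhomR : forall m b, bhom_fun (m <* b) = bhom_fun m <* b }.

Section BhomTheory.
Variables (k : comPzRingType) (A B : kalg k).
Implicit Types M N P : bimod A B.

Lemma bhom_ext M N (f g : bhom M N) : f =1 g -> f = g.
Proof.
case: f g => [f fD fL fR] [g gD gL gR] /= /funext e.
by move: gD gL gR; rewrite -e => gD gL gR; congr BHom; apply: Prop_irrelevance.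
Qed.

Lemma bhom0 M N (f : bhom M N) : f 0 = 0.
Proof. by apply: (addrI (f 0)); rewrite -bhomD !addr0. Qed.

Lemma bhomN M N (f : bhom M N) m : f (- m) = - f m.
Proof. by apply: (addrI (f m)); rewrite -bhomD !subrr bhom0. Qed.

Lemma bhomB M N (f : bhom M N) m n : f (m - n) = f m - f n.
Proof. by rewrite bhomD bhomN. Qed.

Definition bid M : bhom M M :=
  @BHom k A B M M id (fun _ _ => erefl) (fun _ _ => erefl) (fun _ _ => erefl).
Lemma bidE M m : bid M m = m. Proof. by []. Qed.

Section Comp.
Variables (M N P : bimod A B) (g : bhom N P) (f : bhom M N).
Lemma bcompD m n : g (f (m + n)) = g (f m) + g (f n).
Proof. by rewrite !bhomD. Qed.
Lemma bcompL a m : g (f (a *> m)) = a *> g (f m).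
Proof. by rewrite !bhomL. Qed.
Lemma bcompR m b : g (f (m <* b)) = g (f m) <* b.
Proof. by rewrite !bhomR. Qed.
Definition bcomp : bhom M P := BHom bcompD bcompL bcompR.
Lemma bcompE m : bcomp m = g (f m). Proof. by []. Qed.
End Comp.

Section Sub.
Variables (M N : bimod A B) (f g : bhom M N).
Lemma bsubD m n : f (m + n) - g (m + n) = (f m - g m) + (f n - g n).
Proof. by rewrite !bhomD opprD addrACA. Qed.
Lemma bsubL a m : f (a *> m) - g (a *> m) = a *> (f m - g m).
Proof. by rewrite !bhomL lactDr lactN. Qed.
Lemma bsubR m b : f (m <* b) - g (m <* b) = (f m - g m) <* b.
Proof. by rewrite !bhomR ractDl ractN. Qed.
Definition bsub : bhom M N :=
  @BHom k A B M N (fun m => f m - g m) bsubD bsubL bsubR.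
End Sub.

End BhomTheory.

Lemma regularP (k : comPzRingType) (A : kalg k) :
  @bimod_axioms k A A A (fun a m => a * m) (fun m a => m * a).
Proof.
by split=> *; rewrite ?(mulrDl, mulrDr, mulrA, mul1r, mulr1, kalg_central).
Qed.

Definition regular (k : comPzRingType) (A : kalg k) : bimod A A :=
  Bimod (regularP A).

Section OneSided.
Variables (k : comPzRingType) (A B : kalg k) (M : bimod A B).

Lemma rmod_ofP : @bimod_axioms k (kself k) B M
  (fun x m => m <* kalg_map B x) (fun m b => m <* b).
Proof.
split=> *; rewrite ?(ractDl, ractDr, ractA, ract1, rmorphD, rmorphM, rmorph1) //.
  by rewrite kalg_central.
by rewrite -kalg_central.
Qed.

Definition rmod_of : bimod (kself k) B := Bimod rmod_ofP.

Lemma lmod_ofP : @bimod_axioms k A (kself k) M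
  (fun a m => a *> m) (fun m x => kalg_map A x *> m).
Proof.
split=> *; rewrite ?(lactDl, lactDr, lactA, lact1, rmorphD, rmorphM, rmorph1) //.
  by rewrite kalg_central.
by rewrite kalg_central.
Qed.

Definition lmod_of : bimod A (kself k) := Bimod lmod_ofP.

End OneSided.

Section RawTensor.
Variables (M N : zmodType) (A : Type) (r : M -> A -> M) (l : A -> N -> N).

(* The congruence on finite formal sums of pairs (m, n) whose quotient is the
   tensor product of the right action r and the left action l. *)
Inductive tens_eq : seq (M * N) -> seq (M * N) -> Prop :=
  | TensRefl s : tens_eq s s
  | TensSym s t : tens_eq s t -> tens_eq t s
  | TensTrans s t u : tens_eq s t -> tens_eq t u -> tens_eq s u
  | TensPerm s t : perm_eq s t -> tens_eq s t
  | TensCat s s' t t' :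
      tens_eq s s' -> tens_eq t t' -> tens_eq (s ++ t) (s' ++ t')
  | TensZero n : tens_eq [:: (0, n)] [::]
  | TensAddl m m' n : tens_eq [:: (m + m', n)] [:: (m, n); (m', n)]
  | TensAddr m n n' : tens_eq [:: (m, n + n')] [:: (m, n); (m, n')]
  | TensBal m a n : tens_eq [:: (r m a, n)] [:: (m, l a n)].

Definition tens_rel : rel (seq (M * N)) := fun s t => `[< tens_eq s t >].

Lemma tens_rel_equiv : equiv_class_of tens_rel.
Proof.
split=> [s|s t|t s u]; rewrite /tens_rel.
- exact/asboolP/TensRefl.
- by apply/asboolP/asboolP => /TensSym.
- by move=> /asboolP h1 /asboolP h2; apply/asboolP; apply: TensTrans h1 h2.
Qed.

Canonical tens_equiv_rel := EquivRelPack tens_rel_equiv.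

Definition tens := {eq_quot tens_equiv_rel}.
HB.instance Definition _ := Choice.on tens.
HB.instance Definition _ := EqQuotient.on tens.

Lemma tens_eqP s t : (\pi_tens s = \pi_tens t) <-> tens_eq s t.
Proof. by split=> [/eqquotP/asboolP //|h]; apply/eqquotP/asboolP. Qed.

Definition tens_zero : tens := \pi_tens [::].
Definition tens_add (x y : tens) : tens := \pi_tens (repr x ++ repr y).
Definition tens_oppseq (s : seq (M * N)) := [seq (- p.1, p.2) | p <- s].
Definition tens_opp (x : tens) : tens := \pi_tens (tens_oppseq (repr x)).

Lemma tens_addE s t : tens_add (\pi s) (\pi t) = \pi_tens (s ++ t).
Proof. by apply/tens_eqP; apply: TensCat; apply/tens_eqP; rewrite reprK. Qed.

Lemma tens_addA : associative tens_add.
Proof.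
move=> x y z; rewrite -[x]reprK -[y]reprK -[z]reprK !tens_addE.
by rewrite catA.
Qed.

Lemma tens_addC : commutative tens_add.
Proof.
move=> x y; rewrite -[x]reprK -[y]reprK !tens_addE.
by apply/tens_eqP/TensPerm; rewrite perm_catC.
Qed.

Lemma tens_add0 : left_id tens_zero tens_add.
Proof. by move=> x; rewrite -[x]reprK tens_addE. Qed.

Lemma tens_oppP s : tens_eq (tens_oppseq s ++ s) [::].
Proof.
elim: s => [|[m n] s ih] /=; first exact: TensRefl.
apply: (@TensTrans _ ([:: (- m, n); (m, n)] ++ (tens_oppseq s ++ s))).
  apply: TensPerm; rewrite /= perm_cons.
  by rewrite perm_sym -perm_rcons -cats1 -catA perm_cat2l cats1 perm_rcons.
rewrite -[X in tens_eq _ X]/([::] ++ [::]); apply: TensCat => //.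
apply: TensTrans (TensZero n); apply: TensSym.
by rewrite -(addNr m); apply: TensAddl.
Qed.

Lemma tens_addN : left_inverse tens_zero tens_opp tens_add.
Proof.
move=> x; rewrite -{2}[x]reprK /tens_opp tens_addE.
exact/tens_eqP/tens_oppP.
Qed.

HB.instance Definition _ :=
  GRing.isZmodule.Build tens tens_addA tens_addC tens_add0 tens_addN.

Definition tens_pure (m : M) (n : N) : tens := \pi [:: (m, n)].

Lemma tens_pureDl m m' n :
  tens_pure (m + m') n = tens_pure m n + tens_pure m' n.
Proof.
by rewrite [RHS]tens_addE; apply/tens_eqP/TensAddl.
Qed.
Lemma tens_pureDr m n n' :
  tens_pure m (n + n') = tens_pure m n + tens_pure m n'.
Proof.
by rewrite [RHS]tens_addE; apply/tens_eqP/TensAddr.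
Qed.
Lemma tens_pure_bal m a n : tens_pure (r m a) n = tens_pure m (l a n).
Proof. exact/tens_eqP/TensBal. Qed.

Lemma tens_sum s : \pi_tens s = \sum_(p <- s) tens_pure p.1 p.2.
Proof.
elim: s => [|[m n] s ih]; first by rewrite big_nil.
by rewrite big_cons -ih /= [RHS]tens_addE.
Qed.

Lemma tens_ind (P : tens -> Prop) :
  (forall m n, P (tens_pure m n)) -> (forall x y, P x -> P y -> P (x + y)) ->
  forall x, P x.
Proof.
move=> Pp PD x; rewrite -[x]reprK tens_sum.
elim: (repr x) => [|p s ih].
  rewrite big_nil; suff -> : 0 = tens_pure 0 0 by [].
  by apply/esym/tens_eqP/TensZero.
by rewrite big_cons; apply: PD.
Qed.

Section Lift.
Variables (G : zmodType) (f : M -> N -> G).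

Definition balanced : Prop :=
  [/\ forall m m' n, f (m + m') n = f m n + f m' n,
      forall m n n', f m (n + n') = f m n + f m n' &
      forall m a n, f (r m a) n = f m (l a n)].

Definition tlift (x : tens) : G := \sum_(p <- repr x) f p.1 p.2.

Hypothesis fP : balanced.

Lemma tlift_pi q : tlift (\pi q) = \sum_(p <- q) f p.1 p.2.
Proof.
have [fDl fDr fb] := fP.
have main u v : tens_eq u v ->
    \sum_(p <- u) f p.1 p.2 = \sum_(p <- v) f p.1 p.2; last first.
  by apply: main; apply/tens_eqP; rewrite reprK.
elim=> {u v} //=.
- by move=> s t u _ -> _ ->.
- by move=> s t h; exact: perm_big.
- by move=> s s' t t' _ h _ h'; rewrite !big_cat h h'.
- move=> n; rewrite big_seq1 big_nil /=.
  by apply: (addrI (f 0 n)); rewrite -fDl !addr0.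
- by move=> m m' n; rewrite !big_cons !big_nil !addr0 /= fDl.
- by move=> m n n'; rewrite !big_cons !big_nil !addr0 /= fDr.
- by move=> m a n; rewrite !big_cons !big_nil !addr0 /= fb.
Qed.

Lemma tlift_pure m n : tlift (tens_pure m n) = f m n.
Proof. by rewrite tlift_pi big_seq1. Qed.

Lemma tliftD x y : tlift (x + y) = tlift x + tlift y.
Proof.
rewrite -[x]reprK -[y]reprK [X in tlift X]tens_addE.
by rewrite !tlift_pi big_cat.
Qed.

End Lift.

End RawTensor.

Section Tensor.
Variables (k : comPzRingType) (A B C : kalg k).
Variables (M : bimod A B) (N : bimod B C).

Definition btens : zmodType := tens (@ract k A B M) (@lact k B C N).

Definition btens_l (a : A) : btens -> btens :=
  tlift (fun m n => tens_pure _ _ (a *> m) n).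
Definition btens_r (x : btens) (c : C) : btens :=
  tlift (fun m n => tens_pure _ _ m (n <* c)) x.

Lemma btens_lP a : balanced (@ract k A B M) (@lact k B C N)
  (fun m n => tens_pure _ _ (a *> m) n : btens).
Proof.
split=> *; rewrite ?(lactDr, tens_pureDl, tens_pureDr) //.
by rewrite -lractA tens_pure_bal.
Qed.

Lemma btens_rP c : balanced (@ract k A B M) (@lact k B C N)
  (fun m n => tens_pure _ _ m (n <* c) : btens).
Proof.
split=> *; rewrite ?(ractDl, tens_pureDl, tens_pureDr) //.
by rewrite lractA tens_pure_bal.
Qed.

Lemma btensP : bimod_axioms btens_l btens_r.
Proof.
have lE a m n : btens_l a (tens_pure _ _ m n) = tens_pure _ _ (a *> m) n.
  by rewrite /btens_l (tlift_pure (btens_lP a)).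
have rE c m n : btens_r (tens_pure _ _ m n) c = tens_pure _ _ m (n <* c).
  by rewrite /btens_r (tlift_pure (btens_rP c)).
have lD a x y : btens_l a (x + y) = btens_l a x + btens_l a y.
  exact: (tliftD (btens_lP a)).
have rD c x y : btens_r (x + y) c = btens_r x c + btens_r y c.
  exact: (tliftD (btens_rP c)).
split=> //.
- move=> a b; elim/tens_ind=> [m n|x y hx hy].
    by rewrite !lE lactDl tens_pureDl.
  by rewrite !lD hx hy addrACA.
- move=> a b; elim/tens_ind=> [m n|x y hx hy]; first by rewrite !lE lactA.
  by rewrite !lD hx hy.
- elim/tens_ind=> [m n|x y hx hy]; first by rewrite !lE lact1.
  by rewrite !lD hx hy.
- move=> x a b; elim/tens_ind: x => [m n|x y hx hy].
    by rewrite !rE ractDr tens_pureDr.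
  by rewrite !rD hx hy addrACA.
- move=> x a b; elim/tens_ind: x => [m n|x y hx hy]; first by rewrite !rE ractA.
  by rewrite !rD hx hy.
- elim/tens_ind=> [m n|x y hx hy]; first by rewrite !rE ract1.
  by rewrite !rD hx hy.
- move=> a x c; elim/tens_ind: x => [m n|x y hx hy]; first by rewrite !(lE, rE).
  by rewrite !(lD, rD) hx hy.
- move=> u; elim/tens_ind=> [m n|x y hx hy].
    by rewrite lE rE lract_k tens_pure_bal lract_k.
  by rewrite lD rD hx hy.
Qed.

Definition tensor : bimod A C := Bimod btensP.

Definition pure (m : M) (n : N) : tensor := tens_pure _ _ m n.

Lemma pureDl m m' n : pure (m + m') n = pure m n + pure m' n.
Proof. exact: tens_pureDl. Qed.
Lemma pureDr m n n' : pure m (n + n') = pure m n + pure m n'.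
Proof. exact: tens_pureDr. Qed.
Lemma pure_bal m b n : pure (m <* b) n = pure m (b *> n).
Proof. exact: tens_pure_bal. Qed.
Lemma lact_pure a m n : a *> pure m n = pure (a *> m) n.
Proof. exact: (tlift_pure (btens_lP a)). Qed.
Lemma ract_pure m n c : pure m n <* c = pure m (n <* c).
Proof. exact: (tlift_pure (btens_rP c)). Qed.

Lemma tensor_ind (P : tensor -> Prop) :
  (forall m n, P (pure m n)) -> (forall x y, P x -> P y -> P (x + y)) ->
  forall x, P x.
Proof. exact: tens_ind. Qed.

Record bilinear_bal (P : bimod A C) (f : M -> N -> P) : Prop := BilinearBal {
  bilDl : forall m m' n, f (m + m') n = f m n + f m' n;
  bilDr : forall m n n', f m (n + n') = f m n + f m n';
  bil_bal : forall m b n, f (m <* b) n = f m (b *> n);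
  bilL : forall a m n, f (a *> m) n = a *> f m n;
  bilR : forall m n c, f m (n <* c) = f m n <* c }.

Lemma bil_balanced (P : bimod A C) (f : M -> N -> P) : bilinear_bal f ->
  balanced (@ract k A B M) (@lact k B C N) f.
Proof. by case. Qed.

Section BilinearLift.
Variables (P : bimod A C) (f : M -> N -> P).
Hypothesis fP : bilinear_bal f.

Definition blift_fun : tensor -> P :=
  @tlift M N B (@ract k A B M) (@lact k B C N) P f.

Lemma blift_funE m n : blift_fun (pure m n) = f m n.
Proof. exact: (tlift_pure (bil_balanced fP)). Qed.

Lemma blift_funD x y : blift_fun (x + y) = blift_fun x + blift_fun y.
Proof. exact: (tliftD (bil_balanced fP)). Qed.

Lemma blift_funL a x : blift_fun (a *> x) = a *> blift_fun x.
Proof.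
elim/tensor_ind: x => [m n|x y hx hy].
  by rewrite lact_pure !blift_funE (bilL fP).
by rewrite lactDr !blift_funD hx hy lactDr.
Qed.

Lemma blift_funR x c : blift_fun (x <* c) = blift_fun x <* c.
Proof.
elim/tensor_ind: x => [m n|x y hx hy].
  by rewrite ract_pure !blift_funE (bilR fP).
by rewrite ractDl !blift_funD hx hy ractDl.
Qed.

Definition blift : bhom tensor P := BHom blift_funD blift_funL blift_funR.

Lemma bliftE m n : blift (pure m n) = f m n.
Proof. exact: blift_funE. Qed.

End BilinearLift.

End Tensor.

Notation "M ⊗ N" := (tensor M N) (at level 38, left associativity).
Notation "m ⊙ n" := (pure m n) (at level 38, left associativity).
Arguments pure {k A B C M N} m n : simpl never.

Section TensorMaps.
Variable k : comPzRingType.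

Lemma tmapP (A B C : kalg k) (M M' : bimod A B) (N N' : bimod B C)
    (f : bhom M M') (g : bhom N N') :
  bilinear_bal (fun m n => f m ⊙ g n).
Proof.
split=> *; rewrite ?(bhomD, bhomL, bhomR) ?(pureDl, pureDr) //.
- by rewrite pure_bal.
- by rewrite lact_pure.
- by rewrite ract_pure.
Qed.

Definition tmap (A B C : kalg k) (M M' : bimod A B) (N N' : bimod B C)
  (f : bhom M M') (g : bhom N N') : bhom (M ⊗ N) (M' ⊗ N') := blift (tmapP f g).

Lemma tmapE (A B C : kalg k) (M M' : bimod A B) (N N' : bimod B C)
  (f : bhom M M') (g : bhom N N') m n : tmap f g (m ⊙ n) = f m ⊙ g n.
Proof. exact: bliftE. Qed.

Section Assoc.
Variables (A B C D : kalg k).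
Variables (M : bimod A B) (N : bimod B C) (P : bimod C D).

Lemma tassoc_inP (p : P) :
  balanced (@ract k A B M) (@lact k B C N) (fun m n => m ⊙ (n ⊙ p)).
Proof.
split=> *; rewrite ?(pureDl, pureDr) //.
by rewrite pure_bal lact_pure.
Qed.

Definition tassoc_fun (x : M ⊗ N) (p : P) : M ⊗ (N ⊗ P) :=
  tlift (fun m n => m ⊙ (n ⊙ p)) x.

Lemma tassoc_funE m n p : tassoc_fun (m ⊙ n) p = m ⊙ (n ⊙ p).
Proof. exact: (tlift_pure (tassoc_inP p)). Qed.

Lemma tassoc_funD x y p : tassoc_fun (x + y) p = tassoc_fun x p + tassoc_fun y p.
Proof. exact: (tliftD (tassoc_inP p)). Qed.

Lemma tassocP : bilinear_bal tassoc_fun.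
Proof.
split.
- by move=> *; rewrite tassoc_funD.
- move=> x p p'; elim/tensor_ind: x => [m n|x y hx hy].
    by rewrite !tassoc_funE !pureDr.
  by rewrite !tassoc_funD hx hy addrACA.
- move=> x c p; elim/tensor_ind: x => [m n|x y hx hy].
    by rewrite ract_pure !tassoc_funE pure_bal.
  by rewrite ractDl !tassoc_funD hx hy.
- move=> a x p; elim/tensor_ind: x => [m n|x y hx hy].
    by rewrite lact_pure !tassoc_funE lact_pure.
  by rewrite lactDr !tassoc_funD hx hy lactDr.
- move=> x p d; elim/tensor_ind: x => [m n|x y hx hy].
    by rewrite !tassoc_funE !ract_pure.
  by rewrite !tassoc_funD hx hy ractDl.
Qed.

Definition tassoc : bhom ((M ⊗ N) ⊗ P) (M ⊗ (N ⊗ P)) := blift tassocP.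

Lemma tassocE m n p : tassoc (m ⊙ n ⊙ p) = m ⊙ (n ⊙ p).
Proof. by rewrite bliftE tassoc_funE. Qed.

Lemma tassocV_inP (m : M) :
  balanced (@ract k B C N) (@lact k C D P) (fun n p => m ⊙ n ⊙ p).
Proof.
split=> *; rewrite ?(pureDl, pureDr) //.
by rewrite -ract_pure pure_bal.
Qed.

Definition tassocV_fun (m : M) (x : N ⊗ P) : M ⊗ N ⊗ P :=
  tlift (fun n p => m ⊙ n ⊙ p) x.

Lemma tassocV_funE m n p : tassocV_fun m (n ⊙ p) = m ⊙ n ⊙ p.
Proof. exact: (tlift_pure (tassocV_inP m)). Qed.

Lemma tassocV_funD m x y :
  tassocV_fun m (x + y) = tassocV_fun m x + tassocV_fun m y.
Proof. exact: (tliftD (tassocV_inP m)). Qed.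

Lemma tassocVP : bilinear_bal tassocV_fun.
Proof.
split.
- move=> m m' x; elim/tensor_ind: x => [n p|x y hx hy].
    by rewrite !tassocV_funE !pureDl.
  by rewrite !tassocV_funD hx hy addrACA.
- by move=> *; rewrite tassocV_funD.
- move=> m b x; elim/tensor_ind: x => [n p|x y hx hy].
    by rewrite lact_pure !tassocV_funE pure_bal.
  by rewrite lactDr !tassocV_funD hx hy.
- move=> a m x; elim/tensor_ind: x => [n p|x y hx hy].
    by rewrite !tassocV_funE !lact_pure.
  by rewrite !tassocV_funD hx hy lactDr.
- move=> m x d; elim/tensor_ind: x => [n p|x y hx hy].
    by rewrite ract_pure !tassocV_funE ract_pure.
  by rewrite ractDl !tassocV_funD hx hy ractDl.
Qed.

Definition tassocV : bhom (M ⊗ (N ⊗ P)) ((M ⊗ N) ⊗ P) := blift tassocVP.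

Lemma tassocVE m n p : tassocV (m ⊙ (n ⊙ p)) = m ⊙ n ⊙ p.
Proof. by rewrite bliftE tassocV_funE. Qed.

Lemma tassocK : cancel tassoc tassocV.
Proof.
elim/tensor_ind=> [x p|x y hx hy]; last by rewrite !bhomD hx hy.
elim/tensor_ind: x => [m n|x y hx hy]; first by rewrite tassocE tassocVE.
by rewrite pureDl !bhomD hx hy.
Qed.

Lemma tassocVK : cancel tassocV tassoc.
Proof.
elim/tensor_ind=> [m x|x y hx hy]; last by rewrite !bhomD hx hy.
elim/tensor_ind: x => [n p|x y hx hy]; first by rewrite tassocVE tassocE.
by rewrite pureDr !bhomD hx hy.
Qed.

End Assoc.

Lemma tassoc_inj (A B C D : kalg k) (M : bimod A B) (N : bimod B C)
  (P : bimod C D) : injective (tassoc M N P).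
Proof. exact: can_inj (@tassocK _ _ _ _ _ _ _). Qed.

Lemma runitP (A B : kalg k) (M : bimod A B) :
  bilinear_bal (fun (m : M) (b : regular B) => m <* (b : B)).
Proof.
split=> *; rewrite ?(ractDl, ractDr) //.
- by rewrite ractA.
- by rewrite lractA.
- by rewrite ractA.
Qed.

Definition runit (A B : kalg k) (M : bimod A B) : bhom (M ⊗ regular B) M :=
  blift (runitP M).

Lemma runitE (A B : kalg k) (M : bimod A B) m (b : regular B) :
  runit M (m ⊙ b) = m <* (b : B).
Proof. exact: (bliftE (runitP M)). Qed.

Lemma lunitP (A B : kalg k) (M : bimod A B) :
  bilinear_bal (fun (a : regular A) (m : M) => (a : A) *> m).
Proof.
split=> *; rewrite ?(lactDl, lactDr) //.
- by rewrite lactA.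
- by rewrite lactA.
- by rewrite lractA.
Qed.

Definition lunit (A B : kalg k) (M : bimod A B) : bhom (regular A ⊗ M) M :=
  blift (lunitP M).

Lemma lunitE (A B : kalg k) (M : bimod A B) (a : regular A) m :
  lunit M (a ⊙ m) = (a : A) *> m.
Proof. exact: (bliftE (lunitP M)). Qed.

End TensorMaps.

Definition bhomE := (bidE, bcompE, tmapE, tassocE, tassocVE, runitE, lunitE).

Section Equalizer.
Variables (k : comPzRingType) (A B : kalg k) (M N : bimod A B).
Variables f g : bhom M N.

Definition beq_pred : {pred M} := fun m => f m == g m.

Lemma beq_predP : zmod_closed beq_pred.
Proof.
split=> [|m n]; rewrite ?unfold_in ?bhom0 //.
by move=> /eqP hm /eqP hn; rewrite !bhomB hm hn.
Qed.

Definition beq_type := {m : M | beq_pred m}.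
HB.instance Definition _ := SubChoice.on beq_type.
HB.instance Definition _ :=
  GRing.SubChoice_isSubZmodule.Build M beq_pred beq_type beq_predP.

Lemma beq_lP a (m : beq_type) : beq_pred (a *> \val m).
Proof. by rewrite /beq_pred !bhomL (eqP (valP m)). Qed.
Lemma beq_rP (m : beq_type) b : beq_pred (\val m <* b).
Proof. by rewrite /beq_pred !bhomR (eqP (valP m)). Qed.

Definition beq_l a (m : beq_type) : beq_type := Sub _ (beq_lP a m).
Definition beq_r (m : beq_type) b : beq_type := Sub _ (beq_rP m b).

Lemma beq_axioms : bimod_axioms beq_l beq_r.
Proof.
have vD (x y : beq_type) : \val (x + y) = \val x + \val y by [].
split=> *; apply: val_inj; rewrite ?SubK ?vD ?SubK;
 by rewrite ?(lactDr, lactDl, lactA, lact1, ractDl, ractDr, ractA, ract1, lractA, lract_k).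
Qed.

Definition beq : bimod A B := Bimod beq_axioms.

Definition bincl : bhom beq M :=
  @BHom k A B beq M val (fun _ _ => erefl) (fun _ _ => erefl) (fun _ _ => erefl).

Lemma bincl_inj : injective bincl.
Proof. exact: val_inj. Qed.

Lemma binclP (m : beq) : f (bincl m) = g (bincl m).
Proof. exact/eqP/(valP m). Qed.

Lemma bincl_ex m : f m = g m -> exists e : beq, bincl e = m.
Proof. by move/eqP=> h; exists (Sub m (h : beq_pred m)); apply: SubK. Qed.

End Equalizer.

Section Factor.
Variables (k : comPzRingType) (A B : kalg k) (E U V : bimod A B).
Variables (i : bhom E U) (i_inj : injective i) (h : bhom V U).
Hypothesis hi : forall v, exists e, i e = h v.

Definition bfactor_fun (v : V) : E := projT1 (cid (hi v)).
Lemma bfactor_funE v : i (bfactor_fun v) = h v.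
Proof. exact: projT2 (cid (hi v)). Qed.
Lemma bfactorD v w : bfactor_fun (v + w) = bfactor_fun v + bfactor_fun w.
Proof. by apply: i_inj; rewrite bhomD !bfactor_funE bhomD. Qed.
Lemma bfactorL a v : bfactor_fun (a *> v) = a *> bfactor_fun v.
Proof. by apply: i_inj; rewrite bhomL !bfactor_funE bhomL. Qed.
Lemma bfactorR v b : bfactor_fun (v <* b) = bfactor_fun v <* b.
Proof. by apply: i_inj; rewrite bhomR !bfactor_funE bhomR. Qed.

(* The unique map V -> E whose composite with the injection i is h. *)
Definition bfactor : bhom V E := BHom bfactorD bfactorL bfactorR.

Lemma bfactorE v : i (bfactor v) = h v.
Proof. exact: bfactor_funE. Qed.

End Factor.

Definition exact_at (k : comPzRingType) (A B : kalg k) (M N P : bimod A B)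
  (f : bhom M N) (g : bhom N P) : Prop :=
  forall n, g n = 0 <-> exists m, f m = n.

(* left_flat C: the left module underlying C is flat, i.e. - ⊗ C is exact on
   right modules; right_flat C: the right module underlying C is flat. *)
Definition left_flat (k : comPzRingType) (A B : kalg k) (C : bimod A B) : Prop :=
  forall (M N P : bimod (kself k) A) (f : bhom M N) (g : bhom N P),
    exact_at f g -> exact_at (tmap f (bid C)) (tmap g (bid C)).

Definition right_flat (k : comPzRingType) (A B : kalg k) (C : bimod A B) : Prop :=
  forall (M N P : bimod B (kself k)) (f : bhom M N) (g : bhom N P),
    exact_at f g -> exact_at (tmap (bid C) f) (tmap (bid C) g).

Section FlatTheory.
Variables (k : comPzRingType) (A B R : kalg k) (C : bimod A B).

Lemma rhom_of_k (M N : bimod R A) (f : bhom M N) (x : kself k) (m : rmod_of M) :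
  f (x *> m) = x *> (f m : rmod_of N).
Proof. exact: bhomR. Qed.

Definition rhom_of (M N : bimod R A) (f : bhom M N) :
  bhom (rmod_of M) (rmod_of N) :=
  @BHom k (kself k) A (rmod_of M) (rmod_of N) f (bhomD f) (rhom_of_k f) (bhomR f).

Lemma lhom_of_k (M N : bimod B R) (f : bhom M N) (m : lmod_of M) (x : kself k) :
  f (m <* x) = (f m : lmod_of N) <* x.
Proof. exact: bhomL. Qed.

Definition lhom_of (M N : bimod B R) (f : bhom M N) :
  bhom (lmod_of M) (lmod_of N) :=
  @BHom k B (kself k) (lmod_of M) (lmod_of N) f (bhomD f) (bhomL f) (lhom_of_k f).

Lemma left_flat_exact (hC : left_flat C) (M N P : bimod R A)
    (f : bhom M N) (g : bhom N P) :
  exact_at f g -> exact_at (tmap f (bid C)) (tmap g (bid C)).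
Proof.
by move=> h; exact: (@hC (rmod_of M) (rmod_of N) (rmod_of P)
                        (rhom_of f) (rhom_of g) h).
Qed.

Lemma right_flat_exact (hC : right_flat C) (M N P : bimod B R)
    (f : bhom M N) (g : bhom N P) :
  exact_at f g -> exact_at (tmap (bid C) f) (tmap (bid C) g).
Proof.
by move=> h; exact: (@hC (lmod_of M) (lmod_of N) (lmod_of P)
                        (lhom_of f) (lhom_of g) h).
Qed.

Lemma exact_inj (A' B' : kalg k) (M N : bimod A' B') (f : bhom M N) :
  exact_at (bsub (bid M) (bid M)) f <-> injective f.
Proof.
split=> [h x y e|h x].
  apply/eqP; rewrite -subr_eq0; apply/eqP.
  have [|m <-] := (h (x - y)).1; last by rewrite /= subrr.
  by rewrite bhomB e subrr.
split=> [e|[m <-]]; last by rewrite /= subrr bhom0.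
by exists 0; rewrite /= subrr; apply: h; rewrite e bhom0.
Qed.

Lemma tmap0l (A' B' C' : kalg k) (M : bimod A' B') (N : bimod B' C') x :
  tmap (bsub (bid M) (bid M)) (bid N) x = 0.
Proof.
elim/tensor_ind: x => [m n|x y hx hy]; last by rewrite bhomD hx hy addr0.
rewrite tmapE /= subrr.
by apply: (addrI (0 ⊙ n)); rewrite -pureDl !addr0.
Qed.

Lemma tmap0r (A' B' C' : kalg k) (M : bimod A' B') (N : bimod B' C') x :
  tmap (bid M) (bsub (bid N) (bid N)) x = 0.
Proof.
elim/tensor_ind: x => [m n|x y hx hy]; last by rewrite bhomD hx hy addr0.
rewrite tmapE /= subrr.
by apply: (addrI (m ⊙ 0)); rewrite -pureDr !addr0.
Qed.

Lemma left_flat_inj (hC : left_flat C) (M N : bimod R A) (f : bhom M N) :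
  injective f -> injective (tmap f (bid C)).
Proof.
move/exact_inj/(left_flat_exact hC) => h; apply/exact_inj => x.
rewrite h; split=> [[y <-]|[y <-]].
  by exists 0; rewrite tmap0l bhom0.
by exists 0; rewrite tmap0l /= subrr.
Qed.

Lemma right_flat_inj (hC : right_flat C) (M N : bimod B R) (f : bhom M N) :
  injective f -> injective (tmap (bid C) f).
Proof.
move/exact_inj/(right_flat_exact hC) => h; apply/exact_inj => x.
rewrite h; split=> [[y <-]|[y <-]].
  by exists 0; rewrite tmap0r bhom0.
by exists 0; rewrite tmap0r /= subrr.
Qed.

Lemma exact_beq (A' B' : kalg k) (M N : bimod A' B') (f g : bhom M N) :
  exact_at (bincl f g) (bsub f g).
Proof.
move=> m; split=> [/eqP|[e <-]] /=; first by rewrite subr_eq0 => /eqP/bincl_ex.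
by apply/eqP; rewrite subr_eq0; apply/eqP; apply: binclP.
Qed.

Lemma left_flat_beq (hC : left_flat C) (M N : bimod R A) (f g : bhom M N) y :
  tmap f (bid C) y = tmap g (bid C) y ->
  exists w, tmap (bincl f g) (bid C) w = y.
Proof.
move=> e; apply/(left_flat_exact hC (exact_beq f g)).
suff -> : tmap (bsub f g) (bid C) y = tmap f (bid C) y - tmap g (bid C) y.
  by rewrite e subrr.
elim/tensor_ind: y {e} => [m n|x y hx hy].
  rewrite !tmapE /=; apply: (addIr (g m ⊙ n)).
  by rewrite -pureDl !subrK.
by rewrite !bhomD hx hy opprD addrACA.
Qed.

Lemma right_flat_beq (hC : right_flat C) (M N : bimod B R) (f g : bhom M N) y :
  tmap (bid C) f y = tmap (bid C) g y ->
  exists w, tmap (bid C) (bincl f g) w = y.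
Proof.
move=> e; apply/(right_flat_exact hC (exact_beq f g)).
suff -> : tmap (bid C) (bsub f g) y = tmap (bid C) f y - tmap (bid C) g y.
  by rewrite e subrr.
elim/tensor_ind: y {e} => [m n|x y hx hy].
  rewrite !tmapE /=; apply: (addIr (m ⊙ g n)).
  by rewrite -pureDr !subrK.
by rewrite !bhomD hx hy opprD addrACA.
Qed.

End FlatTheory.

Record coring (k : comPzRingType) (A : kalg k) := Coring {
  cor_bimod :> bimod A A;
  cor_delta : bhom cor_bimod (cor_bimod ⊗ cor_bimod);
  cor_eps : bhom cor_bimod (regular A);
  cor_coassoc : forall c,
    tassoc _ _ _ (tmap cor_delta (bid _) (cor_delta c)) =
    tmap (bid _) cor_delta (cor_delta c);
  cor_counitl : forall c, lunit _ (tmap cor_eps (bid _) (cor_delta c)) = c;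
  cor_counitr : forall c, runit _ (tmap (bid _) cor_eps (cor_delta c)) = c }.

Arguments cor_delta {k A} _ : simpl never.
Arguments cor_eps {k A} _ : simpl never.

Record right_coaction (k : comPzRingType) (R A : kalg k) (C : coring A)
    (M : bimod R A) (rho : bhom M (M ⊗ C)) : Prop := RightCoaction {
  rcoact_assoc : forall m,
    tassoc _ _ _ (tmap rho (bid C) (rho m)) = tmap (bid M) (cor_delta C) (rho m);
  rcoact_counit : forall m, runit _ (tmap (bid M) (cor_eps C) (rho m)) = m }.

Record left_coaction (k : comPzRingType) (A S : kalg k) (C : coring A)
    (M : bimod A S) (lam : bhom M (C ⊗ M)) : Prop := LeftCoaction {
  lcoact_assoc : forall m,
    tassoc _ _ _ (tmap (cor_delta C) (bid M) (lam m)) = tmap (bid C) lam (lam m);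
  lcoact_counit : forall m, lunit _ (tmap (cor_eps C) (bid M) (lam m)) = m }.

(* The left action of k on rc_mod carries no information (see bimod), so this
   is a right A-module with a right A-linear coaction. *)
Record rcomod (k : comPzRingType) (A : kalg k) (C : coring A) := RComod {
  rc_mod :> bimod (kself k) A;
  rc_rho : bhom rc_mod (rc_mod ⊗ C);
  rc_rhoP : right_coaction rc_rho }.

Record bicomod (k : comPzRingType) (A B : kalg k) (C : coring A) (D : coring B)
  := Bicomod {
  bc_bimod :> bimod A B;
  bc_lam : bhom bc_bimod (C ⊗ bc_bimod);
  bc_rho : bhom bc_bimod (bc_bimod ⊗ D);
  bc_lamP : left_coaction bc_lam;
  bc_rhoP : right_coaction bc_rho;
  bc_compat : forall m,
    tassoc _ _ _ (tmap bc_lam (bid D) (bc_rho m)) =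
    tmap (bid C) bc_rho (bc_lam m) }.

Definition colinear (k : comPzRingType) (R A : kalg k) (C : coring A)
    (M N : bimod R A) (rhoM : bhom M (M ⊗ C)) (rhoN : bhom N (N ⊗ C))
    (f : bhom M N) : Prop :=
  forall m, rhoN (f m) = tmap f (bid C) (rhoM m).

Definition lcolinear (k : comPzRingType) (A S : kalg k) (C : coring A)
    (M N : bimod A S) (lamM : bhom M (C ⊗ M)) (lamN : bhom N (C ⊗ N))
    (f : bhom M N) : Prop :=
  forall m, lamN (f m) = tmap (bid C) f (lamM m).

Section Cotensor.
Variables (k : comPzRingType) (R A S : kalg k) (C : coring A).
Variables (M : bimod R A) (rho : bhom M (M ⊗ C)).
Variables (N : bimod A S) (lam : bhom N (C ⊗ N)).

Definition cot_f : bhom (M ⊗ N) (M ⊗ (C ⊗ N)) :=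
  bcomp (tassoc M C N) (tmap rho (bid N)).
Definition cot_g : bhom (M ⊗ N) (M ⊗ (C ⊗ N)) := tmap (bid M) lam.

(* M □_C N, the kernel of rho ⊗ N - M ⊗ lam, as the equalizer of the two maps. *)
Definition cotensor : bimod R S := beq cot_f cot_g.
Definition cot_incl : bhom cotensor (M ⊗ N) := bincl cot_f cot_g.

Lemma cot_incl_inj : injective cot_incl. Proof. exact: bincl_inj. Qed.

End Cotensor.

Section CotensorRight.
Variables (k : comPzRingType) (R A B : kalg k) (C : coring A) (D : coring B).
Variables (M : bimod R A) (rho : bhom M (M ⊗ C)).
Variables (N : bicomod C D) (hD : left_flat D).

Let E := cotensor rho (bc_lam N).
Let io : bhom E (M ⊗ N) := cot_incl rho (bc_lam N).

Definition cotr_i : bhom (E ⊗ D) (M ⊗ (N ⊗ D)) :=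
  bcomp (tassoc _ _ _) (tmap io (bid D)).
Definition cotr_h : bhom E (M ⊗ (N ⊗ D)) := bcomp (tmap (bid M) (bc_rho N)) io.

Lemma cotr_i_inj : injective cotr_i.
Proof.
apply: inj_comp; first exact: tassoc_inj.
by apply: left_flat_inj => //; apply: cot_incl_inj.
Qed.

Lemma cotr_ex z : exists w, cotr_i w = cotr_h z.
Proof.
pose f := cot_f rho N; pose g := cot_g M (bc_lam N).
pose Phi : bhom (M ⊗ (C ⊗ N)) ((M ⊗ (C ⊗ N)) ⊗ D) :=
  bcomp (tassocV _ _ _) (bcomp (tmap (bid M) (tassocV _ _ _))
    (tmap (bid M) (tmap (bid C) (bc_rho N)))).
have fE u : tmap f (bid D) (tassocV _ _ _ (tmap (bid M) (bc_rho N) u)) =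
            Phi (f u).
  transitivity (tmap (tassoc M C N) (bid D)
    (tassocV _ _ _ (tmap rho (bc_rho N) u))).
    elim/tensor_ind: u => [m n|x y hx hy]; last by rewrite !bhomD hx hy.
    rewrite !tmapE; elim/tensor_ind: (bc_rho N n) => [n' d|x y hx hy].
      by rewrite !bhomE.
    by rewrite !pureDr !bhomD hx hy.
  have -> : f u = tassoc M C N (tmap rho (bid N) u) by [].
  have -> : tmap rho (bc_rho N) u =
            tmap (bid (M ⊗ C)) (bc_rho N) (tmap rho (bid N) u).
    elim/tensor_ind: u => [m n|x y hx hy]; last by rewrite !bhomD hx hy.
    by rewrite !bhomE.
  elim/tensor_ind: (tmap rho (bid N) u) => [x n|x y hx hy];
    last by rewrite !bhomD hx hy.
  elim/tensor_ind: x => [m c|x y hx hy]; last by rewrite !pureDl !bhomD hx hy.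
  rewrite /Phi !bhomE.
  elim/tensor_ind: (bc_rho N n) => [n' d|x y hx hy]; first by rewrite !bhomE.
  by rewrite !(pureDr, bhomD) hx hy.
have gE u : tmap g (bid D) (tassocV _ _ _ (tmap (bid M) (bc_rho N) u)) =
            Phi (g u).
  elim/tensor_ind: u => [m n|x y hx hy]; last by rewrite !bhomD hx hy.
  rewrite /g /Phi !bhomE -bc_compat tassocK.
  elim/tensor_ind: (bc_rho N n) => [n' d|x y hx hy]; first by rewrite !bhomE.
  by rewrite !(pureDr, bhomD) hx hy.
have [|w hw] := left_flat_beq (f := f) (g := g) hD
    (y := tassocV _ _ _ (cotr_h z)).
  by rewrite fE gE /f /g binclP.
by exists w; rewrite /cotr_i bcompE hw tassocVK.
Qed.

(* The restriction to E = M □_C N of M ⊗ rho_N; it takes its values in E ⊗ D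
   because - ⊗ D preserves the kernel E. *)
Definition cotr_rho : bhom E (E ⊗ D) := bfactor cotr_i_inj cotr_ex.

Lemma cotr_rhoE z :
  tmap io (bid D) (cotr_rho z) = tassocV _ _ _ (tmap (bid M) (bc_rho N) (io z)).
Proof.
apply: tassoc_inj; rewrite tassocVK.
exact: (bfactorE cotr_i_inj cotr_ex).
Qed.

Lemma cotr_rhoP : right_coaction cotr_rho.
Proof.
split=> z.
  pose T : bhom ((M ⊗ (N ⊗ D)) ⊗ D) (M ⊗ (N ⊗ (D ⊗ D))) :=
    bcomp (tmap (bid M) (tassoc _ _ _)) (tassoc _ _ _).
  pose j : bhom (E ⊗ (D ⊗ D)) (M ⊗ (N ⊗ (D ⊗ D))) :=
    bcomp (tassoc _ _ _) (tmap io (bid _)).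
  have jT w : j (tassoc _ _ _ w) = T (tmap cotr_i (bid D) w).
    elim/tensor_ind: w => [w d|x y hx hy]; last by rewrite !bhomD hx hy.
    elim/tensor_ind: w => [e d'|x y hx hy]; last by rewrite !(pureDl, bhomD) hx hy.
    rewrite /j /T !bhomE.
    elim/tensor_ind: (io e) => [m n|x y hx hy]; last by rewrite !(pureDl, bhomD) hx hy.
    by rewrite !bhomE.
  have j_inj : injective j.
    have i2 : injective (tmap (tmap io (bid D)) (bid D)).
      by do 2!apply: left_flat_inj => //; apply: cot_incl_inj.
    suff e w : tassocV _ _ _ (j w) =
        tassoc _ _ _ (tmap (tmap io (bid D)) (bid D) (tassocV _ _ _ w)) :> M ⊗ N ⊗ (D ⊗ D).
      move=> x y /(congr1 (tassocV _ _ _)); rewrite !e => /tassoc_inj/i2.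
      by move/(congr1 (tassoc _ _ _)); rewrite !tassocVK.
    rewrite /j bcompE tassocK; elim/tensor_ind: w => [e' w|x y hx hy]; last by rewrite !bhomD hx hy.
    elim/tensor_ind: w => [d d'|x y hx hy]; last by rewrite !(pureDr, bhomD) hx hy.
    by rewrite !bhomE.
  apply: j_inj; rewrite jT.
  have -> w : tmap cotr_i (bid D) (tmap cotr_rho (bid D) w) =
     tmap (tmap (bid M) (bc_rho N)) (bid D) (tmap io (bid D) w).
    elim/tensor_ind: w => [w d|x y hx hy]; last by rewrite !bhomD hx hy.
    by rewrite /cotr_i !bhomE cotr_rhoE tassocVK.
  rewrite cotr_rhoE.
  have -> : j (tmap (bid E) (cor_delta D) (cotr_rho z)) =
     tassoc _ _ _ (tmap (bid (M ⊗ N)) (cor_delta D) (tmap io (bid D) (cotr_rho z))).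
    elim/tensor_ind: (cotr_rho z) => [e d|x y hx hy]; last by rewrite !bhomD hx hy.
    by rewrite /j !bhomE.
  rewrite cotr_rhoE.
  elim/tensor_ind: (io z) => [m n|x y hx hy]; last by rewrite !bhomD hx hy.
  transitivity (m ⊙ tassoc _ _ _ (tmap (bc_rho N) (bid D) (bc_rho N n))).
    rewrite tmapE; elim/tensor_ind: (bc_rho N n) => [n' d|x y hx hy].
      by rewrite /T !bhomE.
    by rewrite !(pureDr, bhomD) hx hy.
  rewrite (rcoact_assoc (bc_rhoP N)) tmapE.
  elim/tensor_ind: (bc_rho N n) => [n' d|x y hx hy].
    by rewrite /T !bhomE.
  by rewrite !(pureDr, bhomD) hx hy.
apply: (@cot_incl_inj _ _ _ _ _ _ rho _ (bc_lam N)); rewrite -/io.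
have -> w : io (runit E w) = runit (M ⊗ N) (tmap io (bid _) w).
  elim/tensor_ind: w => [e b|x y hx hy]; last by rewrite !bhomD hx hy.
  by rewrite !bhomE bhomR.
have -> w : tmap io (bid _) (tmap (bid E) (cor_eps D) w) =
            tmap (bid _) (cor_eps D) (tmap io (bid D) w).
  elim/tensor_ind: w => [e b|x y hx hy]; last by rewrite !bhomD hx hy.
  by rewrite !bhomE.
rewrite cotr_rhoE.
elim/tensor_ind: (io z) => [m n|x y hx hy]; last by rewrite !bhomD hx hy.
rewrite -[in RHS](rcoact_counit (bc_rhoP N) n) tmapE.
elim/tensor_ind: (bc_rho N n) => [n' d|x y hx hy].
  by rewrite !bhomE ract_pure.
by rewrite !(pureDr, bhomD) hx hy.
Qed.

End CotensorRight.

Section CotensorLeft.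
Variables (k : comPzRingType) (Q A S : kalg k) (H : coring Q) (C : coring A).
Variables (M : bicomod H C) (N : bimod A S) (lam : bhom N (C ⊗ N)).
Variable hH : right_flat H.

Let E := cotensor (bc_rho M) lam.
Let io : bhom E (M ⊗ N) := cot_incl (bc_rho M) lam.

Definition cotl_h : bhom E (H ⊗ (M ⊗ N)) :=
  bcomp (tassoc _ _ _) (bcomp (tmap (bc_lam M) (bid N)) io).

Lemma cotl_i_inj : injective (tmap (bid H) io).
Proof. by apply: right_flat_inj => //; apply: cot_incl_inj. Qed.

Lemma cotl_ex z : exists w, tmap (bid H) io w = cotl_h z.
Proof.
pose f := cot_f (bc_rho M) N; pose g := cot_g M lam.
pose Phi : bhom (M ⊗ (C ⊗ N)) (H ⊗ (M ⊗ (C ⊗ N))) :=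
  bcomp (tassoc _ _ _) (tmap (bc_lam M) (bid (C ⊗ N))).
have gE u : tmap (bid H) g (tassoc _ _ _ (tmap (bc_lam M) (bid N) u)) =
            Phi (g u).
  elim/tensor_ind: u => [m n|x y hx hy]; last by rewrite !bhomD hx hy.
  rewrite !bhomE.
  elim/tensor_ind: (bc_lam M m) => [c m'|x y hx hy]; first by rewrite !bhomE.
  by rewrite !(pureDl, bhomD) hx hy.
have fE u : tmap (bid H) f (tassoc _ _ _ (tmap (bc_lam M) (bid N) u)) =
            Phi (f u).
  elim/tensor_ind: u => [m n|x y hx hy]; last by rewrite !bhomD hx hy.
  transitivity (tmap (bid H) (tassoc _ _ _)
    (tassoc _ _ _ (tmap (bid H) (bc_rho M) (bc_lam M m) ⊙ n))).
    rewrite tmapE.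
    elim/tensor_ind: (bc_lam M m) => [c m'|x y hx hy]; first by rewrite !bhomE.
    by rewrite !(pureDl, bhomD) hx hy.
  rewrite -bc_compat.
  have -> : f (m ⊙ n) = tassoc _ _ _ (bc_rho M m ⊙ n) by rewrite !bhomE.
  elim/tensor_ind: (bc_rho M m) => [m' c|x y hx hy];
    last by rewrite !(pureDl, bhomD) hx hy.
  rewrite !bhomE.
  elim/tensor_ind: (bc_lam M m') => [c' m''|x y hx hy]; first by rewrite !bhomE.
  by rewrite !(pureDl, bhomD) hx hy.
have [|w hw] := right_flat_beq (f := f) (g := g) hH (y := cotl_h z).
  by rewrite fE gE /f /g binclP.
by exists w; rewrite hw.
Qed.

(* The restriction of lam_M ⊗ N to E = M □_C N. *)
Definition cotl_lam : bhom E (H ⊗ E) := bfactor cotl_i_inj cotl_ex.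

Lemma cotl_lamE z :
  tmap (bid H) io (cotl_lam z) = tassoc _ _ _ (tmap (bc_lam M) (bid N) (io z)).
Proof. exact: (bfactorE cotl_i_inj cotl_ex). Qed.

Lemma cotl_lamP : left_coaction cotl_lam.
Proof.
split=> z.
  pose j : bhom (H ⊗ (H ⊗ E)) (H ⊗ (H ⊗ (M ⊗ N))) :=
    tmap (bid H) (tmap (bid H) io).
  have j_inj : injective j.
    by do 2!apply: right_flat_inj => //; apply: cot_incl_inj.
  apply: j_inj.
  have -> w : j (tassoc _ _ _ (tmap (cor_delta H) (bid E) w)) =
    tassoc _ _ _ (tmap (cor_delta H) (bid (M ⊗ N)) (tmap (bid H) io w)).
    elim/tensor_ind: w => [h e|x y hx hy]; last by rewrite !bhomD hx hy.
    rewrite !bhomE.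
    elim/tensor_ind: (cor_delta H h) => [h' h''|x y hx hy]; first by rewrite !bhomE.
    by rewrite !(pureDl, bhomD) hx hy.
  have -> w : j (tmap (bid H) cotl_lam w) =
    tmap (bid H) (bcomp (tassoc _ _ _) (tmap (bc_lam M) (bid N)))
      (tmap (bid H) io w).
    elim/tensor_ind: w => [h e|x y hx hy]; last by rewrite !bhomD hx hy.
    by rewrite /j 3!tmapE cotl_lamE !bhomE.
  rewrite cotl_lamE.
  elim/tensor_ind: (io z) => [m n|x y hx hy]; last by rewrite !bhomD hx hy.
  rewrite tmapE bidE.
  transitivity (tmap (bid H) (tassoc _ _ _)
    (tassoc _ _ _ (tassoc _ _ _ (tmap (cor_delta H) (bid M) (bc_lam M m)) ⊙ n))).
    elim/tensor_ind: (bc_lam M m) => [h m'|x y hx hy];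
      last by rewrite !(pureDl, bhomD) hx hy.
    rewrite !bhomE.
    elim/tensor_ind: (cor_delta H h) => [h' h''|x y hx hy]; first by rewrite !bhomE.
    by rewrite !(pureDl, bhomD) hx hy.
  rewrite (lcoact_assoc (bc_lamP M)).
  elim/tensor_ind: (bc_lam M m) => [h m'|x y hx hy];
    last by rewrite !(pureDl, bhomD) hx hy.
  by rewrite !bhomE.
apply: (@cot_incl_inj _ _ _ _ _ _ (bc_rho M) _ lam); rewrite -/io.
have -> w : io (lunit E w) = lunit (M ⊗ N) (tmap (bid _) io w).
  elim/tensor_ind: w => [e b|x y hx hy]; last by rewrite !bhomD hx hy.
  by rewrite !bhomE bhomL.
have -> w : tmap (bid _) io (tmap (cor_eps H) (bid E) w) =
            tmap (cor_eps H) (bid _) (tmap (bid H) io w).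
  elim/tensor_ind: w => [e b|x y hx hy]; last by rewrite !bhomD hx hy.
  by rewrite !bhomE.
rewrite cotl_lamE.
elim/tensor_ind: (io z) => [m n|x y hx hy]; last by rewrite !bhomD hx hy.
rewrite -[in RHS](lcoact_counit (bc_lamP M) m) tmapE bidE.
elim/tensor_ind: (bc_lam M m) => [h m'|x y hx hy].
  by rewrite !bhomE lact_pure.
by rewrite !(pureDl, bhomD) hx hy.
Qed.

End CotensorLeft.

Section CotensorBicomod.
Variables (k : comPzRingType) (Q A B : kalg k).
Variables (H : coring Q) (C : coring A) (D : coring B).
Variables (hH : right_flat H) (hD : left_flat D).
Variables (X : bicomod H C) (Y : bicomod C D).

Let io := cot_incl (bc_rho X) (bc_lam Y).

Lemma cot_compat z :
  tassoc _ _ _ (tmap (cotl_lam X (bc_lam Y) hH) (bid D)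
                     (cotr_rho (bc_rho X) Y hD z)) =
  tmap (bid H) (cotr_rho (bc_rho X) Y hD) (cotl_lam X (bc_lam Y) hH z).
Proof.
pose lE := cotl_lam X (bc_lam Y) hH.
pose rE := cotr_rho (bc_rho X) Y hD.
pose ir := cotr_i (D := D) (bc_rho X) Y.
have ir_inj : injective (tmap (bid H) ir).
  by apply: right_flat_inj => //; apply: cotr_i_inj.
apply: ir_inj; rewrite -/lE -/rE.
have -> w : tmap (bid H) ir (tassoc _ _ _ (tmap lE (bid D) w)) =
  tmap (bid H) (tassoc _ _ _) (tassoc _ _ _
    (tmap (bcomp (tassoc _ _ _) (tmap (bc_lam X) (bid Y))) (bid D)
      (tmap io (bid D) w))).
  elim/tensor_ind: w => [e d|x y hx hy]; last by rewrite !bhomD hx hy.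
  rewrite 3!tmapE !bidE bcompE -cotl_lamE -/lE -/io.
  elim/tensor_ind: (lE e) => [h e'|x y hx hy]; first by rewrite !bhomE.
  by rewrite !(pureDl, bhomD) hx hy.
rewrite /rE /io cotr_rhoE -/io -/rE.
have -> w : tmap (bid H) ir (tmap (bid H) rE w) =
  tmap (bid H) (tmap (bid X) (bc_rho Y)) (tmap (bid H) io w).
  elim/tensor_ind: w => [h e|x y hx hy]; last by rewrite !bhomD hx hy.
  by rewrite !tmapE /ir bcompE cotr_rhoE tassocVK.
rewrite /lE /io cotl_lamE -/io -/lE.
elim/tensor_ind: (io z) => [m n|x y hx hy]; last by rewrite !bhomD hx hy.
rewrite !tmapE !bidE.
transitivity (tmap (bid H) (tassoc _ _ _)
  (tassoc _ _ _ (tmap (tassoc _ _ _) (bid D)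
     (tassocV _ _ _ (bc_lam X m ⊙ bc_rho Y n))))).
  elim/tensor_ind: (bc_rho Y n) => [n' d|x y hx hy]; first by rewrite !bhomE.
  by rewrite !(pureDr, bhomD) hx hy.
elim/tensor_ind: (bc_lam X m) => [h m'|x y hx hy];
  last by rewrite !(pureDl, bhomD) hx hy.
rewrite !bhomE.
elim/tensor_ind: (bc_rho Y n) => [n' d|x y hx hy]; first by rewrite !bhomE.
by rewrite !(pureDr, bhomD) hx hy.
Qed.

(* X □_C Y as a bicomodule. *)
Definition cot : bicomod H D :=
  Bicomod (cotl_lamP X (bc_lam Y) hH) (cotr_rhoP (bc_rho X) Y hD) cot_compat.

End CotensorBicomod.

Record category := Category {
  cat_ob :> Type;
  cat_hom : cat_ob -> cat_ob -> Type;
  cat_id : forall X, cat_hom X X;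
  cat_comp : forall X Y Z, cat_hom Y Z -> cat_hom X Y -> cat_hom X Z;
  cat_idl : forall X Y (f : cat_hom X Y), cat_comp (cat_id Y) f = f;
  cat_idr : forall X Y (f : cat_hom X Y), cat_comp f (cat_id X) = f;
  cat_assoc : forall X Y Z T (h : cat_hom Z T) (g : cat_hom Y Z) (f : cat_hom X Y),
    cat_comp h (cat_comp g f) = cat_comp (cat_comp h g) f }.

Arguments cat_id {_} X.
Arguments cat_comp {_ X Y Z} g f.

Record functor (C D : category) := Functor {
  fun_ob :> C -> D;
  fun_hom : forall X Y, cat_hom X Y -> cat_hom (fun_ob X) (fun_ob Y);
  fun_id : forall X, fun_hom (cat_id X) = cat_id (fun_ob X);
  fun_comp : forall X Y Z (g : cat_hom Y Z) (f : cat_hom X Y),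
    fun_hom (cat_comp g f) = cat_comp (fun_hom g) (fun_hom f) }.

Arguments fun_hom {C D} _ {X Y} _.

Definition functor_id (C : category) : functor C C :=
  @Functor C C id (fun _ _ f => f) (fun _ => erefl) (fun _ _ _ _ _ => erefl).

Section FunctorComp.
Variables (C D E : category) (G : functor D E) (F : functor C D).
Lemma functor_comp_id (X : C) : fun_hom G (fun_hom F (cat_id X)) = cat_id _.
Proof. by rewrite !fun_id. Qed.
Lemma functor_comp_comp (X Y Z : C) (g : cat_hom Y Z) (f : cat_hom X Y) :
  fun_hom G (fun_hom F (cat_comp g f)) =
  cat_comp (fun_hom G (fun_hom F g)) (fun_hom G (fun_hom F f)).
Proof. by rewrite !fun_comp. Qed.
Definition functor_comp : functor C E :=
  @Functor C E (fun X => G (F X)) (fun _ _ f => fun_hom G (fun_hom F f))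
    functor_comp_id functor_comp_comp.
End FunctorComp.

Definition natural_iso (C D : category) (F G : functor C D) : Prop :=
  exists (u : forall X, cat_hom (F X) (G X)) (v : forall X, cat_hom (G X) (F X)),
    [/\ forall X Y (f : cat_hom X Y),
          cat_comp (u Y) (fun_hom F f) = cat_comp (fun_hom G f) (u X),
        forall X, cat_comp (v X) (u X) = cat_id _ &
        forall X, cat_comp (u X) (v X) = cat_id _].

Definition is_equivalence (C D : category) (F : functor C D) : Prop :=
  exists G : functor D C,
    natural_iso (functor_comp G F) (functor_id C) /\
    natural_iso (functor_comp F G) (functor_id D).

Section ComodCategory.
Variables (k : comPzRingType) (A : kalg k) (C : coring A).

Record rcomod_hom (M N : rcomod C) := RComodHom {
  rch_fun :> bhom M N;
  rch_colinear : colinear (rc_rho M) (rc_rho N) rch_fun }.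

Lemma rcomod_hom_ext (M N : rcomod C) (f g : rcomod_hom M N) : f =1 g -> f = g.
Proof.
case: f g => [f fP] [g gP] /= /bhom_ext e.
by move: gP; rewrite -e => gP; congr RComodHom; apply: Prop_irrelevance.
Qed.

Lemma tmap_id (A1 A2 A3 : kalg k) (M : bimod A1 A2) (N : bimod A2 A3) x :
  tmap (bid M) (bid N) x = x.
Proof.
elim/tensor_ind: x => [m n|x y hx hy]; first by rewrite tmapE.
by rewrite bhomD hx hy.
Qed.

Lemma tmap_comp (A1 A2 A3 : kalg k) (M M' M'' : bimod A1 A2)
    (N N' N'' : bimod A2 A3) (f : bhom M M') (f' : bhom M' M'')
    (g : bhom N N') (g' : bhom N' N'') x :
  tmap f' g' (tmap f g x) = tmap (bcomp f' f) (bcomp g' g) x.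
Proof.
elim/tensor_ind: x => [m n|x y hx hy]; first by rewrite !tmapE.
by rewrite !bhomD hx hy.
Qed.

Lemma colinear_id (M : rcomod C) : colinear (rc_rho M) (rc_rho M) (bid M).
Proof. by move=> m; rewrite tmap_id. Qed.

Lemma colinear_comp (M N P : rcomod C) (g : rcomod_hom N P)
  (f : rcomod_hom M N) : colinear (rc_rho M) (rc_rho P) (bcomp g f).
Proof.
move=> m; rewrite bcompE (rch_colinear g) (rch_colinear f) tmap_comp.
by congr (tmap _ _ _); apply: bhom_ext.
Qed.

Definition rcomod_id M := RComodHom (@colinear_id M).
Definition rcomod_comp M N P (g : rcomod_hom N P) (f : rcomod_hom M N) :=
  RComodHom (colinear_comp g f).

Lemma rcomod_idl M N (f : rcomod_hom M N) : rcomod_comp (rcomod_id N) f = f.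
Proof. exact: rcomod_hom_ext. Qed.
Lemma rcomod_idr M N (f : rcomod_hom M N) : rcomod_comp f (rcomod_id M) = f.
Proof. exact: rcomod_hom_ext. Qed.
Lemma rcomod_assoc M N P Q (h : rcomod_hom P Q) (g : rcomod_hom N P)
    (f : rcomod_hom M N) :
  rcomod_comp h (rcomod_comp g f) = rcomod_comp (rcomod_comp h g) f.
Proof. exact: rcomod_hom_ext. Qed.

Definition comod : category := Category rcomod_idl rcomod_idr rcomod_assoc.

End ComodCategory.

Section CotensorFunctor.
Variables (k : comPzRingType) (A B : kalg k) (C : coring A) (D : coring B).
Variables (hD : left_flat D) (X : bicomod C D).

Definition cot_ob (M : rcomod C) : rcomod D :=
  RComod (cotr_rhoP (rc_rho M) X hD).

Section Hom.
Variables (M N : rcomod C) (f : rcomod_hom M N).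

Let ioM := cot_incl (rc_rho M) (bc_lam X).
Let ioN := cot_incl (rc_rho N) (bc_lam X).

Lemma cot_hom_ex z : exists w, ioN w = bcomp (tmap f (bid X)) ioM z.
Proof.
apply: bincl_ex; rewrite bcompE.
have fE u : cot_f (rc_rho N) X (tmap f (bid X) u) =
            tmap f (bid _) (cot_f (rc_rho M) X u).
  elim/tensor_ind: u => [m x|x y hx hy]; last by rewrite !bhomD hx hy.
  rewrite tmapE /cot_f !bcompE !tmapE (rch_colinear f) !bidE.
  elim/tensor_ind: (rc_rho M m) => [m' c|u v hu hv]; first by rewrite !bhomE.
  by rewrite !(pureDl, bhomD) hu hv.
have gE u : cot_g N (bc_lam X) (tmap f (bid X) u) =
            tmap f (bid _) (cot_g M (bc_lam X) u).
  elim/tensor_ind: u => [m x|x y hx hy]; last by rewrite !bhomD hx hy.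
  by rewrite !bhomE.
by rewrite fE gE binclP.
Qed.

Definition cot_hom_bhom : bhom (cot_ob M) (cot_ob N) :=
  bfactor (@cot_incl_inj _ _ _ _ _ _ (rc_rho N) _ (bc_lam X)) cot_hom_ex.

Lemma cot_hom_bhomE z : ioN (cot_hom_bhom z) = tmap f (bid X) (ioM z).
Proof. exact: bfactorE. Qed.

Lemma cot_hom_colinear :
  colinear (rc_rho (cot_ob M)) (rc_rho (cot_ob N)) cot_hom_bhom.
Proof.
move=> z.
have inj : injective (tmap ioN (bid D)).
  by apply: left_flat_inj => //; apply: cot_incl_inj.
apply: inj; rewrite cotr_rhoE -/ioN cot_hom_bhomE.
have -> w : tmap ioN (bid D) (tmap cot_hom_bhom (bid D) w) =
            tmap (tmap f (bid X)) (bid D) (tmap ioM (bid D) w).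
  elim/tensor_ind: w => [e d|x y hx hy]; last by rewrite !bhomD hx hy.
  by rewrite !tmapE cot_hom_bhomE.
rewrite cotr_rhoE -/ioM.
elim/tensor_ind: (ioM z) => [m x|x y hx hy]; last by rewrite !bhomD hx hy.
rewrite !tmapE !bidE.
elim/tensor_ind: (bc_rho X x) => [x' d|u v hu hv]; first by rewrite !bhomE.
by rewrite !(pureDr, bhomD) hu hv.
Qed.

Definition cot_hom : rcomod_hom (cot_ob M) (cot_ob N) :=
  RComodHom cot_hom_colinear.

End Hom.

Lemma cot_hom_id (M : rcomod C) : cot_hom (rcomod_id M) = rcomod_id (cot_ob M).
Proof.
apply: rcomod_hom_ext => z.
apply: (@cot_incl_inj _ _ _ _ _ _ (rc_rho M) _ (bc_lam X)).
by rewrite cot_hom_bhomE tmap_id.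
Qed.

Lemma cot_hom_comp (M N P : rcomod C) (g : rcomod_hom N P)
    (f : rcomod_hom M N) :
  cot_hom (rcomod_comp g f) = rcomod_comp (cot_hom g) (cot_hom f).
Proof.
apply: rcomod_hom_ext => z.
apply: (@cot_incl_inj _ _ _ _ _ _ (rc_rho P) _ (bc_lam X)).
rewrite (cot_hom_bhomE (rcomod_comp g f)) [RHS](cot_hom_bhomE g).
rewrite (cot_hom_bhomE f) tmap_comp.
by congr (tmap _ _ _); apply: bhom_ext.
Qed.

Definition cot_functor : functor (comod C) (comod D) :=
  @Functor (comod C) (comod D) cot_ob cot_hom cot_hom_id cot_hom_comp.

Definition right_invertible : Prop := is_equivalence cot_functor.

End CotensorFunctor.

Definition MT_right_equivalent (k : comPzRingType) (A B : kalg k)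
    (C : coring A) (D : coring B) (hD : left_flat D) : Prop :=
  exists X : bicomod C D, right_invertible hD X.

(* The type of isomorphism classes of bicomodules lives in a universe above
   that of zmodType, which rules out MathComp's groupType. *)
Record group := Group {
  grp_sort :> Type;
  gmul : grp_sort -> grp_sort -> grp_sort;
  gone : grp_sort;
  ginv : grp_sort -> grp_sort;
  gmulA : associative gmul;
  gmul1l : left_id gone gmul;
  gmul1r : right_id gone gmul;
  gmulVl : left_inverse gone ginv gmul;
  gmulVr : right_inverse gone ginv gmul }.

Arguments gmul {g} _ _.
Arguments gone {g}.
Arguments ginv {g} _.

Definition group_hom (G H : group) (f : G -> H) : Prop :=
  forall x y, f (gmul x y) = gmul (f x) (f y).

Definition group_isomorphic (G H : group) : Prop :=
  exists f : G -> H, group_hom f /\ bijective f.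

(* Exactness of 1 -> G -> H -> K. *)
Definition left_exact_groups (G H K : group) (i : G -> H) (p : H -> K) : Prop :=
  [/\ group_hom i, group_hom p, injective i &
      forall y, p y = gone <-> exists x, i x = y].

Record normal_subgroup (G : group) (N : G -> Prop) : Prop := NormalSubgroup {
  nsub1 : N gone;
  nsubM : forall x y, N x -> N y -> N (gmul x y);
  nsubV : forall x, N x -> N (ginv x);
  nsubJ : forall x y, N x -> N (gmul (gmul (ginv y) x) y) }.

Section SubgroupQuotient.
Variables (G : group) (N : G -> Prop) (hN : normal_subgroup N).

Lemma sig_eq (T : Type) (P : T -> Prop) (x y : {z | P z}) :
  sval x = sval y -> x = y.
Proof.
case: x y => [x hx] [y hy] /= e; move: hy; rewrite -e => hy.
by congr exist; apply: Prop_irrelevance.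
Qed.

Definition sub_mul (x y : {z | N z}) : {z | N z} :=
  exist N _ (nsubM hN (svalP x) (svalP y)).
Definition sub_one : {z | N z} := exist N _ (nsub1 hN).
Definition sub_inv (x : {z | N z}) : {z | N z} :=
  exist N _ (nsubV hN (svalP x)).

Lemma sub_mulA : associative sub_mul.
Proof. by move=> x y z; apply: sig_eq; apply: gmulA. Qed.
Lemma sub_mul1l : left_id sub_one sub_mul.
Proof. by move=> x; apply: sig_eq; apply: gmul1l. Qed.
Lemma sub_mul1r : right_id sub_one sub_mul.
Proof. by move=> x; apply: sig_eq; apply: gmul1r. Qed.
Lemma sub_mulVl : left_inverse sub_one sub_inv sub_mul.
Proof. by move=> x; apply: sig_eq; apply: gmulVl. Qed.
Lemma sub_mulVr : right_inverse sub_one sub_inv sub_mul.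
Proof. by move=> x; apply: sig_eq; apply: gmulVr. Qed.

Definition subgroup : group :=
  Group sub_mulA sub_mul1l sub_mul1r sub_mulVl sub_mulVr.
Definition subgroup_incl (x : subgroup) : G := sval x.

Definition coset (x : G) : G -> Prop := fun y => N (gmul (ginv x) y).
Definition quotient_sort := {P : G -> Prop | exists x, P = coset x}.
Definition quotient_map (x : G) : quotient_sort :=
  exist _ (coset x) (ex_intro _ x erefl).

Lemma quotient_map_ex (P : quotient_sort) : exists x, quotient_map x = P.
Proof. by case: P => P [x e]; exists x; apply: sig_eq. Qed.

Definition quotient_repr (P : quotient_sort) : G := projT1 (cid (quotient_map_ex P)).
Lemma quotient_reprK P : quotient_map (quotient_repr P) = P.
Proof. exact: projT2 (cid (quotient_map_ex P)). Qed.

Lemma ginvM (x y : G) : ginv (gmul x y) = gmul (ginv y) (ginv x).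
Proof.
rewrite -[LHS]gmul1r -(gmulVr x) -[in X in gmul _ (gmul X _)](gmul1r x).
by rewrite -{1}(gmulVr y) !gmulA -(gmulA _ x y) gmulVl gmul1l.
Qed.

Lemma ginvK (x : G) : ginv (ginv x) = x.
Proof. by rewrite -[LHS]gmul1r -(gmulVl x) gmulA gmulVl gmul1l. Qed.

Lemma quotient_mapP x y :
  quotient_map x = quotient_map y <-> N (gmul (ginv x) y).
Proof.
split=> [[] e|h].
  suff : coset x y by [].
  by rewrite e /coset gmulVl; apply: nsub1.
apply: sig_eq; apply/funext => z /=; apply/propext; split=> hz; rewrite /coset.
  suff -> : gmul (ginv y) z = gmul (ginv (gmul (ginv x) y)) (gmul (ginv x) z).
    by apply: nsubM => //; apply: nsubV.
  by rewrite ginvM ginvK gmulA -(gmulA _ x) gmulVr gmul1r.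
suff -> : gmul (ginv x) z = gmul (gmul (ginv x) y) (gmul (ginv y) z).
  exact: nsubM.
by rewrite gmulA -(gmulA _ y) gmulVr gmul1r.
Qed.

Definition quotient_mul (P Q : quotient_sort) : quotient_sort :=
  quotient_map (gmul (quotient_repr P) (quotient_repr Q)).
Definition quotient_inv (P : quotient_sort) : quotient_sort :=
  quotient_map (ginv (quotient_repr P)).

Lemma quotient_mulE x y :
  quotient_mul (quotient_map x) (quotient_map y) = quotient_map (gmul x y).
Proof.
apply/quotient_mapP.
have /quotient_mapP hx := quotient_reprK (quotient_map x).
have /quotient_mapP hy := quotient_reprK (quotient_map y).
move: hx hy; set a := quotient_repr (quotient_map x).
set b := quotient_repr (quotient_map y) => hx hy.
suff -> : gmul (ginv (gmul a b)) (gmul x y) =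
  gmul (gmul (ginv b) y) (gmul (gmul (ginv y) (gmul (ginv a) x)) y).
  by apply: nsubM => //; apply: nsubJ.
by rewrite ginvM !gmulA -(gmulA _ y (ginv y)) gmulVr gmul1r.
Qed.

Lemma quotient_mulA : associative quotient_mul.
Proof.
move=> P Q R; rewrite -(quotient_reprK P) -(quotient_reprK Q) -(quotient_reprK R).
by rewrite !quotient_mulE gmulA.
Qed.
Lemma quotient_mul1l : left_id (quotient_map gone) quotient_mul.
Proof. by move=> P; rewrite -(quotient_reprK P) quotient_mulE gmul1l. Qed.
Lemma quotient_mul1r : right_id (quotient_map gone) quotient_mul.
Proof. by move=> P; rewrite -(quotient_reprK P) quotient_mulE gmul1r. Qed.
Lemma quotient_mulVl : left_inverse (quotient_map gone) quotient_inv quotient_mul.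
Proof.
by move=> P; rewrite -{2}(quotient_reprK P) /quotient_inv quotient_mulE gmulVl.
Qed.
Lemma quotient_mulVr : right_inverse (quotient_map gone) quotient_inv quotient_mul.
Proof.
by move=> P; rewrite -{1}(quotient_reprK P) /quotient_inv quotient_mulE gmulVr.
Qed.

Definition quotient : group :=
  Group quotient_mulA quotient_mul1l quotient_mul1r quotient_mulVl quotient_mulVr.

End SubgroupQuotient.

Section BijInverse.
Variables (T : Type) (f : T -> T) (fB : bijective f).
Lemma binv_ex : exists g, cancel f g /\ cancel g f.
Proof. by case: fB => g h1 h2; exists g. Qed.
Definition binv : T -> T := projT1 (cid binv_ex).
Lemma binvK : cancel f binv. Proof. by case: (projT2 (cid binv_ex)). Qed.
Lemma binvVK : cancel binv f. Proof. by case: (projT2 (cid binv_ex)). Qed.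
Lemma binv_bij : bijective binv.
Proof. by exists f; [apply: binvVK | apply: binvK]. Qed.
End BijInverse.

(* sweedler c s reads: s lists the terms of an expansion
   Delta(c) = \sum c_(1) ⊗ c_(2).  An identity written in Sweedler notation is
   required for all expansions; in particular its two sides do not depend on
   the chosen expansion. *)
Definition sweedler (k : comPzRingType) (A : kalg k) (C : coring A) (c : C)
    (s : seq (C * C)) : Prop :=
  cor_delta C c = \sum_(p <- s) p.1 ⊙ p.2.

Section Automorphisms.
Variables (k : comPzRingType) (A : kalg k) (C : coring A).

Record caut_axioms (phi : C -> C) (rho : A -> A) : Prop := CAutAxioms {
  caut_rhoD : forall a b, rho (a + b) = rho a + rho b;
  caut_rhoM : forall a b, rho (a * b) = rho a * rho b;
  caut_rho_k : forall x, rho (kalg_map A x) = kalg_map A x;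
  caut_rho_bij : bijective rho;
  caut_phiD : forall c d, phi (c + d) = phi c + phi d;
  caut_phi_bij : bijective phi;
  caut_lin : forall a c b, phi ((a *> c) <* b) = (rho a *> phi c) <* rho b;
  caut_delta : forall c s, sweedler c s ->
    cor_delta C (phi c) = \sum_(p <- s) phi p.1 ⊙ phi p.2;
  caut_eps : forall c, cor_eps C (phi c) = rho (cor_eps C c) }.

Record caut := CAut {
  caut_phi : C -> C;
  caut_rho : A -> A;
  cautP : caut_axioms caut_phi caut_rho }.

Lemma caut_ext (f g : caut) :
  caut_phi f =1 caut_phi g -> caut_rho f =1 caut_rho g -> f = g.
Proof.
case: f g => [p r h] [p' r' h'] /= /funext e /funext e'.
by move: h'; rewrite -e -e' => h'; congr CAut; apply: Prop_irrelevance.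
Qed.

Lemma sweedler_ex (x : C ⊗ C) : exists s, x = \sum_(p <- s) p.1 ⊙ p.2.
Proof. by exists (repr x); rewrite -[LHS]reprK; apply: tens_sum. Qed.

Section AutTheory.
Variables (phi : C -> C) (rho : A -> A) (h : caut_axioms phi rho).

Lemma caut_rho1 : rho 1 = 1.
Proof. by rewrite -(rmorph1 (kalg_map A)) (caut_rho_k h). Qed.
Lemma caut_linl a c : phi (a *> c) = rho a *> phi c.
Proof. by rewrite -[a *> c]ract1 (caut_lin h) caut_rho1 ract1. Qed.
Lemma caut_linr c b : phi (c <* b) = phi c <* rho b.
Proof. by rewrite -{1}[c]lact1 (caut_lin h) caut_rho1 lact1. Qed.

Lemma caut_tensP : balanced (@ract k A A C) (@lact k A A C)
  (fun c d => phi c ⊙ phi d).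
Proof.
split=> *; rewrite ?(caut_phiD h) ?(pureDl, pureDr) //.
by rewrite caut_linr pure_bal caut_linl.
Qed.

Lemma caut_tens_sum (s t : seq (C * C)) :
  \sum_(p <- s) p.1 ⊙ p.2 = \sum_(p <- t) p.1 ⊙ p.2 ->
  \sum_(p <- s) phi p.1 ⊙ phi p.2 = \sum_(p <- t) phi p.1 ⊙ phi p.2.
Proof.
by rewrite -2!(tlift_pi caut_tensP) !tens_sum => ->.
Qed.

End AutTheory.

Lemma caut_id : caut_axioms id id.
Proof.
by split=> //; exists id.
Qed.

Lemma caut_comp phi rho phi' rho' :
  caut_axioms phi rho -> caut_axioms phi' rho' ->
  caut_axioms (phi \o phi') (rho \o rho').
Proof.
move=> h h'; split=> /=.
- by move=> a b; rewrite (caut_rhoD h') (caut_rhoD h).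
- by move=> a b; rewrite (caut_rhoM h') (caut_rhoM h).
- by move=> x; rewrite (caut_rho_k h') (caut_rho_k h).
- exact: bij_comp (caut_rho_bij h) (caut_rho_bij h').
- by move=> c d; rewrite (caut_phiD h') (caut_phiD h).
- exact: bij_comp (caut_phi_bij h) (caut_phi_bij h').
- by move=> a c b; rewrite (caut_lin h') (caut_lin h).
- move=> c s hs.
  have := @caut_delta _ _ h (phi' c) [seq (phi' p.1, phi' p.2) | p <- s].
  by rewrite !big_map; apply; rewrite /sweedler (caut_delta h' hs) big_map.
- by move=> c; rewrite (caut_eps h) (caut_eps h').
Qed.

Lemma caut_inv phi rho (h : caut_axioms phi rho) :
  caut_axioms (binv (caut_phi_bij h)) (binv (caut_rho_bij h)).
Proof.
set p' := binv _; set r' := binv _.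
have pK : cancel phi p' by apply: binvK.
have pVK : cancel p' phi by apply: binvVK.
have rK : cancel rho r' by apply: binvK.
have rVK : cancel r' rho by apply: binvVK.
have p_inj := can_inj pK; have r_inj := can_inj rK.
have p'D c d : p' (c + d) = p' c + p' d.
  by apply: p_inj; rewrite (caut_phiD h) !pVK.
have p'lin a c b : p' ((a *> c) <* b) = (r' a *> p' c) <* r' b.
  by apply: p_inj; rewrite (caut_lin h) !pVK !rVK.
have r'1 : r' 1 = 1 by apply: r_inj; rewrite rVK (caut_rho1 h).
split=> //.
- by move=> a b; apply: r_inj; rewrite (caut_rhoD h) !rVK.
- by move=> a b; apply: r_inj; rewrite (caut_rhoM h) !rVK.
- by move=> x; rewrite -{1}(caut_rho_k h) rK.
- exact: binv_bij.
- exact: binv_bij.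
- move=> c s hs; have [t ht] := sweedler_ex (cor_delta C (p' c)).
  have := caut_delta h ht; rewrite pVK hs => e.
  have bal : balanced (@ract k A A C) (@lact k A A C)
      (fun c d => p' c ⊙ p' d).
    split=> *; rewrite ?p'D ?(pureDl, pureDr) //.
    by rewrite -[X in p' X ⊙ _]lact1 -lractA p'lin r'1 lact1 pure_bal
               -[X in _ = _ ⊙ p' X]ract1 p'lin r'1 ract1.
  rewrite ht.
  have : \pi_(tens (@ract k A A C) (@lact k A A C)) s =
         \pi [seq (phi p.1, phi p.2) | p <- t].
    by rewrite !tens_sum big_map.
  move/(congr1 (tlift (fun c d => p' c ⊙ p' d))).
  rewrite !(tlift_pi bal) big_map => ->.
  by apply: eq_bigr => p _; rewrite /= !pK.
- by move=> c; apply: r_inj; rewrite -(caut_eps h) pVK rVK.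
Qed.

Definition caut_mul (f g : caut) : caut := CAut (caut_comp (cautP f) (cautP g)).
Definition caut_one : caut := CAut caut_id.
Definition caut_V (f : caut) : caut := CAut (caut_inv (cautP f)).

Lemma caut_mulA : associative caut_mul.
Proof. by move=> f g h; apply: caut_ext. Qed.
Lemma caut_mul1l : left_id caut_one caut_mul.
Proof. by move=> f; apply: caut_ext. Qed.
Lemma caut_mul1r : right_id caut_one caut_mul.
Proof. by move=> f; apply: caut_ext. Qed.
Lemma caut_mulVl : left_inverse caut_one caut_V caut_mul.
Proof. by move=> f; apply: caut_ext => x /=; apply: binvK. Qed.
Lemma caut_mulVr : right_inverse caut_one caut_V caut_mul.
Proof. by move=> f; apply: caut_ext => x /=; apply: binvVK. Qed.

Definition Aut : group :=
  Group caut_mulA caut_mul1l caut_mul1r caut_mulVl caut_mulVr.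

(* C^* = Hom_{-A}(C, A) *)
Definition cdual := bhom (rmod_of C) (rmod_of (regular A)).

Definition cdual_act_fun (f : cdual) (c : C) : C :=
  tlift (fun c1 c2 : C => (f c1 : A) *> c2) (cor_delta C c).

Lemma cdual_act_bal (f : cdual) : balanced (@ract k A A C) (@lact k A A C)
  (fun c1 c2 : C => (f c1 : A) *> c2).
Proof.
split=> [c d e|c d e|c a d]; rewrite ?lactDr //.
  by rewrite (bhomD f) lactDl.
by rewrite (bhomR f c a) lactA.
Qed.

Lemma cdual_actD f c d :
  cdual_act_fun f (c + d) = cdual_act_fun f c + cdual_act_fun f d.
Proof. by rewrite /cdual_act_fun bhomD (tliftD (cdual_act_bal f)). Qed.

Lemma cdual_actR f c a : cdual_act_fun f (c <* a) = cdual_act_fun f c <* a.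
Proof.
rewrite /cdual_act_fun bhomR.
elim/tensor_ind: (cor_delta C c) => [c1 c2|x y hx hy].
  by rewrite ract_pure !(tlift_pure (cdual_act_bal f)) lractA.
by rewrite ractDl !(tliftD (cdual_act_bal f)) hx hy ractDl.
Qed.

Definition cdual_act (f : cdual) : bhom (rmod_of C) (rmod_of C) :=
  @BHom k (kself k) A (rmod_of C) (rmod_of C) (cdual_act_fun f)
    (cdual_actD f) (fun x c => cdual_actR f c (kalg_map A x)) (cdual_actR f).

(* (f * g)(c) = \sum g(f(c_(1)) c_(2)) *)
Definition cdual_mul (f g : cdual) : cdual := bcomp g (cdual_act f).
Definition cdual_one : cdual := rhom_of (cor_eps C).

Definition cdual_invertible (p : cdual) : Prop :=
  exists q, cdual_mul p q = cdual_one /\ cdual_mul q p = cdual_one.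

Definition Inn (f : Aut) : Prop :=
  exists2 p : cdual, cdual_invertible p &
    forall c s, sweedler c s ->
      \sum_(u <- s) caut_phi f u.1 <* (p u.2 : A) =
      \sum_(u <- s) (p u.1 : A) *> u.2.

End Automorphisms.

Section Twist.
Variables (k : comPzRingType) (A : kalg k) (C : coring A) (f : Aut C).

Let phi := caut_phi f.
Let rho := caut_rho f.
Let h : caut_axioms phi rho := cautP f.

Definition caut_rhoV : A -> A := binv (caut_rho_bij h).
Let rK : cancel rho caut_rhoV. Proof. exact: binvK. Qed.
Let rVK : cancel caut_rhoV rho. Proof. exact: binvVK. Qed.

Lemma twist_bimodP : @bimod_axioms k A A C
  (fun a c => caut_rhoV a *> c) (fun c a => c <* a).
Proof.
have r_inj := can_inj rK.
split=> *; rewrite ?(lactDr, ractDl, ractDr, ractA, ract1, lractA) //.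
- rewrite -lactDl; congr (_ *> _).
  by apply: r_inj; rewrite (caut_rhoD h) !rVK.
- rewrite lactA; congr (_ *> _).
  by apply: r_inj; rewrite (caut_rhoM h) !rVK.
- rewrite -[RHS]lact1; congr (_ *> _).
  by apply: r_inj; rewrite (caut_rho1 h) rVK.
- rewrite -lract_k; congr (_ *> _).
  by apply: r_inj; rewrite (caut_rho_k h) rVK.
Qed.

Definition twist_bimod : bimod A A := Bimod twist_bimodP.

Lemma lact_twist a (c : C) : a *> (c : twist_bimod) = caut_rhoV a *> c :> C.
Proof. by []. Qed.

Lemma twist_bal : balanced (@ract k A A C) (@lact k A A C)
  (fun c d : C => phi c ⊙ (d : twist_bimod)).
Proof.
split=> [c c' d|c d d'|c a d].
- by rewrite (caut_phiD h) pureDl.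
- exact: pureDr.
- by rewrite (caut_linr h) pure_bal lact_twist rK.
Qed.

Definition twist_tens (x : C ⊗ C) : C ⊗ twist_bimod :=
  tlift (fun c d : C => phi c ⊙ (d : twist_bimod)) x.

Lemma twist_tensE c d : twist_tens (c ⊙ d) = phi c ⊙ (d : twist_bimod).
Proof. exact: (tlift_pure twist_bal). Qed.
Lemma twist_tensD x y : twist_tens (x + y) = twist_tens x + twist_tens y.
Proof. exact: (tliftD twist_bal). Qed.
Lemma twist_tensL a x : twist_tens (a *> x) = rho a *> twist_tens x.
Proof.
elim/tensor_ind: x => [c d|x y hx hy].
  by rewrite lact_pure !twist_tensE (caut_linl h) lact_pure.
by rewrite lactDr !twist_tensD hx hy lactDr.
Qed.
Lemma twist_tensR x a : twist_tens (x <* a) = twist_tens x <* a.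
Proof.
elim/tensor_ind: x => [c d|x y hx hy].
  by rewrite ract_pure !twist_tensE ract_pure.
by rewrite ractDl !twist_tensD hx hy ractDl.
Qed.

(* c |-> \sum phi(c_(1)) ⊗ c_(2) *)
Definition twist_lam_fun (c : twist_bimod) : C ⊗ twist_bimod :=
  twist_tens (cor_delta C c).

Lemma twist_lamD c d :
  twist_lam_fun (c + d) = twist_lam_fun c + twist_lam_fun d.
Proof. by rewrite /twist_lam_fun [cor_delta C _]bhomD twist_tensD. Qed.
Lemma twist_lamL a c : twist_lam_fun (a *> c) = a *> twist_lam_fun c.
Proof. by rewrite /twist_lam_fun lact_twist bhomL twist_tensL rVK. Qed.
Lemma twist_lamR c a : twist_lam_fun (c <* a) = twist_lam_fun c <* a.
Proof. by rewrite /twist_lam_fun [cor_delta C _]bhomR twist_tensR. Qed.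

Definition twist_lam : bhom twist_bimod (C ⊗ twist_bimod) :=
  BHom twist_lamD twist_lamL twist_lamR.
Lemma twist_lamE (c : C) : twist_lam c = twist_tens (cor_delta C c).
Proof. by []. Qed.

(* As sets, twist_bimod ⊗ C and C ⊗ C are the same: only the right action on
   the first factor is used. *)
Definition twist_rho_fun (c : twist_bimod) : twist_bimod ⊗ C := cor_delta C c.

Lemma twist_rhoD c d :
  twist_rho_fun (c + d) = twist_rho_fun c + twist_rho_fun d.
Proof. exact: (bhomD (cor_delta C)). Qed.
Lemma twist_rhoL a c : twist_rho_fun (a *> c) = a *> twist_rho_fun c.
Proof. exact: (bhomL (cor_delta C)). Qed.
Lemma twist_rhoR c a : twist_rho_fun (c <* a) = twist_rho_fun c <* a.
Proof. exact: (bhomR (cor_delta C)). Qed.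

Definition twist_rho : bhom twist_bimod (twist_bimod ⊗ C) :=
  BHom twist_rhoD twist_rhoL twist_rhoR.

Lemma twist_rhoP : right_coaction twist_rho.
Proof.
split=> c; first exact: (cor_coassoc (c : C)).
exact: (cor_counitr (c : C)).
Qed.

Section Psi.
Variables (T : bimod A A) (t : C ⊗ C -> T).
Hypotheses (tD : forall x y, t (x + y) = t x + t y)
           (tL : forall a x, t (a *> x) = rho a *> t x).
Definition psi (x : C ⊗ (C ⊗ C)) : C ⊗ T := tlift (fun c y => phi c ⊙ t y) x.
Lemma psi_bal : balanced (@ract k A A C) (@lact k A A (C ⊗ C))
  (fun c y => phi c ⊙ t y).
Proof.
split=> *; rewrite ?(caut_phiD h) ?tD ?(pureDl, pureDr) //.
by rewrite (caut_linr h) tL pure_bal.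
Qed.
Lemma psiE c y : psi (c ⊙ y) = phi c ⊙ t y.
Proof. exact: (tlift_pure psi_bal). Qed.
Lemma psiD x y : psi (x + y) = psi x + psi y.
Proof. exact: (tliftD psi_bal). Qed.
End Psi.

Lemma cor_delta_phi c :
  cor_delta C (phi c) = tlift (fun c d => phi c ⊙ phi d) (cor_delta C c).
Proof.
have [s hs] := sweedler_ex (cor_delta C c).
by rewrite (caut_delta h hs) hs -tens_sum (tlift_pi (caut_tensP h)).
Qed.

Lemma twist_lamP : left_coaction twist_lam.
Proof.
have pE := psiE twist_tensD twist_tensL; have pD := psiD twist_tensD twist_tensL.
split=> c; rewrite twist_lamE.
  have -> x : tassoc _ _ _ (tmap (cor_delta C) (bid twist_bimod) (twist_tens x))
      = psi twist_tens (tassoc _ _ _ (tmap (cor_delta C) (bid C) x)).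
    elim/tensor_ind: x => [d e|x y hx hy]; last first.
      by rewrite twist_tensD !bhomD hx hy pD.
    rewrite twist_tensE !tmapE cor_delta_phi !bidE.
    elim/tensor_ind: (cor_delta C d) => [d1 d2|x y hx hy].
      by rewrite (tlift_pure (caut_tensP h)) !tassocE pE twist_tensE.
    by rewrite (tliftD (caut_tensP h)) !pureDl !bhomD hx hy pD.
  rewrite cor_coassoc.
  have -> x : tmap (bid C) twist_lam (twist_tens x) =
      psi twist_tens (tmap (bid C) (cor_delta C) x); last by [].
  elim/tensor_ind: x => [d e|x y hx hy]; first by rewrite twist_tensE !tmapE twist_lamE pE.
  by rewrite twist_tensD !bhomD hx hy pD.
rewrite -[RHS](cor_counitl (c : C)).
elim/tensor_ind: (cor_delta C c) => [d e|x y hx hy].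
  rewrite twist_tensE !tmapE !lunitE (caut_eps h) lact_twist.
  by rewrite rK.
by rewrite twist_tensD !bhomD hx hy.
Qed.

Lemma twist_compat c :
  tassoc _ _ _ (tmap twist_lam (bid C) (twist_rho c)) =
  tmap (bid C) twist_rho (twist_lam c).
Proof.
pose t (x : C ⊗ C) : twist_bimod ⊗ C := x.
have tD x y : t (x + y) = t x + t y by [].
have tL a x : t (a *> x) = rho a *> t x.
  rewrite -[a in LHS]rK //.
have pE := psiE tD tL; have pD := psiD tD tL.
have -> : tassoc _ _ _ (tmap twist_lam (bid C) (twist_rho c)) =
    psi t (tassoc _ _ _ (tmap (cor_delta C) (bid C) (cor_delta C c))).
  have -> : twist_rho c = t (cor_delta C c) by [].
  elim/tensor_ind: (cor_delta C c) => [d e|x y hx hy]; last first.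
    by rewrite tD !bhomD hx hy pD.
  have -> : t (d ⊙ e) = (d : twist_bimod) ⊙ e by [].
  rewrite !tmapE !bidE twist_lamE.
  elim/tensor_ind: (cor_delta C d) => [d1 d2|x y hx hy].
    by rewrite twist_tensE !tassocE pE.
  by rewrite twist_tensD !pureDl !bhomD hx hy pD.
rewrite cor_coassoc twist_lamE.
elim/tensor_ind: (cor_delta C c) => [d e|x y hx hy].
  by rewrite twist_tensE !tmapE pE.
by rewrite twist_tensD !bhomD pD hx hy.
Qed.

(* The bicomodule denoted _fC. *)
Definition twist : bicomod C C := Bicomod twist_lamP twist_rhoP twist_compat.

End Twist.

Section BicomodIso.
Variables (k : comPzRingType) (A B : kalg k) (C : coring A) (D : coring B).

Definition bicomod_iso (X Y : bicomod C D) : Prop :=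
  exists f : bhom X Y,
    [/\ bijective f, lcolinear (bc_lam X) (bc_lam Y) f &
        colinear (bc_rho X) (bc_rho Y) f].

Lemma bicomod_iso_refl X : bicomod_iso X X.
Proof.
exists (bid X); split; first by exists id.
  by move=> x; rewrite tmap_id.
by move=> x; rewrite tmap_id.
Qed.

Lemma bicomod_iso_trans Y X Z :
  bicomod_iso X Y -> bicomod_iso Y Z -> bicomod_iso X Z.
Proof.
move=> [f [fB fl fr]] [g [gB gl gr]]; exists (bcomp g f); split.
- exact: bij_comp gB fB.
- move=> x; rewrite bcompE gl fl tmap_comp.
  by congr (tmap _ _ _); apply: bhom_ext.
- move=> x; rewrite bcompE gr fr tmap_comp.
  by congr (tmap _ _ _); apply: bhom_ext.
Qed.

Lemma bicomod_iso_sym X Y : bicomod_iso X Y -> bicomod_iso Y X.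
Proof.
move=> [f [[g fK gK] fl fr]]; have f_inj := can_inj fK.
have gD x y : g (x + y) = g x + g y by apply: f_inj; rewrite bhomD !gK.
have gL a x : g (a *> x) = a *> g x by apply: f_inj; rewrite bhomL !gK.
have gR x b : g (x <* b) = g x <* b by apply: f_inj; rewrite bhomR !gK.
have e : bcomp (BHom gD gL gR) f = bid X by apply: bhom_ext => x /=; rewrite fK.
exists (BHom gD gL gR); split; first by exists f.
- move=> y; rewrite -{2}[y]gK fl tmap_comp e /=.
  by rewrite -[LHS]tmap_id; congr (tmap _ _ _); apply: bhom_ext.
- move=> y; rewrite -{2}[y]gK fr tmap_comp e /=.
  by rewrite -[LHS]tmap_id; congr (tmap _ _ _); apply: bhom_ext.
Qed.

End BicomodIso.

Definition regular_bicomod (k : comPzRingType) (A : kalg k) (C : coring A) :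
  bicomod C C.
Proof.
refine (@Bicomod k A A C C C (cor_delta C) (cor_delta C) _ _ _).
- by split; [apply: cor_coassoc | apply: cor_counitl].
- by split; [apply: cor_coassoc | apply: cor_counitr].
- exact: cor_coassoc.
Defined.

Section Picard.
Variables (k : comPzRingType) (A : kalg k) (C : coring A).
Variables (hl : left_flat C) (hr : right_flat C).

Local Notation rinv := (right_invertible hl).
Local Notation "X □ Y" := (cot hr hl X Y) (at level 40).

(* Isomorphism classes of right invertible C-bicomodules. *)
Definition pic_sort := {P : bicomod C C -> Prop |
  exists X, rinv X /\ P = bicomod_iso X}.

Definition pic_class (X : bicomod C C) (hX : rinv X) : pic_sort :=
  exist _ (bicomod_iso X) (ex_intro _ X (conj hX erefl)).

Lemma pic_classP X Y (hX : rinv X) (hY : rinv Y) :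
  pic_class hX = pic_class hY <-> bicomod_iso X Y.
Proof.
split=> [[] ->|h]; first exact: bicomod_iso_refl.
apply: sig_eq; apply/funext => Z /=; apply/propext.
split; first exact: bicomod_iso_trans (bicomod_iso_sym h).
exact: bicomod_iso_trans h.
Qed.

Lemma pic_ex (x : pic_sort) : exists X, exists hX : rinv X, pic_class hX = x.
Proof. by case: x => P [X [hX e]]; exists X, hX; apply: sig_eq. Qed.

Definition pic_repr (x : pic_sort) : bicomod C C := projT1 (cid (pic_ex x)).
Lemma pic_repr_inv x : rinv (pic_repr x).
Proof. by case: (projT2 (cid (pic_ex x))). Qed.
Lemma pic_reprK x : pic_class (pic_repr_inv x) = x.
Proof.
have [hX e] := projT2 (cid (pic_ex x)).
by rewrite -[RHS]e; congr pic_class; apply: Prop_irrelevance.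
Qed.

(* The facts making (X)(Y) = (X □ Y) a well-defined group law on these
   classes; Pic is built from a proof of them. *)
Record pic_laws : Prop := PicLaws {
  pic_closed : forall X Y, rinv X -> rinv Y -> rinv (X □ Y);
  pic_cong : forall X X' Y Y', rinv X -> rinv Y ->
    bicomod_iso X X' -> bicomod_iso Y Y' -> bicomod_iso (X □ Y) (X' □ Y');
  pic_assoc : forall X Y Z, rinv X -> rinv Y -> rinv Z ->
    bicomod_iso (X □ (Y □ Z)) ((X □ Y) □ Z);
  pic_reg : rinv (regular_bicomod C);
  pic_unitl : forall X, rinv X -> bicomod_iso (regular_bicomod C □ X) X;
  pic_unitr : forall X, rinv X -> bicomod_iso (X □ regular_bicomod C) X;
  pic_inverse : forall X, rinv X -> exists Y, rinv Y /\
    bicomod_iso (Y □ X) (regular_bicomod C) /\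
    bicomod_iso (X □ Y) (regular_bicomod C) }.

Section PicGroup.
Variable hP : pic_laws.

Definition pic_mul (x y : pic_sort) : pic_sort :=
  pic_class (pic_closed hP (pic_repr_inv x) (pic_repr_inv y)).
Definition pic_one : pic_sort := pic_class (pic_reg hP).

Definition pic_inv (x : pic_sort) : pic_sort :=
  let Y := cid (pic_inverse hP (pic_repr_inv x)) in
  pic_class (proj1 (projT2 Y)).

Lemma pic_mulE X Y (hX : rinv X) (hY : rinv Y) :
  pic_mul (pic_class hX) (pic_class hY) = pic_class (pic_closed hP hX hY).
Proof.
apply/pic_classP/(pic_cong hP); try exact: pic_repr_inv.
  by apply/(pic_classP (pic_repr_inv _) hX); apply: pic_reprK.
by apply/(pic_classP (pic_repr_inv _) hY); apply: pic_reprK.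
Qed.

Lemma pic_mulA : associative pic_mul.
Proof.
move=> x y z; rewrite -(pic_reprK x) -(pic_reprK y) -(pic_reprK z).
by rewrite !pic_mulE; apply/pic_classP/(pic_assoc hP); apply: pic_repr_inv.
Qed.
Lemma pic_mul1l : left_id pic_one pic_mul.
Proof.
move=> x; rewrite -(pic_reprK x) pic_mulE.
by apply/pic_classP/(pic_unitl hP); apply: pic_repr_inv.
Qed.
Lemma pic_mul1r : right_id pic_one pic_mul.
Proof.
move=> x; rewrite -(pic_reprK x) pic_mulE.
by apply/pic_classP/(pic_unitr hP); apply: pic_repr_inv.
Qed.
Lemma pic_mulVl : left_inverse pic_one pic_inv pic_mul.
Proof.
move=> x; rewrite -{2}(pic_reprK x) /pic_inv.
case: (cid _) => Y [hY [e1 e2]] /=.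
by rewrite pic_mulE; apply/pic_classP.
Qed.
Lemma pic_mulVr : right_inverse pic_one pic_inv pic_mul.
Proof.
move=> x; rewrite -{1}(pic_reprK x) /pic_inv.
case: (cid _) => Y [hY [e1 e2]] /=.
by rewrite pic_mulE; apply/pic_classP.
Qed.

(* By pic_mulE, (X)(Y) = (X □ Y) in Pic. *)
Definition Pic : group :=
  Group pic_mulA pic_mul1l pic_mul1r pic_mulVl pic_mulVr.

End PicGroup.

End Picard.

(* Main.v *)
Require Import Defs.
From mathcomp Require Import all_boot ssralg.
From mathcomp Require Import boolp.

Set Implicit Arguments.
Unset Strict Implicit.
Unset Printing Implicit Defensive.

Import GRing.Theory.
Local Open Scope ring_scope.

(* Write F_X for the functor - □ X. If F_X is an equivalence then X is flat on
   the left, because N ⊗ X is a natural retract of F_X(N ⊗ C) and F_X preserves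
   kernels; and M ⊗ (W □ X) = (M ⊗ W) □ X, because F_X is full and faithful, so
   that both sides represent the same functor. Hence the cotensor product is
   associative as soon as its last factor is right invertible.

   Let F_X(W) = D. Full faithfulness transports the left multiplications of D
   and its comultiplication to W, which becomes a bicomodule Y with Y □ X = D;
   then F_X F_Y = Id shows that Y is right invertible, and applying the same
   construction to Y gives X □ Y = C. So the right invertible bicomodules form
   a groupoid under □, which yields the group Pic^r and, by conjugation with X,
   its invariance (2).

   For f = (phi, rho) with inverse g, the map m |-> sum m_(0) ⊗ phi_g(m_(1)) is
   a semilinear bijection of M onto M □ _fC; composing the ones for f and g
   shows that _fC is right invertible. A right colinear map h from _fC to C is
   h(c) = sum p(c_(1)) c_(2) with p = eps h, and it is left colinear exactly when
   f and p satisfy the identity defining Inn; so the kernel of Omega is Inn. *)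

(** * Equivalences of categories *)

(** The obstacle is that neither associativity of the cotensor product nor its compatibility with
    [M ⊗ -] holds for arbitrary bicomodules: both ask a tensor product to preserve an equalizer, and
    flatness is assumed of the corings only. That flatness provides coactions on cotensor products
    and kernels of comodule maps; everything beyond must be extracted from the equivalence. But an
    equivalence between categories of right comodules sees right colinear maps alone. A left
    structure is therefore handled as a family of such maps: an element [m] of a bimodule becomes
    [v |-> m ⊗ v], an element [b] of the left ring becomes multiplication by [b], an element of [k]
    becomes a scalar endomorphism. The maps that a left structure should induce are lifted through
    the functor by fullness, and each law between the lifts, including additivity and balancedness
    in the parameter, is an equality of morphisms that faithfulness reduces to a known one after
    [- □ X]. *)

Section Categories.
Variables C D E : category.

Lemma natural_iso_sym (F G : functor C D) : natural_iso F G -> natural_iso G F.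
Proof.
move=> [u [v [uN vu uv]]]; exists v, u; split=> // X Y f.
rewrite -[LHS]cat_idr -uv cat_assoc -(cat_assoc (v Y)) -uN cat_assoc vu.
by rewrite cat_idl.
Qed.

Lemma natural_iso_trans (F G H : functor C D) :
  natural_iso F G -> natural_iso G H -> natural_iso F H.
Proof.
move=> [u [v [uN vu uv]]] [u' [v' [uN' vu' uv']]].
exists (fun X => cat_comp (u' X) (u X)), (fun X => cat_comp (v X) (v' X)).
split=> [X Y f|X|X].
- by rewrite -cat_assoc uN cat_assoc uN' cat_assoc.
- by rewrite -cat_assoc (cat_assoc (v' X)) vu' cat_idl vu.
- by rewrite -cat_assoc (cat_assoc (u X)) uv cat_idl uv'.
Qed.

Lemma natural_iso_whiskerl (G : functor D E) (F F' : functor C D) :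
  natural_iso F F' -> natural_iso (functor_comp G F) (functor_comp G F').
Proof.
move=> [u [v [uN vu uv]]].
exists (fun X => fun_hom G (u X)), (fun X => fun_hom G (v X)).
by split=> [X Y f|X|X] /=; rewrite -!fun_comp ?uN ?vu ?uv ?fun_id.
Qed.

Lemma natural_iso_whiskerr (G G' : functor D E) (F : functor C D) :
  natural_iso G G' -> natural_iso (functor_comp G F) (functor_comp G' F).
Proof.
move=> [u [v [uN vu uv]]]; exists (fun X => u (F X)), (fun X => v (F X)).
by split=> [X Y f|X|X] /=.
Qed.

End Categories.

(* Composition of functors is strictly associative and unital on objects and
   arrows, but the composites only differ by proofs; identities relate them. *)
Ltac natural_iso_id :=
  exists (fun X => cat_id _), (fun X => cat_id _);
  split=> *; rewrite /= ?cat_idl ?cat_idr //.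

Section Equivalences.
Variables (C D : category) (F : functor C D) (hF : is_equivalence F).

Lemma equivalence_faithful X Y (f g : cat_hom X Y) :
  fun_hom F f = fun_hom F g -> f = g.
Proof.
have [G [[u [v [uN vu uv]]] _]] := hF.
move=> e; have := congr1 (fun h => cat_comp (u Y) (fun_hom G h)) e.
rewrite !uN /= => e2.
have := congr1 (fun h => cat_comp h (v X)) e2.
by rewrite /= -!cat_assoc uv !cat_idr.
Qed.

Lemma equivalence_surj (Z : D) :
  exists (X : C) (f : cat_hom Z (F X)) (g : cat_hom (F X) Z),
    cat_comp g f = cat_id _ /\ cat_comp f g = cat_id _.
Proof.
have [G [_ [u [v [uN vu uv]]]]] := hF.
by exists (G Z), (v Z), (u Z); split; [apply: uv | apply: vu].
Qed.
End Equivalences.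

(** The equation [F f = h] is verified after applying [G], which is itself an equivalence and hence
    faithful; this avoids triangle identities between the two natural isomorphisms. *)
Lemma equivalence_full (C D : category) (F : functor C D) X Y
    (h : cat_hom (F X) (F Y)) :
  is_equivalence F -> exists f : cat_hom X Y, fun_hom F f = h.
Proof.
move=> [G [hGF hFG]].
have hG : is_equivalence G by exists F.
have [u [v [uN vu uv]]] := hGF.
exists (cat_comp (u Y) (cat_comp (fun_hom G h) (v X))).
apply: (equivalence_faithful hG).
have e f : fun_hom G (fun_hom F f) = cat_comp (v Y) (cat_comp f (u X)).
  by rewrite -[RHS]/(cat_comp (v Y) (cat_comp (fun_hom (functor_id C) f) (u X)))
    -uN cat_assoc vu cat_idl.
by rewrite e -!cat_assoc vu cat_idr cat_assoc vu cat_idl.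
Qed.

Lemma equivalence_comp (C D E : category) (G : functor D E) (F : functor C D) :
  is_equivalence F -> is_equivalence G -> is_equivalence (functor_comp G F).
Proof.
move=> [F' [FF' F'F]] [G' [GG' G'G]]; exists (functor_comp F' G'); split.
- apply: natural_iso_trans FF'.
  apply: natural_iso_trans (natural_iso_whiskerr F (natural_iso_whiskerl F' GG')).
  natural_iso_id.
- apply: natural_iso_trans G'G.
  apply: natural_iso_trans (natural_iso_whiskerr G' (natural_iso_whiskerl G F'F)).
  natural_iso_id.
Qed.

Lemma equivalence_iso (C D : category) (F F' : functor C D) :
  natural_iso F F' -> is_equivalence F -> is_equivalence F'.
Proof.
move=> e [G [h h']]; exists G; split.
  exact: natural_iso_trans (natural_iso_whiskerl G (natural_iso_sym e)) h.
exact: natural_iso_trans (natural_iso_whiskerr G (natural_iso_sym e)) h'.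
Qed.

Lemma equivalence_id (C : category) : is_equivalence (functor_id C).
Proof.
by exists (functor_id C); split; natural_iso_id.
Qed.

(** With [G'] quasi-inverse to [G], [F] is isomorphic to [G' ∘ (G ∘ F)], a composite of
    equivalences. *)
Lemma equivalence_cancell (C D E : category) (G : functor D E) (F : functor C D) :
  is_equivalence G -> is_equivalence (functor_comp G F) -> is_equivalence F.
Proof.
move=> [G' [GG' G'G]] h.
have hG' : is_equivalence G' by exists G.
apply: equivalence_iso (equivalence_comp h hG').
apply: natural_iso_trans (natural_iso_whiskerr F GG').
natural_iso_id.
Qed.

(** * Forgetting left actions, and coactions on tensor products *)

Section RightLinear.
Variables (k : comPzRingType) (A : kalg k) (M N : bimod (kself k) A).

Lemma lact_kself (x : kself k) (m : M) : x *> m = m <* kalg_map A x.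
Proof. exact: (lract_k x m). Qed.

End RightLinear.

Section RBHom.
Variables (k : comPzRingType) (A : kalg k) (M N : bimod (kself k) A).
Variables (f : M -> N) (fD : forall m n, f (m + n) = f m + f n).
Hypothesis fR : forall m a, f (m <* a) = f m <* a.

Lemma rbhomL (x : kself k) m : f (x *> m) = x *> f m.
Proof. by rewrite !lact_kself fR. Qed.

(** Over [kself k] the left action is the right action of scalars, so additivity and right linearity
    suffice. *)
Definition rbhom : bhom M N := BHom fD rbhomL fR.
End RBHom.

Section RComodOf.
Variables (k : comPzRingType) (R A : kalg k) (C : coring A).
Variables (M : bimod R A) (rho : bhom M (M ⊗ C)).

(** The tensor relation uses only the right action on the first factor, so [rmod_of M ⊗ C] and
    [M ⊗ C] have the same underlying group and [rho] is reused unchanged. Many later steps pass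
    between such types by conversion. *)
Definition rmod_rho : bhom (rmod_of M) (rmod_of M ⊗ C) :=
  @rbhom k A (rmod_of M) (rmod_of M ⊗ C) rho (bhomD rho) (bhomR rho).

Hypothesis rhoP : right_coaction rho.

Lemma rmod_rhoP : right_coaction rmod_rho.
Proof. split; [exact: (rcoact_assoc rhoP)|exact: (rcoact_counit rhoP)]. Qed.

Definition rcomod_of : rcomod C := RComod rmod_rhoP.
End RComodOf.


Ltac tensor_elim x :=
  elim/tensor_ind: x => [? ?|? ?];
    last by rewrite !(pureDl, pureDr, bhomD) => {1}-> {1}->.

Section TensorMapLemmas.
Variables (k : comPzRingType) (A1 A2 A3 : kalg k).

Lemma pure0l (M : bimod A1 A2) (N : bimod A2 A3) (n : N) : (0 : M) ⊙ n = 0.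
Proof. by apply: (addrI (0 ⊙ n)); rewrite -pureDl !addr0. Qed.

Lemma tmap_compl (M M' M'' : bimod A1 A2) (N : bimod A2 A3) (g : bhom M' M'')
  (f : bhom M M') x :
  tmap (bcomp g f) (bid N) x = tmap g (bid N) (tmap f (bid N) x).
Proof. by tensor_elim x; rewrite !bhomE. Qed.

Lemma tmap_compr (M : bimod A1 A2) (N N' N'' : bimod A2 A3) (g : bhom N' N'')
  (f : bhom N N') x :
  tmap (bid M) (bcomp g f) x = tmap (bid M) g (tmap (bid M) f x).
Proof. by tensor_elim x; rewrite !bhomE. Qed.

End TensorMapLemmas.

Section TensorRightCoaction.
Variables (k : comPzRingType) (R S B : kalg k) (D : coring B).
Variables (M : bimod R S) (V : bimod S B) (rho : bhom V (V ⊗ D)).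

Definition tens_rho : bhom (M ⊗ V) (M ⊗ V ⊗ D) :=
  bcomp (tassocV M V D) (tmap (bid M) rho).

Lemma tens_rhoE m v : tens_rho (m ⊙ v) = tassocV M V D (m ⊙ rho v).
Proof. by rewrite /tens_rho bcompE tmapE. Qed.

Hypothesis rhoP : right_coaction rho.

Lemma tens_rhoP : right_coaction tens_rho.
Proof.
split=> x.
  elim/tensor_ind: x => [m v|x y hx hy]; last by rewrite !bhomD hx hy.
  rewrite tens_rhoE.
  transitivity (tassocV M V (D ⊗ D)
    (m ⊙ tassoc V D D (tmap rho (bid D) (rho v)))).
    tensor_elim (rho v); rewrite !bhomE.
    by set u := rho _; tensor_elim u; rewrite !bhomE.
  rewrite (rcoact_assoc rhoP).
  by tensor_elim (rho v); rewrite !bhomE.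
elim/tensor_ind: x => [m v|x y hx hy]; last by rewrite !bhomD hx hy.
rewrite tens_rhoE -[in RHS](rcoact_counit rhoP v).
by tensor_elim (rho v); rewrite !bhomE ract_pure.
Qed.

End TensorRightCoaction.

Section TensorRightColinear.
Variables (k : comPzRingType) (R S B : kalg k) (D : coring B).
Variables (M M' : bimod R S) (V V' : bimod S B).
Variables (rho : bhom V (V ⊗ D)) (rho' : bhom V' (V' ⊗ D)).

Lemma tmap_colinear (f : bhom M M') (g : bhom V V') :
  colinear rho rho' g -> colinear (tens_rho M rho) (tens_rho M' rho') (tmap f g).
Proof.
move=> hg x; tensor_elim x; rewrite tmapE !tens_rhoE hg.
by set u := rho _; tensor_elim u; rewrite !bhomE.
Qed.

End TensorRightColinear.

Section CotensorTensor.
Variables (k : comPzRingType) (R S A B : kalg k) (C : coring A).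
Variables (M : bimod R S) (W : bimod S A) (rho : bhom W (W ⊗ C)).
Variables (X : bimod A B) (lam : bhom X (C ⊗ X)).

Lemma cot_f_tens m u : cot_f (tens_rho M rho) X (tassocV _ _ _ (m ⊙ u)) =
  tassocV _ _ _ (m ⊙ cot_f rho X u).
Proof.
tensor_elim u; rewrite /cot_f !bhomE.
by set v := rho _; tensor_elim v; rewrite !bhomE.
Qed.

Lemma cot_g_tens m u : cot_g (M ⊗ W) lam (tassocV _ _ _ (m ⊙ u)) =
  tassocV _ _ _ (m ⊙ cot_g W lam u).
Proof.
by tensor_elim u; rewrite /cot_g !bhomE.
Qed.

Let E := cotensor rho lam.
Let io : bhom E (W ⊗ X) := cot_incl rho lam.

Lemma tcot_ex (y : M ⊗ E) : exists e, cot_incl (tens_rho M rho) lam e =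
  bcomp (tassocV _ _ _) (tmap (bid M) io) y.
Proof.
apply: bincl_ex; tensor_elim y.
by rewrite bcompE tmapE bidE cot_f_tens cot_g_tens binclP.
Qed.

(** The canonical comparison of [M ⊗ (W □ X)] with [(M ⊗ W) □ X]. As [M] is not assumed flat, it
    need not be bijective in general; [tcot_bij] derives bijectivity from invertibility of [X]. *)
Definition tcot : bhom (M ⊗ E) (cotensor (tens_rho M rho) lam) :=
  bfactor (@cot_incl_inj _ _ _ _ _ _ _ _ _) tcot_ex.

Lemma tcotE y : cot_incl (tens_rho M rho) lam (tcot y) =
  tassocV _ _ _ (tmap (bid M) io y).
Proof. exact: bfactorE. Qed.

End CotensorTensor.

(** * Right invertible bicomodules *)

Section Subcomodule.
Variables (k : comPzRingType) (R B : kalg k) (D : coring B) (hD : left_flat D).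
Variables (L P : bimod R B) (rho : bhom P (P ⊗ D)) (i : bhom L P).
Hypotheses (rhoP : right_coaction rho) (i_inj : injective i).
Hypothesis hi : forall l, exists w, tmap i (bid D) w = bcomp rho i l.

Lemma subcomod_inj : injective (tmap i (bid D)).
Proof. exact: left_flat_inj. Qed.

Definition sub_rho : bhom L (L ⊗ D) := bfactor subcomod_inj hi.

Lemma sub_rhoE l : tmap i (bid D) (sub_rho l) = rho (i l).
Proof. exact: (bfactorE subcomod_inj hi). Qed.

Lemma sub_rhoP : right_coaction sub_rho.
Proof.
split=> l.
  have inj2 : injective (tmap (tmap i (bid D)) (bid D)).
    exact/left_flat_inj/subcomod_inj.
  apply: (can_inj (@tassocVK _ _ _ _ _ _ _ _)); rewrite tassocK; apply: inj2.
  have -> x : tmap (tmap i (bid D)) (bid D) (tmap sub_rho (bid D) x) =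
              tmap rho (bid D) (tmap i (bid D) x).
    by tensor_elim x; rewrite 3!tmapE sub_rhoE bidE tmapE.
  have -> x : tmap (tmap i (bid D)) (bid D) (tassocV L D D x) =
              tassocV P D D (tmap i (bid _) x).
    elim/tensor_ind: x => [l' d|x y hx hy]; last by rewrite !bhomD hx hy.
    by tensor_elim d; rewrite !bhomE.
  have -> : tmap i (bid (D ⊗ D)) (tmap (bid L) (cor_delta D) (sub_rho l)) =
            tmap (bid P) (cor_delta D) (tmap i (bid D) (sub_rho l)).
    by tensor_elim (sub_rho l); rewrite !bhomE.
  by rewrite sub_rhoE -(rcoact_assoc rhoP) tassocK.
apply: i_inj.
have -> x : i (runit L x) = runit P (tmap i (bid _) x).
  by tensor_elim x; rewrite !bhomE bhomR.
rewrite -[RHS](rcoact_counit rhoP) -sub_rhoE.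
by congr (runit P _); tensor_elim (sub_rho l); rewrite !bhomE.
Qed.

End Subcomodule.

Section ComodEqualizer.
Variables (k : comPzRingType) (B : kalg k) (D : coring B) (hD : left_flat D).
Variables (P Q : rcomod D) (u v : rcomod_hom P Q).

(** Flatness of [D] makes [- ⊗ D] preserve the equalizer of [u] and [v], so the coaction of [P]
    restricts to it. *)
Lemma beq_comod_ex (l : beq u v) : exists w,
  tmap (bincl u v) (bid D) w = bcomp (rc_rho P) (bincl u v) l.
Proof.
apply: left_flat_beq => //.
by rewrite bcompE -!rch_colinear binclP.
Qed.

Definition beq_comod : rcomod D :=
  RComod (sub_rhoP hD (rc_rhoP P) (bincl_inj (g := v)) beq_comod_ex).

Lemma bincl_colinear : colinear (rc_rho beq_comod) (rc_rho P) (bincl u v).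
Proof. by move=> l; rewrite sub_rhoE. Qed.

Definition beq_comod_incl : rcomod_hom beq_comod P := RComodHom bincl_colinear.

End ComodEqualizer.

Lemma cor_rightP (k : comPzRingType) (A : kalg k) (C : coring A) :
  right_coaction (cor_delta C).
Proof. split; [exact: cor_coassoc|exact: cor_counitr]. Qed.

Section Invertible.
Variables (k : comPzRingType) (A B : kalg k) (C : coring A) (D : coring B).
Variables (hD : left_flat D) (X : bicomod C D) (hX : right_invertible hD X).

Local Notation io V := (cot_incl (rc_rho V) (bc_lam X)).
Local Notation F := (cot_functor hD X).

Lemma rinv_full (V V' : rcomod C) (h : rcomod_hom (cot_ob hD X V) (cot_ob hD X V')) :
  exists f : rcomod_hom V V', forall z, io V' (h z) = tmap f (bid X) (io V z).
Proof.
have [f e] := equivalence_full (h : cat_hom (F V) (F V')) hX.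
by exists f => z; rewrite -e; exact: (cot_hom_bhomE f z).
Qed.

Lemma rinv_faithful (V V' : rcomod C) (f g : rcomod_hom V V') :
  (forall z, tmap f (bid X) (io V z) = tmap g (bid X) (io V z)) -> f =1 g.
Proof.
move=> h v; suff -> : f = g by [].
apply: (equivalence_faithful hX); apply: rcomod_hom_ext => z.
apply: (@cot_incl_inj _ _ _ _ _ _ (rc_rho V') _ (bc_lam X)).
by rewrite !cot_hom_bhomE.
Qed.

Lemma rinv_surj (Z : rcomod D) : exists (V : rcomod C)
    (f : rcomod_hom Z (cot_ob hD X V)) (g : rcomod_hom (cot_ob hD X V) Z),
  cancel f g /\ cancel g f.
Proof.
have [V [f [g [gf fg]]]] := equivalence_surj hX (Z : comod D).
exists V, f, g; split=> z.
  exact: (congr1 (fun h : rcomod_hom _ _ => h z) gf).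
exact: (congr1 (fun h : rcomod_hom _ _ => h z) fg).
Qed.

Section Flat.
Hypothesis hC : left_flat C.

Let cofree (N : bimod (kself k) A) : rcomod C :=
  RComod (tens_rhoP N (cor_rightP C)).

Let cofree_hom (M N : bimod (kself k) A) (f : bhom M N) :
    rcomod_hom (cofree M) (cofree N).
Proof.
by exists (tmap f (bid C)); apply: tmap_colinear => c; rewrite tmap_id.
Defined.

(** Coassociativity of the left coaction of [X] puts [n ⊗ lam x] into [(N ⊗ C) □ X]; applying the
    counit, as [retr] does, recovers [n ⊗ x]. *)
Lemma cofree_ex (N : bimod (kself k) A) (y : N ⊗ X) :
  exists z : cot_ob hD X (cofree N),
    io (cofree N) z = tassocV _ _ _ (tmap (bid N) (bc_lam X) y).
Proof.
apply: bincl_ex; elim/tensor_ind: y => [n x|y y' hy hy']; last by rewrite !bhomD hy hy'.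
rewrite tmapE bidE cot_f_tens cot_g_tens; congr (tassocV _ _ _ (_ ⊙ _)).
by rewrite /cot_f /cot_g bcompE (lcoact_assoc (bc_lamP X)).
Qed.

Let retr (N : bimod (kself k) A) : bhom (cofree N ⊗ X) (N ⊗ X) :=
  tmap (bcomp (runit N) (tmap (bid N) (cor_eps C))) (bid X).

Let retrK N y : retr N (tassocV _ _ _ (tmap (bid N) (bc_lam X) y)) = y.
Proof.
elim/tensor_ind: y => [n x|y y' hy hy']; last by rewrite !bhomD hy hy'.
rewrite tmapE bidE -[in RHS](lcoact_counit (bc_lamP X) x).
by tensor_elim (bc_lam X x); rewrite /retr !bhomE pure_bal.
Qed.

Let retrN M N (f : bhom M N) u :
  retr N (tmap (cofree_hom f) (bid X) u) = tmap f (bid X) (retr M u).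
Proof.
elim/tensor_ind: u => [u x|u v hu hv]; last by rewrite !bhomD hu hv.
rewrite /retr !tmapE; congr (_ ⊙ _).
by tensor_elim u; rewrite !bhomE bhomR.
Qed.

(* A kernel of g becomes a kernel after tensoring with C, and F preserves
   kernels; F(N ⊗ C) contains N ⊗ X as a natural retract. *)
Lemma rinv_left_flat : left_flat X.
Proof.
move=> M N P f g fg y; split; last first.
  move=> [x <-]; elim/tensor_ind: x => [m x|u v hu hv];
    last by rewrite !bhomD hu hv addr0.
  by rewrite !tmapE; have -> : g (f m) = 0; [apply/fg; exists m | exact: pure0l].
(* [o] is the zero map, so the equalizer of [g] and [o] is the kernel of [g], with inclusion [i]. *)
move=> gy; pose o := bsub g g; pose i := bincl g o.
have [z hz] := cofree_ex y.
pose L := beq_comod hD (cot_hom hD X (cofree_hom g)) (cot_hom hD X (cofree_hom o)).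
have oE Q (v : N ⊗ Q) : tmap o (bid Q) v = 0.
  elim/tensor_ind: v => [n v|u v hu hv]; last by rewrite bhomD hu hv addr0.
  by rewrite tmapE /= subrr pure0l.
have natE (h : bhom N P) : tmap (cofree_hom h) (bid X) (io (cofree N) z) =
    tassocV _ _ _ (tmap (bid P) (bc_lam X) (tmap h (bid X) y)).
  rewrite hz; clear gy hz; tensor_elim y; rewrite !tmapE.
  by set u := bc_lam X _; tensor_elim u; rewrite !bhomE.
have [l hl] : exists l : L, beq_comod_incl _ _ _ l = z.
  apply: bincl_ex; apply: (@cot_incl_inj _ _ _ _ _ _ _ _ (bc_lam X)).
  by rewrite !cot_hom_bhomE !natE gy oE.
(* The kernel [L] is isomorphic to the image of some [W]. Fullness turns its inclusion into
   [j : W -> N ⊗ C], faithfulness shows that [g ⊗ C] kills [j], and flatness of [C] factors [j]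
   through [Ker g ⊗ C]. *)
have [W [a [b [ab ba]]]] := rinv_surj L.
have [j hj] := rinv_full (rcomod_comp (beq_comod_incl hD _ _) b).
have gj w : cofree_hom g (j w) = cofree_hom o (j w).
  apply: (rinv_faithful (f := rcomod_comp (cofree_hom g) j)
    (g := rcomod_comp (cofree_hom o) j)) => u.
  rewrite !tmap_compl -!hj.
  rewrite -!cot_hom_bhomE; congr (io _ _); exact: (binclP (b u)).
pose K := tmap i (bid C).
have K_inj : injective K by apply: left_flat_inj => //; apply: bincl_inj.
have hK w : exists e, K e = j w by exact: (left_flat_beq hC (gj w)).
pose j' := bfactor K_inj hK.
have jE : j = bcomp (cofree_hom i) j' :> bhom _ _.
  by apply: bhom_ext => w; apply: esym; apply: (bfactorE K_inj hK).
(* Naturality of [retr] exhibits [y] as the image of an element of [Ker g ⊗ X]; by exactness [Ker g]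
   is the image of [f]. *)
have ey : y = tmap i (bid X) (retr _ (tmap j' (bid X) (io W (a l)))).
  by rewrite -retrN -(tmap_compl (cofree_hom i) j') -jE -hj bcompE ab hl hz retrK.
rewrite ey; set v := retr _ _; elim/tensor_ind: v => [n x|u v [u' hu] [v' hv]]; last first.
  by exists (u' + v'); rewrite !bhomD hu hv.
have [|m hm] := (fg (i n)).1; first by rewrite binclP /= subrr.
by exists (m ⊙ x); rewrite !tmapE hm.
Qed.
End Flat.
End Invertible.

(** * Cotensoring with a right invertible bicomodule commutes with tensoring *)

Section TcotColinear.
Variables (k : comPzRingType) (R S A B : kalg k) (C : coring A) (D : coring B).
Variables (M : bimod R S) (W : bimod S A) (rho : bhom W (W ⊗ C)).
Variables (hD : left_flat D) (X : bicomod C D).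

Lemma tcot_colinear :
  colinear (tens_rho M (cotr_rho rho X hD)) (cotr_rho (tens_rho M rho) X hD)
    (tcot M rho (bc_lam X)).
Proof.
have inj : injective (tmap (cot_incl (tens_rho M rho) (bc_lam X)) (bid D)).
  by apply: left_flat_inj => //; apply: cot_incl_inj.
move=> y; apply: inj; rewrite cotr_rhoE tcotE.
elim/tensor_ind: y => [m e|y z hy hz]; last by rewrite !bhomD hy hz.
rewrite tens_rhoE tmapE bidE.
transitivity (tmap (tassocV M W X) (bid D) (tassocV _ _ _
  (m ⊙ tmap (cot_incl rho (bc_lam X)) (bid D) (cotr_rho rho X hD e)))).
  rewrite cotr_rhoE; set u := cot_incl _ _ e; tensor_elim u; rewrite !bhomE.
  by set v := bc_rho X _; tensor_elim v; rewrite !bhomE.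
by tensor_elim (cotr_rho rho X hD e); rewrite !bhomE tcotE !bhomE.
Qed.

End TcotColinear.

Lemma tmap_subl (k : comPzRingType) (A1 A2 A3 : kalg k) (M M' : bimod A1 A2)
    (N : bimod A2 A3) (f g : bhom M M') x :
  tmap (bsub f g) (bid N) x = tmap f (bid N) x - tmap g (bid N) x.
Proof.
elim/tensor_ind: x => [m n|x y hx hy]; last by rewrite !bhomD hx hy opprD addrACA.
by rewrite !tmapE /=; apply: (addIr (g m ⊙ n)); rewrite -pureDl !subrK.
Qed.

Lemma colinear_sub (k : comPzRingType) (A : kalg k) (C : coring A)
    (M N : rcomod C) (f g : rcomod_hom M N) :
  colinear (rc_rho M) (rc_rho N) (bsub f g).
Proof. by move=> m; rewrite tmap_subl -!rch_colinear -bhomB. Qed.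

(** Faithfulness proves additivity of a family [psi] in its parameter by comparing the morphisms
    [psi (m + m') - psi m'] and [psi m]. *)
Definition rcomod_sub (k : comPzRingType) (A : kalg k) (C : coring A)
    (M N : rcomod C) (f g : rcomod_hom M N) : rcomod_hom M N :=
  RComodHom (colinear_sub f g).

Lemma inj_surj_bij (T U : Type) (f : T -> U) :
  injective f -> (forall y, exists x, f x = y) -> bijective f.
Proof.
move=> f_inj f_surj; have g y := cid (f_surj y).
exists (fun y => projT1 (g y)) => [x|y]; last exact: projT2 (g y).
by apply: f_inj; apply: (projT2 (g (f x))).
Qed.

Lemma bhom_inv (k : comPzRingType) (A B : kalg k) (M N : bimod A B) (f : bhom M N) :
  bijective f -> exists g : bhom N M, cancel f g /\ cancel g f.
Proof.
move=> [g fK gK]; have f_inj := can_inj fK.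
have gD x y : g (x + y) = g x + g y by apply: f_inj; rewrite bhomD !gK.
have gL a x : g (a *> x) = a *> g x by apply: f_inj; rewrite bhomL !gK.
have gR x b : g (x <* b) = g x <* b by apply: f_inj; rewrite bhomR !gK.
by exists (BHom gD gL gR).
Qed.

Lemma rcomod_hom_bij (k : comPzRingType) (A : kalg k) (C : coring A)
    (M N : rcomod C) (f : rcomod_hom M N) :
  bijective f -> exists g : rcomod_hom N M, cancel f g /\ cancel g f.
Proof.
move=> /bhom_inv [g [fK gK]].
suff gC : colinear (rc_rho N) (rc_rho M) g by exists (RComodHom gC).
move=> y; rewrite -{2}[y]gK (rch_colinear f) -tmap_compl.
have -> : bcomp g f = bid M by apply: bhom_ext => m; apply: fK.
by rewrite tmap_id.
Qed.

Section CotensorCast.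
Variables (k : comPzRingType) (R A B : kalg k) (C : coring A) (D : coring B).
Variables (W : bimod R A) (rho : bhom W (W ⊗ C)) (rhoP : right_coaction rho).
Variables (hD : left_flat D) (X : bicomod C D).

Local Notation io := (cot_incl rho (bc_lam X)).
Local Notation io' := (cot_incl (rc_rho (rcomod_of rhoP)) (bc_lam X)).
Local Notation E := (rcomod_of (cotr_rhoP rho X hD)).
Local Notation E' := (cot_ob hD X (rcomod_of rhoP)).

Let jD (x y : E') : io' (x + y) = io' x + io' y :> W ⊗ X.
Proof. exact: (bhomD io'). Qed.
Let jR (x : E') b : io' (x <* b) = (io' x : W ⊗ X) <* b.
Proof. exact: (bhomR io'). Qed.
Let j : bhom E' (rmod_of (W ⊗ X)) := @rbhom k B E' (rmod_of (W ⊗ X)) _ jD jR.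

Let ex (z : E') : exists e, rhom_of io e = j z.
Proof. exact: (@bincl_ex _ _ _ _ _ _ _ (io' z) (binclP z)). Qed.

Let inj : injective (rhom_of io).
Proof. exact: cot_incl_inj. Qed.

(** [E'] and [E] are the same subgroup of [W ⊗ X], obtained by forgetting the left action of [W]
    before and after cotensoring. The first is a value of the functor, the second keeps track of the
    bimodule. *)
Definition cot_cast_bhom : bhom E' E := bfactor inj ex.

Lemma cot_cast_bhomE z : io (cot_cast_bhom z) = io' z.
Proof. exact: (bfactorE inj ex). Qed.

Lemma cot_cast_colinear : colinear (rc_rho E') (rc_rho E) cot_cast_bhom.
Proof.
have injD : injective (tmap io (bid D)).
  by apply: left_flat_inj => //; apply: cot_incl_inj.
move=> z; apply: injD; rewrite [LHS]cotr_rhoE.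
have -> w : tmap io (bid D) (tmap cot_cast_bhom (bid D) w) = tmap io' (bid D) w.
  by tensor_elim w; rewrite !tmapE cot_cast_bhomE.
by rewrite cotr_rhoE cot_cast_bhomE.
Qed.

Definition cot_cast : rcomod_hom E' E := RComodHom cot_cast_colinear.

Lemma cot_cast_bij : bijective cot_cast.
Proof.
apply: inj_surj_bij => [x y e|e].
  apply: (@cot_incl_inj _ _ _ _ _ _ (rc_rho (rcomod_of rhoP)) _ (bc_lam X)).
  rewrite -[LHS]cot_cast_bhomE -[RHS]cot_cast_bhomE; congr (io _); exact: e.
have [z hz] : exists z, io' z = io e :> W ⊗ X.
  exact: (@bincl_ex _ _ _ _ _ _ _ (io e) (binclP e)).
by exists z; apply: inj; rewrite -hz; exact: cot_cast_bhomE.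
Qed.

End CotensorCast.

Section RComodOfHom.
Variables (k : comPzRingType) (R B : kalg k) (D : coring B) (V V' : bimod R B).
Variables (rho : bhom V (V ⊗ D)) (rho' : bhom V' (V' ⊗ D)).
Variables (rhoP : right_coaction rho) (rhoP' : right_coaction rho').
Variables (f : bhom V V') (fC : colinear rho rho' f).

Lemma rcomod_of_colinear :
  colinear (rc_rho (rcomod_of rhoP)) (rc_rho (rcomod_of rhoP')) (rhom_of f).
Proof. exact: fC. Qed.

Definition rcomod_of_hom : rcomod_hom (rcomod_of rhoP) (rcomod_of rhoP') :=
  RComodHom rcomod_of_colinear.

End RComodOfHom.

Section Multiplication.
Variables (k : comPzRingType) (R S B : kalg k) (D : coring B).
Variables (M : bimod R S) (V : bimod S B) (rho : bhom V (V ⊗ D)).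
Variable rhoP : right_coaction rho.

Let Vr := rcomod_of rhoP.
Let MV := rcomod_of (tens_rhoP M rhoP).

Let lmulR s (v : V) b : s *> (v <* b) = (s *> v) <* b.
Proof. by rewrite lractA. Qed.

Definition lmul_bhom s : bhom Vr Vr :=
  @rbhom k B Vr Vr (fun v => s *> (v : V)) (lactDr s) (lmulR s).

Lemma lmul_tmap s (Q : kalg k) (N : bimod B Q) (x : Vr ⊗ N) :
  tmap (lmul_bhom s) (bid N) x = s *> (x : V ⊗ N) :> V ⊗ N.
Proof.
elim/tensor_ind: x => [v n|x y hx hy].
  by rewrite tmapE; apply: esym; exact: (lact_pure s (v : V) n).
rewrite bhomD hx hy; apply: esym; exact: (@lactDr _ _ _ (V ⊗ N) s x y).
Qed.

Lemma lmul_colinear s : colinear (rc_rho Vr) (rc_rho Vr) (lmul_bhom s).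
Proof. by move=> v; rewrite [LHS](bhomL rho s v) lmul_tmap. Qed.

Definition lmul s : rcomod_hom Vr Vr := RComodHom (lmul_colinear s).

Let pmulR (m : M) (v : V) b : m ⊙ (v <* b) = (m ⊙ v) <* b.
Proof. by rewrite ract_pure. Qed.

Definition pmul_bhom m : bhom Vr MV :=
  @rbhom k B Vr MV (fun v => m ⊙ (v : V)) (pureDr m) (pmulR m).

Lemma pmul_tmap m (Q : kalg k) (N : bimod B Q) (x : Vr ⊗ N) :
  tmap (pmul_bhom m) (bid N) x = tassocV M V N (m ⊙ (x : V ⊗ N)) :> M ⊗ V ⊗ N.
Proof.
elim/tensor_ind: x => [v n|x y hx hy].
  by rewrite tmapE; apply: esym; exact: (tassocVE m (v : V) n).
rewrite bhomD hx hy; apply: esym.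
have e : m ⊙ ((x : V ⊗ N) + (y : V ⊗ N)) = m ⊙ (x : V ⊗ N) + m ⊙ (y : V ⊗ N).
  exact: pureDr.
have e2 := etrans (congr1 (tassocV M V N) e) (bhomD (tassocV M V N) _ _).
exact e2.
Qed.

Lemma pmul_colinear m : colinear (rc_rho Vr) (rc_rho MV) (pmul_bhom m).
Proof. by move=> v; rewrite [LHS](tens_rhoE rho m v) pmul_tmap. Qed.

Definition pmul m : rcomod_hom Vr MV := RComodHom (pmul_colinear m).

End Multiplication.

Section TensorCotensor.
Variables (k : comPzRingType) (R S A B : kalg k) (C : coring A) (D : coring B).
Variables (M : bimod R S) (W : bimod S A) (rho : bhom W (W ⊗ C)).
Variables (rhoP : right_coaction rho).
Variables (hD : left_flat D) (X : bicomod C D) (hX : right_invertible hD X).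

Let E := cotensor rho (bc_lam X).
Let io : bhom E (W ⊗ X) := cot_incl rho (bc_lam X).
Let Wr := rcomod_of rhoP.
Let MW := rcomod_of (tens_rhoP M rhoP).
Let Z := rcomod_of (tens_rhoP M (cotr_rhoP rho X hD)).

Local Notation F V := (cot_ob hD X V).
Local Notation ioF V := (cot_incl (rc_rho V) (bc_lam X)).

(* Since F = - □ X is full and faithful, a colinear map out of M ⊗ F(W) is the
   same as a colinear map out of M ⊗ W, and thus M ⊗ F(W) represents the same
   functor as F(M ⊗ W). *)
Lemma tcot_bij : bijective (tcot M rho (bc_lam X)).
Proof.
(* [U] is a comodule with [F(U)] isomorphic to [Z = M ⊗ F(W)]; it is going to be compared with
   [M ⊗ W]. *)
have [U [zeta [zeta' [zK zVK]]]] := rinv_surj hX Z.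
pose ka := cot_cast rhoP hD X.
pose phi m : rcomod_hom (F Wr) Z :=
  rcomod_comp (pmul (cotr_rhoP rho X hD) m) ka.
(* For fixed [m], the map [e |-> zeta (m ⊗ e)] is colinear from [F(W)] to [F(U)] and lifts to
   [psi m : W -> U]. Balancedness of [psi] in [m] then glues these lifts to [Psi : M ⊗ W -> U]. *)
have psi_ex m : exists f : rcomod_hom Wr U, forall z,
    ioF U (zeta (m ⊙ (ka z : E))) = tmap f (bid X) (io (ka z)).
  have [f hf] := rinv_full hX (rcomod_comp zeta (phi m)).
  exists f => z; rewrite [io _](cot_cast_bhomE z); exact: hf.
pose psi m := projT1 (cid (psi_ex m)).
have psiE m e : ioF U (zeta (m ⊙ (e : E))) = tmap (psi m) (bid X) (io e).
  have [g _ gK] := cot_cast_bij rhoP hD X.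
  rewrite -[e]gK; exact: (projT2 (cid (psi_ex m))).
have faith V (f g : rcomod_hom Wr V) :
    (forall e, tmap f (bid X) (io e) = tmap g (bid X) (io e)) -> f =1 g.
  move=> h; apply: (rinv_faithful hX) => z.
  have e := cot_cast_bhomE z.
  have := h (ka z); rewrite [io _]e; exact.
have psiDl m m' w : psi (m + m') w = psi m w + psi m' w.
  have /(_ w) <- /= : rcomod_sub (psi (m + m')) (psi m') =1 psi m.
    by apply: faith => e; rewrite tmap_subl -!psiE pureDl bhomD bhomD addrK.
  by rewrite subrK.
have psi_bal m s (w : W) : psi (m <* s) w = psi m (s *> w).
  move: w; apply: (faith _ (psi (m <* s)) (rcomod_comp (psi m) (lmul rhoP s))) => e.
  rewrite tmap_compl -psiE pure_bal psiE; congr (tmap _ _ _).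
have psi_balanced : balanced (@ract k R S M) (@lact k S A W) (fun m w => psi m w).
  by split=> //; move=> m; exact: (bhomD (psi m)).
have psiR (x : M ⊗ W) a : tlift (fun m w => psi m w) (x <* a) =
    tlift (fun m w => psi m w) x <* a.
  elim/tensor_ind: x => [m w|x y hx hy].
    by rewrite ract_pure !(tlift_pure psi_balanced) -bhomR.
  by rewrite ractDl !(tliftD psi_balanced) hx hy ractDl.
pose Psi0 : bhom MW U := @rbhom k A MW U _ (tliftD psi_balanced) psiR.
have Psi0E m w : Psi0 (m ⊙ (w : W)) = psi m w by apply: (tlift_pure psi_balanced).
have Psi0C : colinear (rc_rho MW) (rc_rho U) Psi0.
  have {}Psi0C m w : rc_rho U (Psi0 (m ⊙ (w : W))) =
      tmap Psi0 (bid C) (rc_rho MW (m ⊙ (w : W))).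
    rewrite Psi0E rch_colinear.
    have -> : rc_rho MW (m ⊙ (w : W)) = tassocV M W C (m ⊙ rho w).
      exact: tens_rhoE.
    rewrite -[tassocV _ _ _ _](@pmul_tmap _ _ _ _ C M W rho rhoP m _ C (rc_rho Wr w)) -tmap_compl.
    by congr (tmap _ _ _); apply: bhom_ext => w'; rewrite bcompE [RHS]Psi0E.
  move=> x; elim/tensor_ind: x => [m w|x y hx hy]; first exact: Psi0C.
  have -> : Psi0 (x + y) = Psi0 x + Psi0 y := tliftD psi_balanced x y.
  have -> : rc_rho MW (x + y) = rc_rho MW x + rc_rho MW y := bhomD (rc_rho MW) x y.
  by rewrite !bhomD hx hy.
pose Psi : rcomod_hom MW U := RComodHom Psi0C.
have Psi_tcot y : ioF U (zeta y) =
   tmap Psi (bid X) (cot_incl (tens_rho M rho) (bc_lam X) (tcot M rho (bc_lam X) y)).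
  rewrite tcotE; elim/tensor_ind: y => [m e|y z hy hz].
    rewrite psiE [tmap _ _ (m ⊙ e)]tmapE.
    rewrite -[tassocV _ _ _ _](@pmul_tmap _ _ _ _ C M W rho rhoP m _ X (io e)) -tmap_compl.
    by congr (tmap _ _ _); apply: bhom_ext => w; rewrite bcompE [RHS]Psi0E.
  have -> : zeta (y + z) = zeta y + zeta z := bhomD zeta y z.
  by rewrite !bhomD hy hz.
pose t0 : rcomod_hom Z _ := rcomod_of_hom (tens_rhoP M (cotr_rhoP rho X hD))
  (cotr_rhoP (tens_rho M rho) X hD) (@tcot_colinear _ _ _ _ _ C D M W rho hD X).
have [c [cK cVK]] := rcomod_hom_bij (cot_cast_bij (tens_rhoP M rhoP) hD X).
(* In the other direction, [t : U -> M ⊗ W] is the lift of [tcot ∘ zeta']. *)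
have [t ht] := rinv_full hX (rcomod_comp c (rcomod_comp t0 zeta')).
have {}ht u : tmap t (bid X) (ioF U u) =
    cot_incl (tens_rho M rho) (bc_lam X) (tcot M rho (bc_lam X) (zeta' u)).
  rewrite -ht; have := cot_cast_bhomE (c (t0 (zeta' u))).
  by rewrite -[cot_cast_bhom _ _ _ _]/(cot_cast _ _ _ _) cVK => ->.
have tPsi x : t (Psi x) = x.
  elim/tensor_ind: x => [m w|x y hx hy]; last first.
    have -> : Psi (x + y) = Psi x + Psi y := bhomD Psi x y.
    by rewrite bhomD hx hy.
  rewrite [Psi _]Psi0E; move: w.
  apply: (faith _ (rcomod_comp t (psi m)) (pmul rhoP m)) => e.
  rewrite tmap_compl -psiE ht zK tcotE [tmap _ _ (m ⊙ e)]tmapE.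
  by rewrite [RHS]pmul_tmap.
(* [F(Psi) ∘ tcot = zeta] is injective, hence so is [tcot]. Since [tcot ∘ zeta'] is [F(t)] and
   [t ∘ Psi] is the identity, every [e] equals [tcot (zeta' (F(Psi) e))]. *)
apply: inj_surj_bij => [x y exy|e].
  apply: (can_inj zK); apply: (@cot_incl_inj _ _ _ _ _ _ (rc_rho U) _ (bc_lam X)).
  by rewrite !Psi_tcot exy.
exists (zeta' (cot_hom hD X Psi (c e))).
apply: (@cot_incl_inj _ _ _ _ _ _ (tens_rho M rho) _ (bc_lam X)).
rewrite -ht cot_hom_bhomE -tmap_compl.
have -> : bcomp t Psi = bid _ by apply: bhom_ext => x; apply: tPsi.
rewrite tmap_id; have := cot_cast_bhomE (c e).
by rewrite -[cot_cast_bhom _ _ _ _]/(cot_cast _ _ _ _) cVK => ->.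
Qed.

End TensorCotensor.

(** * Associativity and units of the cotensor product *)

Lemma left_flat_tens_inj (k : comPzRingType) (R S A B : kalg k) (D : bimod S A)
    (Z : bimod A B) (M N : bimod R S) (i : bhom M N) :
  left_flat D -> left_flat Z -> injective i -> injective (tmap i (bid (D ⊗ Z))).
Proof.
move=> hD hZ i_inj; have inj := left_flat_inj hZ (left_flat_inj hD i_inj).
have e x : tmap i (bid (D ⊗ Z)) x =
    tassoc _ _ _ (tmap (tmap i (bid D)) (bid Z) (tassocV _ _ _ x)).
  elim/tensor_ind: x => [m x|x y hx hy]; last by rewrite !bhomD hx hy.
  by tensor_elim x; rewrite !bhomE.
move=> x y; rewrite !e => /tassoc_inj/inj.
by move/(can_inj (@tassocVK _ _ _ _ _ _ _ _)).
Qed.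

Section Associativity.
Variables (k : comPzRingType) (R A B Q : kalg k).
Variables (C : coring A) (D : coring B) (E : coring Q).
Variables (hC : right_flat C) (hD : left_flat D) (hE : left_flat E).
Variables (M : bimod R A) (rho : bhom M (M ⊗ C)).
Variables (Y : bicomod C D) (Z : bicomod D E) (hZ : right_invertible hE Z).

Let N : bicomod C E := cot hC hE Y Z.
Let inN : bhom N (Y ⊗ Z) := cot_incl (bc_rho Y) (bc_lam Z).
Let inL := cot_incl rho (bc_lam N).
Let P := cotensor rho (bc_lam Y).
Let rhoP : bhom P (P ⊗ D) := cotr_rho rho Y hD.
Let inP : bhom P (M ⊗ Y) := cot_incl rho (bc_lam Y).
Let inR := cot_incl rhoP (bc_lam Z).

(** Both iterated cotensor products are compared as subgroups of [M ⊗ Y ⊗ Z]. That [M ⊗ (Y □ Z)]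
    embeds there is not a matter of flatness of [M]: the map is the bijection [tcot] followed by an
    inclusion. *)
Definition assoc_src : bhom (M ⊗ N) (M ⊗ Y ⊗ Z) :=
  bcomp (tassocV M Y Z) (tmap (bid M) inN).
Let J := assoc_src.
Definition assoc_srcL : bhom (cotensor rho (bc_lam N)) (M ⊗ Y ⊗ Z) := bcomp J inL.
Let jL := assoc_srcL.
Definition assoc_tgt : bhom (cotensor rhoP (bc_lam Z)) (M ⊗ Y ⊗ Z) :=
  bcomp (tmap inP (bid Z)) inR.
Let jR := assoc_tgt.

Let Z_flat : left_flat Z := rinv_left_flat hZ hD.

Let JE x : J x = cot_incl (tens_rho M (bc_rho Y)) (bc_lam Z)
                   (tcot M (bc_rho Y) (bc_lam Z) x).
Proof. by rewrite tcotE. Qed.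

Let J_inj : injective J.
Proof.
move=> x y; rewrite !JE => /cot_incl_inj.
exact/bij_inj/(tcot_bij M (bc_rhoP Y) hZ).
Qed.

Let jL_inj : injective jL.
Proof. by apply: inj_comp => //; apply: cot_incl_inj. Qed.

Lemma assoc_tgt_inj : injective jR.
Proof.
apply: inj_comp; last exact: cot_incl_inj.
by apply: left_flat_inj => //; apply: cot_incl_inj.
Qed.

Let Th : bhom (M ⊗ (C ⊗ N)) (M ⊗ (C ⊗ Y) ⊗ Z) :=
  bcomp (tassocV _ _ _) (bcomp (tmap (bid M) (tassocV _ _ _))
    (tmap (bid M) (tmap (bid C) inN))).

(** Up to reassociation [Th] is [J] with [M ⊗ C] in place of [M], so [tcot_bij] applies again. *)
Let Th_inj : injective Th.
Proof.
have e x : Th x = tmap (tassoc M C Y) (bid Z) (cot_incl (tens_rho (M ⊗ C) (bc_rho Y)) (bc_lam Z)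
    (tcot (M ⊗ C) (bc_rho Y) (bc_lam Z) (tassocV _ _ _ x))).
  rewrite tcotE; elim/tensor_ind: x => [m x|x y hx hy]; last by rewrite !bhomD hx hy.
  elim/tensor_ind: x => [c n|x y hx hy]; last by rewrite !(pureDr, bhomD) hx hy.
  rewrite /Th !bhomE -/inN.
  by tensor_elim (inN n); rewrite !bhomE.
have aK : cancel (tmap (tassoc M C Y) (bid Z)) (tmap (tassocV M C Y) (bid Z)).
  move=> x; rewrite -tmap_compl.
  by rewrite (_ : bcomp _ _ = bid _) ?tmap_id //; apply: bhom_ext => y; apply: tassocK.
move=> x y; rewrite !e => /(can_inj aK)/cot_incl_inj.
move/(bij_inj (tcot_bij (M ⊗ C) (bc_rhoP Y) hZ)).
exact: (can_inj (@tassocVK _ _ _ _ _ _ _ _)).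
Qed.

(** Through [J] and [Th], the pair of maps defining [M □ N] becomes the pair defining [M □ Y],
    tensored with [Z] ([T1], [T2]). Likewise [inP] carries the pair defining [P □ Z] to the one
    defining [(M ⊗ Y) □ Z] ([T3], [T4]). *)
Let T1 x : tmap (cot_f rho Y) (bid Z) (J x) = Th (cot_f rho N x).
Proof.
elim/tensor_ind: x => [m n|x y hx hy]; last by rewrite !bhomD hx hy.
rewrite /J /Th /assoc_src /cot_f !bhomE.
transitivity (tmap (tassoc M C Y) (bid Z)
   (tassocV _ _ _ (rho m ⊙ inN n))).
  by tensor_elim (inN n); rewrite !bhomE.
tensor_elim (rho m); rewrite !bhomE.
by tensor_elim (inN n); rewrite !bhomE.
Qed.

Let T2 x : tmap (cot_g M (bc_lam Y)) (bid Z) (J x) = Th (cot_g M (bc_lam N) x).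
Proof.
elim/tensor_ind: x => [m n|x y hx hy]; last by rewrite !bhomD hx hy.
rewrite /J /Th /assoc_src /cot_g !bhomE cotl_lamE -/inN.
tensor_elim (inN n); rewrite !bhomE.
by set u := bc_lam Y _; tensor_elim u; rewrite !bhomE.
Qed.

Let T3 v : tmap inP (bid (D ⊗ Z)) (cot_f rhoP Z v) =
  cot_f (tens_rho M (bc_rho Y)) Z (tmap inP (bid Z) v).
Proof.
elim/tensor_ind: v => [p z|x y hx hy]; last by rewrite !bhomD hx hy.
rewrite /cot_f !bcompE !tmapE !bidE /tens_rho bcompE -cotr_rhoE -/inP -/rhoP.
by tensor_elim (rhoP p); rewrite !bhomE.
Qed.

Let T4 v : tmap inP (bid (D ⊗ Z)) (cot_g P (bc_lam Z) v) =
  cot_g (M ⊗ Y) (bc_lam Z) (tmap inP (bid Z) v).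
Proof. by tensor_elim v; rewrite /cot_g !bhomE. Qed.

(** Flatness of [Z] turns the equalizer condition into membership in [P ⊗ Z]. The condition for
    [P □ Z] is then tested in [(M ⊗ Y) ⊗ (D ⊗ Z)], into which [P ⊗ (D ⊗ Z)] embeds because [D] and
    [Z] are flat. *)
Let ex_lr l : exists r, jR r = jL l.
Proof.
have [v hv] : exists v, tmap inP (bid Z) v = jL l.
  by apply: left_flat_beq => //; rewrite T1 T2 binclP.
have [r hr] : exists r, inR r = v; last by exists r; rewrite /jR /assoc_tgt bcompE hr.
apply: bincl_ex; apply: (@left_flat_tens_inj _ _ _ _ _ D Z _ _ inP) => //.
  exact: cot_incl_inj.
rewrite T3 T4 hv [jL l]JE; exact: binclP.
Qed.

(** Surjectivity of [tcot] provides a preimage in [M ⊗ N], and injectivity of [Th] lets the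
    condition for [M □ N] be tested after [Th]. *)
Let ex_rl r : exists l, jL l = jR r.
Proof.
have [e he] : exists e, cot_incl (tens_rho M (bc_rho Y)) (bc_lam Z) e = jR r.
  by apply: bincl_ex; rewrite -T3 -T4 binclP.
have [x hx] : exists x, tcot M (bc_rho Y) (bc_lam Z) x = e.
  by have [g _ gK] := tcot_bij M (bc_rhoP Y) hZ; exists (g e).
have {he hx} hx : J x = jR r by rewrite -he -hx JE.
have [l hl] : exists l, inL l = x; last by exists l; rewrite /jL /assoc_srcL bcompE hl.
apply: bincl_ex; apply: Th_inj; rewrite -T1 -T2 hx /jR /assoc_tgt bcompE -!tmap_compl.
by congr (tmap _ _ _); apply: bhom_ext => p; exact: binclP.
Qed.

Definition assoc_map : bhom (cotensor rho (bc_lam N)) (cotensor rhoP (bc_lam Z)) :=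
  bfactor assoc_tgt_inj ex_lr.

Lemma assoc_mapE l : jR (assoc_map l) = jL l.
Proof. exact: bfactorE. Qed.

Lemma assoc_map_bij : bijective assoc_map.
Proof.
apply: inj_surj_bij => [x y e|r]; first by apply: jL_inj; rewrite -!assoc_mapE e.
have [l hl] := ex_rl r; exists l.
by apply: assoc_tgt_inj; rewrite assoc_mapE.
Qed.

Lemma assoc_map_colinear :
  colinear (cotr_rho rho N hE) (cotr_rho rhoP Z hE) assoc_map.
Proof.
have inj := left_flat_inj hE assoc_tgt_inj.
move=> l; apply: inj; rewrite -[RHS]tmap_compl.
have -> : bcomp assoc_tgt assoc_map = bcomp J inL.
  by apply: bhom_ext => x; apply: assoc_mapE.
rewrite !tmap_compl !cotr_rhoE -/inL -/inR.
transitivity (tassocV _ _ _ (tmap (bid (M ⊗ Y)) (bc_rho Z) (jR (assoc_map l)))).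
  rewrite [jR _]bcompE.
  elim/tensor_ind: (inR _) => [p z|x y hx hy]; last by rewrite !bhomD hx hy.
  by rewrite !bhomE; tensor_elim (bc_rho Z z); rewrite !bhomE.
rewrite assoc_mapE [jL _]bcompE.
elim/tensor_ind: (inL l) => [m n|x y hx hy]; last by rewrite !bhomD hx hy.
transitivity (tmap (tassocV _ _ _) (bid E) (tassocV _ _ _
   (m ⊙ (tmap inN (bid E) (bc_rho N n))))).
  rewrite cotr_rhoE -/inN /J /assoc_src bcompE !tmapE !bidE.
  elim/tensor_ind: (inN n) => [y z|x y hx hy]; last by rewrite !(pureDr, bhomD) hx hy.
  by rewrite !bhomE; tensor_elim (bc_rho Z z); rewrite !bhomE.
by rewrite tmapE; tensor_elim (bc_rho N n); rewrite /J /assoc_src !bhomE.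
Qed.

End Associativity.

Section AssociativityBicomod.
Variables (k : comPzRingType) (Q A B S : kalg k).
Variables (H : coring Q) (C : coring A) (D : coring B) (E : coring S).
Variables (hH : right_flat H) (hC : right_flat C).
Variables (hD : left_flat D) (hE : left_flat E).
Variables (X : bicomod H C) (Y : bicomod C D) (Z : bicomod D E).
Variable hZ : right_invertible hE Z.

Let N : bicomod C E := cot hC hE Y Z.
Let P : bicomod H D := cot hH hD X Y.
Let inN : bhom N (Y ⊗ Z) := cot_incl (bc_rho Y) (bc_lam Z).
Let inL := cot_incl (bc_rho X) (bc_lam N).
Let inP : bhom P (X ⊗ Y) := cot_incl (bc_rho X) (bc_lam Y).
Let inR := cot_incl (bc_rho P) (bc_lam Z).
Let al : bhom (cot hH hE X N) (cot hH hE P Z) := assoc_map hC hD (bc_rho X) Y hZ.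
Let J := assoc_src hC hE X Y Z.
Let jR : bhom (cot hH hE P Z) (X ⊗ Y ⊗ Z) := assoc_tgt hD (bc_rho X) Y Z.

Let jRE l : jR (al l) = J (inL l).
Proof. exact: assoc_mapE. Qed.

Lemma assoc_map_lcolinear :
  lcolinear (bc_lam (cot hH hE X N)) (bc_lam (cot hH hE P Z)) al.
Proof.
have inj := right_flat_inj hH (assoc_tgt_inj (hD := hD) (rho := bc_rho X) (Y := Y) hZ).
move=> l; apply: inj; rewrite -[RHS]tmap_compr.
have -> : bcomp (assoc_tgt hD (bc_rho X) Y Z) al = bcomp J inL.
  by apply: bhom_ext => x; apply: jRE.
rewrite !tmap_compr [tmap _ inR _]cotl_lamE [tmap _ inL _]cotl_lamE -/inL -/inR.
transitivity (tmap (bid H) (tassocV _ _ _) (tassoc H X (Y ⊗ Z)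
   (tmap (bc_lam X) (bid _) (tassoc _ _ _ (jR (al l)))))).
  rewrite [jR _]bcompE.
  elim/tensor_ind: (inR _) => [p z|x y hx hy]; last by rewrite !bhomD hx hy.
  transitivity (tassoc _ _ _ (tmap (bid H) inP (bc_lam P p) ⊙ z)).
    by rewrite tmapE bidE; tensor_elim (bc_lam P p); rewrite !bhomE.
  rewrite [tmap _ inP _]cotl_lamE -/inP tmapE bidE.
  elim/tensor_ind: (inP p) => [x y|x y hx hy]; last by rewrite !(pureDl, bhomD) hx hy.
  by rewrite !bhomE; tensor_elim (bc_lam X x); rewrite !bhomE.
rewrite jRE.
elim/tensor_ind: (inL l) => [x n|x y hx hy]; last by rewrite !bhomD hx hy.
rewrite /J /assoc_src bcompE tassocVK !tmapE !bidE -/inN.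
by tensor_elim (bc_lam X x); rewrite !bhomE.
Qed.

Lemma cot_assoc_iso : bicomod_iso (cot hH hE X N) (cot hH hE P Z).
Proof.
exists al; split; [exact: assoc_map_bij | exact: assoc_map_lcolinear |].
exact: assoc_map_colinear.
Qed.

End AssociativityBicomod.

Section AssociativityFunctor.
Variables (k : comPzRingType) (A B S : kalg k).
Variables (C : coring A) (D : coring B) (E : coring S).
Variables (hC : right_flat C) (hD : left_flat D) (hE : left_flat E).
Variables (Y : bicomod C D) (Z : bicomod D E) (hZ : right_invertible hE Z).

Lemma cot_functor_comp : natural_iso (cot_functor hE (cot hC hE Y Z))
  (functor_comp (cot_functor hE Z) (cot_functor hD Y)).
Proof.
pose N : bicomod C E := cot hC hE Y Z.
pose u (M : rcomod C) : rcomod_hom (cot_ob hE N M) (cot_ob hE Z (cot_ob hD Y M)) :=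
  @RComodHom _ _ _ (cot_ob hE N M) (cot_ob hE Z (cot_ob hD Y M))
    (assoc_map hC hD (rc_rho M) Y hZ)
    (assoc_map_colinear (hC := hC) hD (rho := rc_rho M) (Y := Y) hZ).
have u_bij M : exists v : rcomod_hom (cot_ob hE Z (cot_ob hD Y M)) (cot_ob hE N M),
    cancel (u M) v /\ cancel v (u M).
  exact/rcomod_hom_bij/(assoc_map_bij hC hD (rc_rho M) Y hZ).
exists u, (fun M => projT1 (cid (u_bij M))); split=> [M M' f|M|M].
- apply: rcomod_hom_ext => l.
  apply: (assoc_tgt_inj (hD := hD) (rho := rc_rho M') (Y := Y) hZ).
  transitivity (tmap (tmap f (bid Y)) (bid Z) (assoc_tgt hD (rc_rho M) Y Z (u M l))).
    rewrite [assoc_tgt _ _ _ _ (u M l)]assoc_mapE [LHS]assoc_mapE.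
    rewrite /assoc_srcL ![bcomp _ _ _]bcompE.
    rewrite [X in assoc_src _ _ _ _ _ X = _](cot_hom_bhomE (X := N) f l).
    elim/tensor_ind: (cot_incl _ _ _) => [m n|x y hx hy]; last by rewrite !bhomD hx hy.
    rewrite tmapE /assoc_src !bcompE !tmapE !bidE.
    by set w := cot_incl _ _ n; tensor_elim w; rewrite !bhomE.
  rewrite /assoc_tgt ![bcomp _ _ _]bcompE.
  rewrite [X in _ = tmap _ _ X](cot_hom_bhomE (X := Z) (cot_hom hD Y f) (u M l)).
  rewrite -!tmap_compl; congr (tmap _ _ _); apply: bhom_ext => p.
  by rewrite !bcompE cot_hom_bhomE.
- by apply: rcomod_hom_ext; apply: (proj1 (projT2 (cid (u_bij M)))).
- by apply: rcomod_hom_ext; apply: (proj2 (projT2 (cid (u_bij M)))).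
Qed.

End AssociativityFunctor.

Section RightUnit.
Variables (k : comPzRingType) (R A : kalg k) (C : coring A).
Variables (hC : left_flat C) (M : bimod R A) (rho : bhom M (M ⊗ C)).
Hypothesis rhoP : right_coaction rho.

Let io := cot_incl rho (bc_lam (regular_bicomod C)).

Lemma cot_unitr_ex m : exists e, io e = rho m.
Proof.
by apply: bincl_ex; rewrite /cot_f bcompE; exact: (rcoact_assoc rhoP).
Qed.

Definition cot_unitr : bhom M (cotensor rho (bc_lam (regular_bicomod C))) :=
  bfactor (@cot_incl_inj _ _ _ _ _ _ _ _ _) cot_unitr_ex.

Lemma cot_unitrE m : io (cot_unitr m) = rho m.
Proof. exact: bfactorE. Qed.

(** The fork [M -> M ⊗ C => M ⊗ (C ⊗ C)] is split by the counit: [r ∘ rho] and [s ∘ cot_g] are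
    identities and [s ∘ cot_f = rho ∘ r]. Hence an element [e] of the equalizer is [rho (r e)]. *)
Lemma cot_unitr_bij : bijective cot_unitr.
Proof.
pose r : bhom (M ⊗ C) M := bcomp (runit M) (tmap (bid M) (cor_eps C)).
have rK m : r (rho m) = m by apply: (rcoact_counit rhoP).
apply: inj_surj_bij => [x y e|e].
  by rewrite -[x]rK -[y]rK -!cot_unitrE e.
exists (r (io e)); apply: (@cot_incl_inj _ _ _ _ _ _ rho _ _); rewrite -/io cot_unitrE.
pose s : bhom (M ⊗ (C ⊗ C)) (M ⊗ C) :=
  tmap (bid M) (bcomp (runit C) (tmap (bid C) (cor_eps C))).
have s1 x : s (cot_f rho C x) = rho (r x).
  elim/tensor_ind: x => [m c|x y hx hy]; last by rewrite !bhomD hx hy.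
  rewrite /cot_f /r !bhomE bhomR.
  elim/tensor_ind: (rho m) => [m' c'|x y hx hy]; last first.
    by rewrite ractDl pureDl !bhomD hx hy.
  by rewrite /s !bhomE ract_pure.
have s2 x : s (cot_g M (cor_delta C) x) = x.
  elim/tensor_ind: x => [m c|x y hx hy]; last by rewrite !bhomD hx hy.
  by rewrite /cot_g /s !tmapE bcompE cor_counitr.
by rewrite -s1 -[RHS]s2; congr (s _); exact: (binclP e).
Qed.

Lemma cot_unitr_colinear :
  colinear rho (cotr_rho rho (regular_bicomod C) hC) cot_unitr.
Proof.
have inj : injective (tmap io (bid C)).
  by apply: left_flat_inj => //; apply: cot_incl_inj.
move=> m; apply: inj; rewrite cotr_rhoE -tmap_compl -/io cot_unitrE.
have -> : bcomp io cot_unitr = rho by apply: bhom_ext => x; apply: cot_unitrE.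
by apply: tassoc_inj; rewrite tassocVK (rcoact_assoc rhoP).
Qed.

End RightUnit.

Section LeftUnit.
Variables (k : comPzRingType) (A B : kalg k) (C : coring A) (D : coring B).
Variables (hC : right_flat C) (hD : left_flat D) (X : bicomod C D).

Let io := cot_incl (bc_rho (regular_bicomod C)) (bc_lam X).

Lemma cot_unitl_ex x : exists e, io e = bc_lam X x.
Proof.
by apply: bincl_ex; rewrite /cot_f bcompE; exact: (lcoact_assoc (bc_lamP X)).
Qed.

Definition cot_unitl : bhom X (cot hC hD (regular_bicomod C) X) :=
  bfactor (@cot_incl_inj _ _ _ _ _ _ _ _ _) cot_unitl_ex.

Lemma cot_unitlE x : io (cot_unitl x) = bc_lam X x.
Proof. exact: bfactorE. Qed.

(** The mirror splitting, where the counit on the first factor undoes [cot_f] instead of [cot_g]. *)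
Lemma cot_unitl_bij : bijective cot_unitl.
Proof.
pose r : bhom (C ⊗ X) X := bcomp (lunit X) (tmap (cor_eps C) (bid X)).
have rK x : r (bc_lam X x) = x by apply: (lcoact_counit (bc_lamP X)).
apply: inj_surj_bij => [x y e|e].
  by rewrite -[x]rK -[y]rK -!cot_unitlE e.
exists (r (io e)); apply: (@cot_incl_inj _ _ _ _ _ _ (bc_rho (regular_bicomod C)) _ _).
rewrite -/io cot_unitlE.
pose s : bhom (C ⊗ (C ⊗ X)) (C ⊗ X) :=
  bcomp (lunit (C ⊗ X)) (tmap (cor_eps C) (bid (C ⊗ X))).
have s1 x : s (cot_g C (bc_lam X) x) = bc_lam X (r x).
  elim/tensor_ind: x => [c x|x y hx hy]; last by rewrite !bhomD hx hy.
  by rewrite /cot_g /s /r !bhomE bhomL.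
have s2 x : s (cot_f (cor_delta C) X x) = x.
  elim/tensor_ind: x => [c x|x y hx hy]; last by rewrite !bhomD hx hy.
  rewrite /cot_f /s !bhomE -[in RHS](cor_counitl c).
  by tensor_elim (cor_delta C c); rewrite !bhomE lact_pure.
by rewrite -s1 -[RHS]s2; congr (s _); apply: esym; exact: (binclP e).
Qed.

Lemma cot_unitl_iso : bicomod_iso (cot hC hD (regular_bicomod C) X) X.
Proof.
apply: bicomod_iso_sym; exists cot_unitl; split; first exact: cot_unitl_bij.
- have inj : injective (tmap (bid C) io).
    by apply: right_flat_inj => //; apply: cot_incl_inj.
  move=> x; apply: inj; rewrite [LHS]cotl_lamE -[RHS]tmap_compr -/io cot_unitlE.
  have -> : bcomp io cot_unitl = bc_lam X by apply: bhom_ext => y; apply: cot_unitlE.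
  exact: (lcoact_assoc (bc_lamP X)).
- have inj : injective (tmap io (bid D)).
    by apply: left_flat_inj => //; apply: cot_incl_inj.
  move=> x; apply: inj; rewrite [LHS]cotr_rhoE -[RHS]tmap_compl -/io cot_unitlE.
  have -> : bcomp io cot_unitl = bc_lam X by apply: bhom_ext => y; apply: cot_unitlE.
  by apply: tassoc_inj; rewrite tassocVK bc_compat.
Qed.

End LeftUnit.

Section RightUnitIso.
Variables (k : comPzRingType).

Lemma cot_unitr_iso (Q A : kalg k) (H : coring Q) (C : coring A)
    (hH : right_flat H) (hC : left_flat C) (X : bicomod H C) :
  bicomod_iso (cot hH hC X (regular_bicomod C)) X.
Proof.
apply: bicomod_iso_sym.
pose io := cot_incl (bc_rho X) (bc_lam (regular_bicomod C)).
exists (cot_unitr (bc_rhoP X) : bhom X (cot hH hC X (regular_bicomod C))).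
split; first exact: cot_unitr_bij; last exact: cot_unitr_colinear.
have inj : injective (tmap (bid H) io).
  by apply: right_flat_inj => //; apply: cot_incl_inj.
move=> x; apply: inj; rewrite [LHS]cotl_lamE -[RHS]tmap_compr cot_unitrE.
have -> : bcomp io (cot_unitr (bc_rhoP X)) = bc_rho X.
  by apply: bhom_ext => y; apply: cot_unitrE.
exact: bc_compat.
Qed.

Lemma cot_functor_regular (A : kalg k) (C : coring A) (hC : left_flat C) :
  natural_iso (cot_functor hC (regular_bicomod C)) (functor_id (comod C)).
Proof.
apply: natural_iso_sym.
pose u (M : rcomod C) : rcomod_hom M (cot_ob hC (regular_bicomod C) M) :=
  @RComodHom _ _ _ M (cot_ob hC (regular_bicomod C) M) (cot_unitr (rc_rhoP M))
    (cot_unitr_colinear hC (rc_rhoP M)).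
have u_bij M : exists v : rcomod_hom (cot_ob hC (regular_bicomod C) M) M,
    cancel (u M) v /\ cancel v (u M).
  apply: rcomod_hom_bij; exact: (cot_unitr_bij (rc_rhoP M)).
exists u, (fun M => projT1 (cid (u_bij M))).
split=> [M M' f|M|M].
- apply: rcomod_hom_ext => m.
  apply: (@cot_incl_inj _ _ _ _ _ _ (rc_rho M') _ (bc_lam (regular_bicomod C))).
  rewrite [LHS]cot_unitrE [RHS](cot_hom_bhomE (X := regular_bicomod C) f) cot_unitrE.
  exact: rch_colinear.
- by apply: rcomod_hom_ext; apply: (proj1 (projT2 (cid (u_bij M)))).
- by apply: rcomod_hom_ext; apply: (proj2 (projT2 (cid (u_bij M)))).
Qed.

End RightUnitIso.

(** * Functoriality of the cotensor product *)

Section CotensorMap.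
Variables (k : comPzRingType) (R A S : kalg k) (C : coring A).
Variables (M M' : bimod R A) (rho : bhom M (M ⊗ C)) (rho' : bhom M' (M' ⊗ C)).
Variables (N N' : bimod A S) (lam : bhom N (C ⊗ N)) (lam' : bhom N' (C ⊗ N')).
Variables (f : bhom M M') (g : bhom N N').
Hypotheses (fC : colinear rho rho' f) (gC : lcolinear lam lam' g).

Lemma cot_map_ex z : exists w,
  cot_incl rho' lam' w = bcomp (tmap f g) (cot_incl rho lam) z.
Proof.
apply: bincl_ex; rewrite bcompE.
have fE u : cot_f rho' N' (tmap f g u) = tmap f (tmap (bid C) g) (cot_f rho N u).
  elim/tensor_ind: u => [m n|x y hx hy]; last by rewrite !bhomD hx hy.
  rewrite tmapE /cot_f !bcompE !tmapE fC.
  by tensor_elim (rho m); rewrite !bhomE.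
have gE u : cot_g M' lam' (tmap f g u) = tmap f (tmap (bid C) g) (cot_g M lam u).
  elim/tensor_ind: u => [m n|x y hx hy]; last by rewrite !bhomD hx hy.
  by rewrite /cot_g !tmapE gC.
by rewrite fE gE; congr (tmap _ _ _); exact: binclP.
Qed.

Definition cot_map : bhom (cotensor rho lam) (cotensor rho' lam') :=
  bfactor (@cot_incl_inj _ _ _ _ _ _ _ _ _) cot_map_ex.

Lemma cot_mapE z : cot_incl rho' lam' (cot_map z) = tmap f g (cot_incl rho lam z).
Proof. exact: bfactorE. Qed.

End CotensorMap.

Section CotensorMapInverse.
Variables (k : comPzRingType) (R A S : kalg k) (C : coring A).
Variables (M M' : bimod R A) (rho : bhom M (M ⊗ C)) (rho' : bhom M' (M' ⊗ C)).
Variables (N N' : bimod A S) (lam : bhom N (C ⊗ N)) (lam' : bhom N' (C ⊗ N')).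
Variables (f : bhom M M') (g : bhom N N') (fV : bhom M' M) (gV : bhom N' N).
Hypotheses (fC : colinear rho rho' f) (gC : lcolinear lam lam' g).
Hypotheses (fVC : colinear rho' rho fV) (gVC : lcolinear lam' lam gV).

Lemma cot_mapK : cancel f fV -> cancel g gV ->
  cancel (cot_map fC gC) (cot_map fVC gVC).
Proof.
move=> fK gK z; apply: (@cot_incl_inj _ _ _ _ _ _ rho _ lam).
rewrite !cot_mapE; set u := cot_incl _ _ _.
by tensor_elim u; rewrite !tmapE fK gK.
Qed.

End CotensorMapInverse.

Section CotensorMapColinear.
Variables (k : comPzRingType).

Lemma cot_map_colinear (R A B : kalg k) (C : coring A) (D : coring B)
    (hD : left_flat D) (M M' : bimod R A)
    (rho : bhom M (M ⊗ C)) (rho' : bhom M' (M' ⊗ C)) (X X' : bicomod C D)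
    (f : bhom M M') (g : bhom X X')
    (fC : colinear rho rho' f) (gC : lcolinear (bc_lam X) (bc_lam X') g) :
  colinear (bc_rho X) (bc_rho X') g ->
  colinear (cotr_rho rho X hD) (cotr_rho rho' X' hD) (cot_map fC gC).
Proof.
move=> gR z.
have inj : injective (tmap (cot_incl rho' (bc_lam X')) (bid D)).
  by apply: left_flat_inj => //; apply: cot_incl_inj.
apply: inj; rewrite cotr_rhoE cot_mapE -tmap_compl.
have -> : bcomp (cot_incl rho' (bc_lam X')) (cot_map fC gC) =
    bcomp (tmap f g) (cot_incl rho (bc_lam X)).
  by apply: bhom_ext => x; apply: cot_mapE.
rewrite tmap_compl cotr_rhoE; set u := cot_incl _ _ _.
elim/tensor_ind: u => [m x|x y hx hy]; last by rewrite !bhomD hx hy.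
rewrite !tmapE gR !bidE.
by tensor_elim (bc_rho X x); rewrite !bhomE.
Qed.

Lemma cot_map_lcolinear (Q A S : kalg k) (H : coring Q) (C : coring A)
    (hH : right_flat H) (X X' : bicomod H C) (N N' : bimod A S)
    (lam : bhom N (C ⊗ N)) (lam' : bhom N' (C ⊗ N'))
    (f : bhom X X') (g : bhom N N')
    (fC : colinear (bc_rho X) (bc_rho X') f) (gC : lcolinear lam lam' g) :
  lcolinear (bc_lam X) (bc_lam X') f ->
  lcolinear (cotl_lam X lam hH) (cotl_lam X' lam' hH) (cot_map fC gC).
Proof.
move=> fL z.
have inj : injective (tmap (bid H) (cot_incl (bc_rho X') lam')).
  by apply: right_flat_inj => //; apply: cot_incl_inj.
apply: inj; rewrite cotl_lamE cot_mapE -tmap_compr.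
have -> : bcomp (cot_incl (bc_rho X') lam') (cot_map fC gC) =
    bcomp (tmap f g) (cot_incl (bc_rho X) lam).
  by apply: bhom_ext => x; apply: cot_mapE.
rewrite tmap_compr cotl_lamE; set u := cot_incl _ _ _.
elim/tensor_ind: u => [x n|x y hx hy]; last by rewrite !bhomD hx hy.
rewrite !tmapE fL !bidE.
by tensor_elim (bc_lam X x); rewrite !bhomE.
Qed.

Lemma bicomod_iso_inv (A B : kalg k) (C : coring A) (D : coring B)
    (X Y : bicomod C D) : bicomod_iso X Y ->
  exists (f : bhom X Y) (g : bhom Y X),
    [/\ cancel f g, cancel g f,
        lcolinear (bc_lam X) (bc_lam Y) f /\ lcolinear (bc_lam Y) (bc_lam X) g &
        colinear (bc_rho X) (bc_rho Y) f /\ colinear (bc_rho Y) (bc_rho X) g].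
Proof.
move=> [f [f_bij fL fR]]; have [g [fK gK]] := bhom_inv f_bij.
have gf : bcomp g f = bid X by apply: bhom_ext.
exists f, g; split=> //; split=> // y; rewrite -{2}[y]gK ?fL ?fR.
  by rewrite -tmap_compr gf tmap_id.
by rewrite -tmap_compl gf tmap_id.
Qed.

Lemma cot_iso (Q A B : kalg k) (H : coring Q) (C : coring A) (D : coring B)
    (hH : right_flat H) (hD : left_flat D) (X X' : bicomod H C)
    (Y Y' : bicomod C D) :
  bicomod_iso X X' -> bicomod_iso Y Y' ->
  bicomod_iso (cot hH hD X Y) (cot hH hD X' Y').
Proof.
move=> /bicomod_iso_inv [f [f' [fK f'K [fL f'L] [fR f'R]]]].
move=> /bicomod_iso_inv [g [g' [gK g'K [gL g'L] [gR g'R]]]].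
exists (cot_map fR gL : bhom (cot hH hD X Y) (cot hH hD X' Y')); split.
- by exists (cot_map f'R g'L); apply: cot_mapK.
- exact: cot_map_lcolinear.
- exact: cot_map_colinear.
Qed.

Lemma cot_functor_iso (A B : kalg k) (C : coring A) (D : coring B)
    (hD : left_flat D) (X X' : bicomod C D) :
  bicomod_iso X X' -> natural_iso (cot_functor hD X) (cot_functor hD X').
Proof.
move=> /bicomod_iso_inv [g [g' [gK g'K [gL g'L] [gR g'R]]]].
have idC (M : rcomod C) : colinear (rc_rho M) (rc_rho M) (bid M).
  by move=> m; rewrite tmap_id.
pose u (M : rcomod C) : rcomod_hom (cot_ob hD X M) (cot_ob hD X' M) :=
  @RComodHom _ _ _ (cot_ob hD X M) (cot_ob hD X' M) (cot_map (idC M) gL)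
    (cot_map_colinear hD (idC M) gL gR).
pose v (M : rcomod C) : rcomod_hom (cot_ob hD X' M) (cot_ob hD X M) :=
  @RComodHom _ _ _ (cot_ob hD X' M) (cot_ob hD X M) (cot_map (idC M) g'L)
    (cot_map_colinear hD (idC M) g'L g'R).
exists u, v; split=> [M M' f|M|M]; apply: rcomod_hom_ext => z.
- apply: (@cot_incl_inj _ _ _ _ _ _ (rc_rho M') _ (bc_lam X')).
  rewrite [LHS]cot_mapE [RHS](cot_hom_bhomE (X := X') f).
  rewrite [X in tmap _ _ X = _](cot_hom_bhomE (X := X) f).
  rewrite [X in _ = tmap _ _ X]cot_mapE; set w := cot_incl _ _ _.
  by tensor_elim w; rewrite !bhomE.
- exact: cot_mapK.
- exact: cot_mapK.
Qed.

End CotensorMapColinear.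

(** * Inverse bicomodules *)

Section FullFaithfulBimod.
Variables (k : comPzRingType) (A B : kalg k) (C : coring A) (D : coring B).
Variables (hD : left_flat D) (X : bicomod C D) (hX : right_invertible hD X).
Variables (R : kalg k) (W : bimod R A) (rho : bhom W (W ⊗ C)).
Variables (rhoP : right_coaction rho).

Let io := cot_incl rho (bc_lam X).
Let E := rcomod_of (cotr_rhoP rho X hD).

(** Here and in the next two lemmas, fullness and faithfulness are restated for a comodule carrying
    a left action, with the cotensor product formed before that action is forgotten. *)
Lemma rinv_faithful_of (V : rcomod C) (f g : rcomod_hom (rcomod_of rhoP) V) :
  (forall e, tmap f (bid X) (io e) = tmap g (bid X) (io e)) -> f =1 g.
Proof.
move=> h; apply: (rinv_faithful hX) => z.
have e := cot_cast_bhomE z.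
have := h (cot_cast rhoP hD X z); rewrite [io _]e; exact.
Qed.

Lemma rinv_full_of (V : rcomod C) (h : rcomod_hom E (cot_ob hD X V)) :
  exists f : rcomod_hom (rcomod_of rhoP) V,
    forall e, tmap f (bid X) (io e) = cot_incl (rc_rho V) (bc_lam X) (h e).
Proof.
have [f hf] := rinv_full hX (rcomod_comp h (cot_cast rhoP hD X)).
exists f => e; have [g _ gK] := cot_cast_bij rhoP hD X.
rewrite -[e]gK [io _](cot_cast_bhomE (g e)); apply: esym; exact: hf.
Qed.

Lemma rinv_full_bimod (S : kalg k) (V : bimod S A) (rhoV : bhom V (V ⊗ C))
    (rhoVP : right_coaction rhoV)
    (h : rcomod_hom E (rcomod_of (cotr_rhoP rhoV X hD))) :
  exists f : rcomod_hom (rcomod_of rhoP) (rcomod_of rhoVP),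
    forall e, tmap f (bid X) (io e) = cot_incl rhoV (bc_lam X) (h e) :> V ⊗ X.
Proof.
have [c [cK cVK]] := rcomod_hom_bij (cot_cast_bij rhoVP hD X).
have [f hf] := rinv_full_of (rcomod_comp c h).
exists f => e; rewrite [LHS]hf; have := cot_cast_bhomE (c (h e)).
by rewrite -[cot_cast_bhom _ _ _ _]/(cot_cast _ _ _ _) cVK => ->.
Qed.

End FullFaithfulBimod.

Section ScalarMultiplication.
Variables (k : comPzRingType) (A : kalg k) (C : coring A) (M : rcomod C) (x : k).

Let rmulkD (m n : M) : (m + n) <* kalg_map A x = m <* kalg_map A x + n <* kalg_map A x.
Proof. exact: ractDl. Qed.
Let rmulkR (m : M) a : (m <* a) <* kalg_map A x = (m <* kalg_map A x) <* a.
Proof. by rewrite !ractA kalg_central. Qed.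

(** Faithfulness compares this endomorphism with the transported left action to obtain the axiom
    [bimod_k]. *)
Definition rmulk_bhom : bhom M M :=
  @rbhom k A M M (fun m => m <* kalg_map A x) rmulkD rmulkR.

Lemma rmulk_tmap (B : kalg k) (N : bimod A B) (u : M ⊗ N) :
  tmap rmulk_bhom (bid N) u = u <* kalg_map B x.
Proof.
elim/tensor_ind: u => [m n|u v hu hv]; last by rewrite bhomD hu hv ractDl.
by rewrite tmapE bidE ract_pure -lract_k -pure_bal.
Qed.

Lemma rmulk_colinear : colinear (rc_rho M) (rc_rho M) rmulk_bhom.
Proof. by move=> m; rewrite rmulk_tmap; apply: bhomR. Qed.

Definition rmulk : rcomod_hom M M := RComodHom rmulk_colinear.

End ScalarMultiplication.

Section Preimage.
Variables (k : comPzRingType) (A B : kalg k) (C : coring A) (D : coring B).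
Variables (hD : left_flat D) (X : bicomod C D) (hX : right_invertible hD X).

Let Dr := rcomod_of (cor_rightP D).

Section Action.
Variables (W0 : rcomod C).
Variables (th : rcomod_hom Dr (cot_ob hD X W0)) (th' : rcomod_hom (cot_ob hD X W0) Dr).
Hypotheses (thK : cancel th th') (th'K : cancel th' th).

Let io := cot_incl (rc_rho W0) (bc_lam X).

(** Left multiplication by [b] on [D] is right colinear; conjugated by [th] it is an endomorphism of
    [F(W0)], which lifts. *)
Let la_ex b : exists f : rcomod_hom W0 W0, forall z,
  tmap f (bid X) (io z) = io (th (b *> (th' z : D))).
Proof.
have [f hf] := rinv_full hX (rcomod_comp th (rcomod_comp (lmul (cor_rightP D) b) th')).
by exists f => z; rewrite -hf.
Qed.

Let la b := projT1 (cid (la_ex b)).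
Let laE b z : tmap (la b) (bid X) (io z) = io (th (b *> (th' z : D))).
Proof. exact: (projT2 (cid (la_ex b))). Qed.

(** The axioms that relate several multiplications are identities between endomorphisms of [W0], and
    faithfulness reduces them to the corresponding identities in [D]. *)
Let la_axioms : @bimod_axioms k B A W0 (fun b w => la b w) (fun w a => w <* a).
Proof.
have thD (x y : D) : th (x + y) = th x + th y := bhomD th x y.
split=> [b|b b' w|b b' w|w|||||b w a|x w]; rewrite ?(ractDl, ractDr, ractA, ract1) //.
- exact: bhomD.
- have /(_ w) <- /= : rcomod_sub (la (b + b')) (la b') =1 la b.
    apply: (rinv_faithful hX) => z.
    by rewrite tmap_subl !laE lactDl thD bhomD addrK.
  by rewrite subrK.
- apply: (rinv_faithful hX (f := rcomod_comp (la b) (la b'))) => z.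
  by rewrite tmap_compl !laE thK lactA.
- apply: (rinv_faithful hX (g := rcomod_id W0)) => z.
  by rewrite laE lact1 th'K tmap_id.
- by move=> u v a; rewrite ractDl.
- by move=> v a a'; rewrite ractDr.
- by move=> v a a'; rewrite ractA.
- by move=> v; rewrite ract1.
- by rewrite -bhomR.
- apply: (rinv_faithful hX (g := rmulk W0 x)) => z.
  rewrite laE [RHS]rmulk_tmap -bhomR lract_k; congr (io _).
  by rewrite -[in RHS](th'K z); exact: (bhomR th).
Qed.

Let W : bimod B A := Bimod la_axioms.
Let rhoL b (w : W) : rc_rho W0 (b *> w) = b *> (rc_rho W0 w : W ⊗ C) :> W ⊗ C.
Proof.
rewrite [LHS](rch_colinear (la b)).
elim/tensor_ind: (rc_rho W0 w) => [v c|x y hx hy].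
  by rewrite tmapE; apply: esym; exact: (lact_pure b (v : W) c).
rewrite bhomD hx hy; apply: esym; exact: (@lactDr _ _ _ (W ⊗ C) b x y).
Qed.
Let rho : bhom W (W ⊗ C) :=
  @BHom k B A W (W ⊗ C) (rc_rho W0) (bhomD (rc_rho W0)) rhoL (bhomR (rc_rho W0)).
Let rhoP : right_coaction rho.
Proof.
split; [exact: (rcoact_assoc (rc_rhoP W0))|exact: (rcoact_counit (rc_rhoP W0))].
Qed.

Let ka_bhom : bhom (rcomod_of rhoP) W0 :=
  @rbhom k A (rcomod_of rhoP) W0 id (fun _ _ => erefl) (fun _ _ => erefl).
Let ka_tmap (Q : kalg k) (N : bimod A Q) (u : rcomod_of rhoP ⊗ N) :
  tmap ka_bhom (bid N) u = u.
Proof.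
elim/tensor_ind: u => [w n|x y hx hy]; first by rewrite tmapE.
by rewrite bhomD hx hy.
Qed.
Let ka_colinear : colinear (rc_rho (rcomod_of rhoP)) (rc_rho W0) ka_bhom.
Proof. by move=> w; rewrite ka_tmap. Qed.
Let ka : rcomod_hom (rcomod_of rhoP) W0 := RComodHom ka_colinear.

Lemma preimage_bimod_of : exists (V : bimod B A) (rhoV : bhom V (V ⊗ C))
    (f : bhom (cotensor rhoV (bc_lam X)) D),
  [/\ right_coaction rhoV, bijective f &
      colinear (cotr_rho rhoV X hD) (cor_delta D) f].
Proof.
have [c [cK cVK]] := rcomod_hom_bij (cot_cast_bij rhoP hD X).
pose inE := cot_incl rho (bc_lam X).
pose h e := cot_hom hD X ka (c e).
have hE e : io (h e) = inE e :> W ⊗ X.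
  rewrite [LHS]cot_hom_bhomE [LHS]ka_tmap -[in RHS](cVK e).
  by rewrite [RHS]cot_cast_bhomE.
pose g := rcomod_comp th' (rcomod_comp (cot_hom hD X ka) c).
have gL (b : B) (e : cotensor rho (bc_lam X)) : g (b *> e) = b *> (g e : D) :> D.
  have -> : g (b *> e) = th' (h (b *> e)) by [].
  suff -> : h (b *> e) = th (b *> (th' (h e) : D)) by rewrite thK.
  apply: (@cot_incl_inj _ _ _ _ _ _ (rc_rho W0) _ (bc_lam X)).
  rewrite [LHS]hE -[RHS]laE [inE _]bhomL.
  have -> : inE e = io (h e) by rewrite hE.
  elim/tensor_ind: (io (h e)) => [w x|x y hx hy].
    by rewrite tmapE; exact: (lact_pure b (w : W) x).
  by rewrite bhomD -hx -hy; exact: (@lactDr _ _ _ (W ⊗ X) b x y).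
exists W, rho, (@BHom k B B (cotensor rho (bc_lam X)) D g (bhomD g) gL (bhomR g)).
split; [exact: rhoP | | exact: (rch_colinear g)].
apply: inj_surj_bij => [x y|d].
  move/(can_inj th'K)/(congr1 io); rewrite ![io _]hE; exact: cot_incl_inj.
have [e he] : exists e, inE e = io (th d).
  exact: (@bincl_ex _ _ _ _ _ _ _ (io (th d)) (binclP (th d))).
exists e; rewrite -[d]thK; congr (th' _).
apply: (@cot_incl_inj _ _ _ _ _ _ (rc_rho W0) _ (bc_lam X)).
by rewrite [LHS]hE he.
Qed.

End Action.

Lemma preimage_bimod : exists (V : bimod B A) (rhoV : bhom V (V ⊗ C))
    (f : bhom (cotensor rhoV (bc_lam X)) D),
  [/\ right_coaction rhoV, bijective f &
      colinear (cotr_rho rhoV X hD) (cor_delta D) f].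
Proof.
have [W0 [th [th' [thK th'K]]]] := rinv_surj hX Dr.
exact: preimage_bimod_of thK th'K.
Qed.

End Preimage.

Section TensorColinearMaps.
Variables (k : comPzRingType) (B A : kalg k) (D : coring B) (C : coring A).
Variables (W : bimod B A) (rho : bhom W (W ⊗ C)).

Lemma tassoc_colinear (R S : kalg k) (M : bimod R S) (N : bimod S B) :
  colinear (tens_rho (M ⊗ N) rho) (tens_rho M (tens_rho N rho)) (tassoc M N W).
Proof.
move=> x; elim/tensor_ind: x => [x w|x y hx hy]; last by rewrite !bhomD hx hy.
elim/tensor_ind: x => [m n|x y hx hy]; last by rewrite !(pureDl, bhomD) hx hy.
rewrite tassocE !tens_rhoE.
by tensor_elim (rho w); rewrite !bhomE.
Qed.

Lemma lunit_colinear : colinear (tens_rho (regular B) rho) rho (lunit W).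
Proof.
move=> x; elim/tensor_ind: x => [b w|x y hx hy]; last by rewrite !bhomD hx hy.
rewrite lunitE tens_rhoE bhomL.
elim/tensor_ind: (rho w) => [w' c|x y hx hy]; last first.
  by rewrite lactDr pureDr !bhomD hx hy.
by rewrite !bhomE lact_pure.
Qed.

End TensorColinearMaps.

Section PreimageCoaction.
Variables (k : comPzRingType) (A B : kalg k) (C : coring A) (D : coring B).
Variable hD : left_flat D.
Variables (X : bicomod C D) (hX : right_invertible hD X).
Variables (W : bimod B A) (rho : bhom W (W ⊗ C)) (rhoP : right_coaction rho).

Let E := cotensor rho (bc_lam X).
Let io : bhom E (W ⊗ X) := cot_incl rho (bc_lam X).
Let rhoE : bhom E (E ⊗ D) := cotr_rho rho X hD.

Variables (th : bhom E D) (th' : bhom D E).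
Hypotheses (thK : cancel th th') (th'K : cancel th' th).
Hypothesis thC : colinear rhoE (cor_delta D) th.

(** The comultiplication of [D] read as a left coaction on [E], which [th] identifies with [D]. *)
Let La : bhom E (D ⊗ E) := bcomp (tmap (bid D) th') (bcomp (cor_delta D) th).

Let LaE e : La e = tmap (bid D) th' (cor_delta D (th e)).
Proof. by []. Qed.

Let th'C : colinear (cor_delta D) rhoE th'.
Proof.
move=> d; rewrite -{2}[d]th'K thC -tmap_compl.
have -> : bcomp th' th = bid E by apply: bhom_ext => e; apply: thK.
by rewrite tmap_id.
Qed.

Let La_colinear : colinear rhoE (tens_rho D rhoE) La.
Proof.
move=> e; rewrite LaE (tmap_colinear (bid D) th'C) /La !tmap_compl -thC.
by congr (tmap _ _ _); rewrite /tens_rho bcompE -cor_coassoc tassocK.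
Qed.

Let La_coassoc e :
  tassoc _ _ _ (tmap (cor_delta D) (bid E) (La e)) = tmap (bid D) La (La e).
Proof.
rewrite LaE.
transitivity (tmap (bid D) (tmap (bid D) th') (tassoc _ _ _
   (tmap (cor_delta D) (bid D) (cor_delta D (th e))))).
  elim/tensor_ind: (cor_delta D _) => [d d'|x y hx hy]; last by rewrite !bhomD hx hy.
  by rewrite !tmapE !bidE; tensor_elim (cor_delta D d); rewrite !bhomE.
rewrite cor_coassoc.
by tensor_elim (cor_delta D (th e)); rewrite !tmapE !bidE LaE th'K.
Qed.

Let La_counit e : lunit E (tmap (cor_eps D) (bid E) (La e)) = e.
Proof.
rewrite LaE -[RHS]thK -[in RHS](cor_counitl (th e)).
elim/tensor_ind: (cor_delta D _) => [d d'|x y hx hy]; last by rewrite !bhomD hx hy.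
by rewrite !tmapE !lunitE !bidE bhomL.
Qed.

Let tD : rcomod_hom (rcomod_of (tens_rhoP D (cotr_rhoP rho X hD)))
    (rcomod_of (cotr_rhoP (tens_rho D rho) X hD)) :=
  rcomod_of_hom (tens_rhoP D (cotr_rhoP rho X hD))
  (cotr_rhoP (tens_rho D rho) X hD) (@tcot_colinear _ _ _ _ _ C D D W rho hD X).

(** [La] takes values in [D ⊗ (W □ X)]; only after [tcot] has moved them to [(D ⊗ W) □ X] does it
    become a map between values of the functor, which fullness can lift. *)
Let la_ex : exists f : rcomod_hom (rcomod_of rhoP) (rcomod_of (tens_rhoP D rhoP)),
  forall e, tmap f (bid X) (io e) = tassocV D W X (tmap (bid D) io (La e)) :> D ⊗ W ⊗ X.
Proof.
pose h := rcomod_comp tD (rcomod_of_hom (cotr_rhoP rho X hD)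
  (tens_rhoP D (cotr_rhoP rho X hD)) La_colinear).
have [f hf] := rinv_full_bimod hX rhoP (tens_rhoP D rhoP) h.
by exists f => e; rewrite [LHS]hf -tcotE.
Qed.

(** [lam] is the lift of [La]. Left linearity, coassociativity and the counit law are equalities of
    colinear maps out of [W], which faithfulness reduces to the same laws for [La]; compatibility
    with [rho] is the colinearity of [lam]. *)
Lemma preimage_coaction : exists lam : bhom W (D ⊗ W),
  [/\ left_coaction lam,
      forall w, tassoc _ _ _ (tmap lam (bid C) (rho w)) = tmap (bid D) rho (lam w) &
      forall e, tmap lam (bid X) (io e) =
        tassocV D W X (tmap (bid D) io (tmap (bid D) th' (cor_delta D (th e))))].
Proof.
have [f fE] := la_ex.
have fL (b : B) (w : W) : f (b *> w) = b *> (f w : D ⊗ W) :> D ⊗ W.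
  apply: (rinv_faithful_of hX (f := rcomod_comp f (lmul rhoP b))
   (g := rcomod_comp (lmul (tens_rhoP D rhoP) b) f)) => e.
  rewrite !tmap_compl.
  rewrite [X in tmap f _ X]lmul_tmap [RHS]lmul_tmap.
  have -> : tmap f (bid X) (io e) = tassocV D W X (tmap (bid D) io (La e)) := fE e.
  rewrite -!bhomL; exact: fE.
pose lam : bhom W (D ⊗ W) := @BHom k B A W (D ⊗ W) f (bhomD f) fL (bhomR f).
have lamE e : tmap lam (bid X) (io e) = tassocV D W X (tmap (bid D) io (La e)) := fE e.
have lamC : colinear rho (tens_rho D rho) lam := rch_colinear f.
have lam_ext (V : bimod B A) (rhoV : bhom V (V ⊗ C)) (g g' : bhom W V) :
    right_coaction rhoV -> colinear rho rhoV g -> colinear rho rhoV g' ->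
    (forall e, tmap g (bid X) (io e) = tmap g' (bid X) (io e)) -> g =1 g'.
  move=> hV gC g'C h.
  exact: (rinv_faithful_of hX (f := rcomod_of_hom rhoP hV gC)
    (g := rcomod_of_hom rhoP hV g'C)).
exists lam; split=> //; last by move=> w; rewrite -lamC /tens_rho bcompE tassocVK.
have compC (V V' : bimod B A) (rV : bhom V (V ⊗ C)) (rV' : bhom V' (V' ⊗ C)) (g : bhom V V')
   (g' : bhom W V) : colinear rV rV' g -> colinear rho rV g' -> colinear rho rV' (bcomp g g').
  by move=> gC g'C w; rewrite bcompE gC g'C tmap_compl.
have deltaC : colinear (tens_rho D rho) (tens_rho (D ⊗ D) rho) (tmap (cor_delta D) (bid W)).
  by apply: tmap_colinear => w; rewrite tmap_id.
split=> w.
- apply: (lam_ext (D ⊗ (D ⊗ W)) (tens_rho D (tens_rho D rho))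
    (bcomp (tassoc _ _ _) (bcomp (tmap (cor_delta D) (bid W)) lam))
    (bcomp (tmap (bid D) lam) lam)).
  + exact/tens_rhoP/tens_rhoP.
  + apply: (compC _ _ _ _ _ _ (@tassoc_colinear _ _ _ _ _ _ _ _ _ _)).
    exact: (compC _ _ _ _ _ _ deltaC lamC).
  + exact: (compC _ _ _ _ _ _ (tmap_colinear (bid D) lamC) lamC).
  + move=> e; rewrite !tmap_compl !lamE.
    transitivity (tassocV D (D ⊗ W) X (tmap (bid D) (tassocV D W X)
      (tmap (bid D) (tmap (bid D) io) (tmap (bid D) La (La e))))); last first.
      elim/tensor_ind: (La e) => [d e'|x y hx hy]; last by rewrite !bhomD hx hy.
      rewrite !tmapE !bidE -lamE.
      by tensor_elim (io e'); rewrite !bhomE.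
    rewrite -La_coassoc.
    elim/tensor_ind: (La e) => [d e'|x y hx hy]; last by rewrite !bhomD hx hy.
    rewrite !tmapE !bidE.
    transitivity (tmap (tassoc D D W) (bid X) (tassocV (D ⊗ D) W X (cor_delta D d ⊙ io e'))).
      by tensor_elim (io e'); rewrite !bhomE.
    tensor_elim (cor_delta D d); rewrite !bhomE.
    by tensor_elim (io e'); rewrite !bhomE.
- apply: (lam_ext W rho
    (bcomp (lunit W) (bcomp (tmap (cor_eps D) (bid W)) lam)) (bid W)) => //.
  + apply: (compC _ _ _ _ _ _ (@lunit_colinear _ _ _ _ _ _)).
    apply: (compC _ _ _ _ _ _ _ lamC).
    by apply: tmap_colinear => v; rewrite tmap_id.
  + by move=> v; rewrite tmap_id.
  + move=> e; rewrite !tmap_compl lamE tmap_id -[in RHS](La_counit e).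
    elim/tensor_ind: (La e) => [d e'|x y hx hy]; last by rewrite !bhomD hx hy.
    rewrite !tmapE !bidE lunitE bhomL.
    elim/tensor_ind: (io e') => [w' x|x y hx hy]; last first.
      by rewrite lactDr pureDr !bhomD hx hy.
    by rewrite !bhomE lact_pure.
Qed.

End PreimageCoaction.

Section Inverse.
Variable k : comPzRingType.

Lemma rinv_comp (Q A B : kalg k) (H : coring Q) (C : coring A) (D : coring B)
    (hH : right_flat H) (hC : left_flat C) (hD : left_flat D)
    (X : bicomod H C) (Y : bicomod C D) :
  right_invertible hC X -> right_invertible hD Y ->
  right_invertible hD (cot hH hD X Y).
Proof.
move=> hX hY; apply: equivalence_iso (equivalence_comp hX hY).
exact/natural_iso_sym/cot_functor_comp.
Qed.

Lemma rinv_regular (A : kalg k) (C : coring A) (hC : left_flat C) :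
  right_invertible hC (regular_bicomod C).
Proof.
apply: equivalence_iso (equivalence_id _).
exact/natural_iso_sym/cot_functor_regular.
Qed.

Variables (A B : kalg k) (C : coring A) (D : coring B).

Lemma rinv_left_inverse (hCl : left_flat C) (hDl : left_flat D)
    (hDr : right_flat D) (X : bicomod C D) : right_invertible hDl X ->
  exists Y : bicomod D C, right_invertible hCl Y /\
    bicomod_iso (cot hDr hDl Y X) (regular_bicomod D).
Proof.
move=> hX.
have [W [rho [th [rhoP th_bij thC]]]] := preimage_bimod hX.
have [th' [thK th'K]] := bhom_inv th_bij.
have [lam [lamP compat lamE]] := preimage_coaction hX rhoP thK th'K thC.
pose Y : bicomod D C := Bicomod lamP rhoP compat.
have e : bicomod_iso (cot hDr hDl Y X) (regular_bicomod D).
  exists th; split=> // z.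
  have inj : injective (tmap (bid D) (cot_incl rho (bc_lam X))).
    by apply: right_flat_inj => //; apply: cot_incl_inj.
  (* The left coaction of [Y □ X] is the restriction of [lam ⊗ X], which [lamE] identifies with the
     transported comultiplication; so [th] is left colinear. *)
  have -> : bc_lam (cot hDr hDl Y X) z = tmap (bid D) th' (cor_delta D (th z)).
    apply: inj; apply: etrans (@cotl_lamE _ _ _ _ D C Y X (bc_lam X) hDr z) _.
    by rewrite [tmap _ _ _]lamE tassocVK.
  rewrite -tmap_compr.
  have -> : bcomp th th' = bid D by apply: bhom_ext => d; apply: th'K.
  by rewrite tmap_id.
exists Y; split=> //.
apply: (equivalence_cancell hX).
apply: equivalence_iso (rinv_regular hDl).
apply: natural_iso_trans (cot_functor_comp hDr hCl Y hX).
exact/natural_iso_sym/cot_functor_iso.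
Qed.

End Inverse.

(** * The groupoid of right invertible bicomodules, and conjugation in it *)

Section Groupoid.
Variable k : comPzRingType.
Local Notation "X ≅ Y" := (bicomod_iso X Y) (at level 70).

(** A left inverse [Z] of the left inverse [Y] is isomorphic to [X], through [(Z □ Y) □ X] and
    [Z □ (Y □ X)]; hence [X □ Y] is isomorphic to [Z □ Y]. *)
Lemma rinv_inverse (A B : kalg k) (C : coring A) (D : coring B)
    (hCl : left_flat C) (hCr : right_flat C) (hDl : left_flat D)
    (hDr : right_flat D) (X : bicomod C D) : right_invertible hDl X ->
  exists Y : bicomod D C, [/\ right_invertible hCl Y,
    cot hDr hDl Y X ≅ regular_bicomod D & cot hCr hCl X Y ≅ regular_bicomod C].
Proof.
move=> hX; have [Y [hY YX]] := rinv_left_inverse hCl hDr hX.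
exists Y; split=> //.
have [Z [hZ ZY]] := rinv_left_inverse hDl hCr hY.
refine (bicomod_iso_trans _ ZY).
have CX : X ≅ cot hCr hDl Z (cot hDr hDl Y X).
  apply: bicomod_iso_trans (bicomod_iso_sym (cot_unitl_iso hCr hDl X)) _.
  refine (bicomod_iso_trans _ (bicomod_iso_sym (cot_assoc_iso hCr hDr hCl Z Y hX))).
  exact: cot_iso (bicomod_iso_sym ZY) (bicomod_iso_refl X).
apply: cot_iso (bicomod_iso_refl Y).
apply: bicomod_iso_trans CX _.
apply: bicomod_iso_trans (cot_iso hCr hDl (bicomod_iso_refl Z) YX) _.
exact: cot_unitr_iso.
Qed.

Lemma rinv_pic_laws (A : kalg k) (C : coring A) (hCl : left_flat C)
    (hCr : right_flat C) : pic_laws hCl hCr.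
Proof.
split.
- by move=> X Y; apply: rinv_comp.
- by move=> X X' Y Y' _ _; apply: cot_iso.
- by move=> X Y Z _ _ hZ; apply: cot_assoc_iso.
- exact: rinv_regular.
- by move=> X _; apply: cot_unitl_iso.
- by move=> X _; apply: cot_unitr_iso.
- by move=> X /(rinv_inverse hCl hCr hCr)[Y [hY YX XY]]; exists Y.
Qed.

Section Conjugation.
Variables (A B : kalg k) (C : coring A) (D : coring B).
Variables (hCl : left_flat C) (hCr : right_flat C).
Variables (hDl : left_flat D) (hDr : right_flat D).
Variables (hC : pic_laws hCl hCr) (hD : pic_laws hDl hDr).
Variables (X : bicomod C D) (Y : bicomod D C).
Hypotheses (hX : right_invertible hDl X) (hY : right_invertible hCl Y).
Hypotheses (XY : cot hCr hCl X Y ≅ regular_bicomod C).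

Definition conj_bicomod (Z : bicomod C C) : bicomod D D :=
  cot hDr hDl (cot hDr hCl Y Z) X.

Lemma conj_rinv Z : right_invertible hCl Z -> right_invertible hDl (conj_bicomod Z).
Proof. by move=> hZ; apply: rinv_comp => //; apply: rinv_comp. Qed.

Lemma conj_iso Z Z' : Z ≅ Z' -> conj_bicomod Z ≅ conj_bicomod Z'.
Proof.
move=> e; apply: cot_iso (bicomod_iso_refl X).
exact: cot_iso (bicomod_iso_refl Y) e.
Qed.

(** Rebracketing brings the inner [X] and [Y] together, and they cancel. Each use of associativity
    has [X], [Y] or [Z'] as last factor, and all three are right invertible. *)
Lemma conj_mul Z Z' : right_invertible hCl Z -> right_invertible hCl Z' ->
  cot hDr hDl (conj_bicomod Z) (conj_bicomod Z') ≅ conj_bicomod (cot hCr hCl Z Z').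
Proof.
move=> hZ hZ'; rewrite /conj_bicomod.
apply: bicomod_iso_trans (cot_assoc_iso hDr hDr hCl _ _ hX) _.
apply: cot_iso (bicomod_iso_refl X).
apply: bicomod_iso_trans (cot_assoc_iso hDr hDr hCl _ _ hZ') _.
refine (bicomod_iso_trans _ (bicomod_iso_sym (cot_assoc_iso hDr hCr hCl _ _ hZ'))).
apply: cot_iso (bicomod_iso_refl Z').
apply: bicomod_iso_trans (bicomod_iso_sym (cot_assoc_iso hDr hCr hDl _ _ hY)) _.
apply: bicomod_iso_trans (cot_iso hDr hCl (bicomod_iso_refl _) XY) _.
exact: cot_unitr_iso.
Qed.

Definition pic_conj (x : Pic hC) : Pic hD :=
  pic_class (conj_rinv (pic_repr_inv x)).

Lemma pic_conjE Z (hZ : right_invertible hCl Z) :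
  pic_conj (pic_class hZ) = pic_class (conj_rinv hZ).
Proof.
apply/pic_classP/conj_iso.
by apply/(pic_classP (pic_repr_inv _) hZ); apply: pic_reprK.
Qed.

Lemma pic_conjM : group_hom pic_conj.
Proof.
move=> x y; rewrite -(pic_reprK x) -(pic_reprK y).
rewrite [gmul _ _]pic_mulE !pic_conjE [RHS]pic_mulE.
apply/pic_classP/bicomod_iso_sym/conj_mul; exact: pic_repr_inv.
Qed.

End Conjugation.

(** Conjugating forth and back surrounds [Z] by two copies of [X □ Y]. The other cancellation is
    this lemma with [X] and [Y] exchanged. *)
Lemma pic_conjK (A B : kalg k) (C : coring A) (D : coring B)
    (hCl : left_flat C) (hCr : right_flat C)
    (hDl : left_flat D) (hDr : right_flat D)
    (hC : pic_laws hCl hCr) (hD : pic_laws hDl hDr)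
    (X : bicomod C D) (Y : bicomod D C)
    (hX : right_invertible hDl X) (hY : right_invertible hCl Y) :
  cot hCr hCl X Y ≅ regular_bicomod C ->
  cancel (pic_conj (hC := hC) hD hX hY) (pic_conj (hC := hD) hC hY hX).
Proof.
move=> XY x; rewrite -(pic_reprK x) !pic_conjE.
have := pic_repr_inv x; set Z := pic_repr x => hZ.
apply/pic_classP; rewrite /conj_bicomod.
refine (bicomod_iso_trans _ (cot_unitr_iso hCr hCl Z)).
refine (bicomod_iso_trans _ (cot_iso hCr hCl (bicomod_iso_refl Z) XY)).
refine (bicomod_iso_trans _ (bicomod_iso_sym (cot_assoc_iso hCr hCr hDl _ _ hY))).
apply: cot_iso (bicomod_iso_refl Y).
apply: bicomod_iso_trans (cot_assoc_iso hCr hDr hCl _ _ hX) _.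
apply: cot_iso (bicomod_iso_refl X).
apply: bicomod_iso_trans (cot_assoc_iso hCr hDr hCl _ _ hZ) _.
refine (bicomod_iso_trans _ (cot_unitl_iso hCr hCl Z)).
exact: cot_iso XY (bicomod_iso_refl Z).
Qed.

Lemma MT_equivalent_pic (A B : kalg k) (C : coring A) (D : coring B)
    (hCl : left_flat C) (hCr : right_flat C)
    (hDl : left_flat D) (hDr : right_flat D)
    (hC : pic_laws hCl hCr) (hD : pic_laws hDl hDr) :
  MT_right_equivalent C hDl -> group_isomorphic (Pic hC) (Pic hD).
Proof.
move=> [X hX]; have [Y [hY YX XY]] := rinv_inverse hCl hCr hDr hX.
exists (pic_conj (hC := hC) hD hX hY); split; first exact: pic_conjM.
by exists (pic_conj (hC := hD) hC hY hX); apply: pic_conjK.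
Qed.

End Groupoid.

(** * Bicomodules twisted by automorphisms *)

Section SemilinearTensor.
Variables (k : comPzRingType) (R A S S' : kalg k).
Variables (M : bimod R A) (V : bimod A S) (V' : bimod A S') (p : V -> V').
Hypotheses (pD : forall v w, p (v + w) = p v + p w)
           (pL : forall a v, p (a *> v) = a *> p v).

Lemma tmapr_bal : balanced (@ract k R A M) (@lact k A S V) (fun m v => m ⊙ p v).
Proof. by split=> *; rewrite ?pD ?(pureDl, pureDr) // pL pure_bal. Qed.

(** A substitute for [tmap] when [p] is left linear but only semilinear on the right, as [phi] is
    between [C] and its twist. *)
Definition tmapr (x : M ⊗ V) : M ⊗ V' := tlift (fun m v => m ⊙ p v) x.

Lemma tmaprE m v : tmapr (m ⊙ v) = m ⊙ p v.
Proof. exact: (tlift_pure tmapr_bal). Qed.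

Lemma tmaprD x y : tmapr (x + y) = tmapr x + tmapr y.
Proof. exact: (tliftD tmapr_bal). Qed.

Lemma tmaprR (s : S -> S') : (forall v b, p (v <* b) = p v <* s b) ->
  forall x b, tmapr (x <* b) = tmapr x <* s b.
Proof.
move=> pR x b; elim/tensor_ind: x => [m v|x y hx hy].
  by rewrite ract_pure !tmaprE pR ract_pure.
by rewrite ractDl !tmaprD hx hy ractDl.
Qed.

End SemilinearTensor.

Section TwistInvertible.
Variables (k : comPzRingType) (A : kalg k) (C : coring A) (hC : left_flat C).
Variables f g : Aut C.
Hypotheses (fg : gmul f g = gone) (gf : gmul g f = gone).

Let phiK c : caut_phi f (caut_phi g c) = c.
Proof. exact: (congr1 (fun h : Aut C => caut_phi h c) fg). Qed.
Let phiVK c : caut_phi g (caut_phi f c) = c.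
Proof. exact: (congr1 (fun h : Aut C => caut_phi h c) gf). Qed.
Let rhoK a : caut_rho f (caut_rho g a) = a.
Proof. exact: (congr1 (fun h : Aut C => caut_rho h a) fg). Qed.

Let X := twist f.

Lemma twist_lactE a (x : C) : a *> (x : X) = caut_rho g a *> x :> C.
Proof.
rewrite lact_twist; congr (_ *> _).
by rewrite -{1}[a]rhoK /caut_rhoV binvK.
Qed.

(** This is an isomorphism of left comodules from [C] to the twist [X] ([toXL], [lam_toX]), though
    only semilinear over [rho_g] on the right. So [M □ X] is [M □ C], hence [M], with its right
    structure twisted. Keeping [g] as a variable instead of [ginv f] allows [f] and [g] to be
    exchanged later. *)
Let toX (c : C) : X := caut_phi g c.
Let ofX (x : X) : C := caut_phi f x.
Let toXD c d : toX (c + d) = toX c + toX d. Proof. exact: (caut_phiD (cautP g)). Qed.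
Let toXL a c : toX (a *> c) = a *> toX c.
Proof. by rewrite [RHS]twist_lactE; exact: (caut_linl (cautP g)). Qed.
Let toXR c a : toX (c <* a) = toX c <* caut_rho g a.
Proof. exact: (caut_linr (cautP g)). Qed.
Let ofXD x y : ofX (x + y) = ofX x + ofX y. Proof. exact: (caut_phiD (cautP f)). Qed.
Let ofXL a x : ofX (a *> x) = a *> ofX x.
Proof. by rewrite [a *> x]twist_lactE /ofX (caut_linl (cautP f)) rhoK. Qed.

Section OneComodule.
Variables (M : rcomod C).

Let io := cot_incl (rc_rho M) (bc_lam X).
Let toMX : M ⊗ C -> M ⊗ X := tmapr (M := M) toX.
Let ofMX : M ⊗ X -> M ⊗ C := tmapr (M := M) ofX.
Let toMXE m c : toMX (m ⊙ c) = m ⊙ toX c. Proof. exact: tmaprE. Qed.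
Let toMXD x y : toMX (x + y) = toMX x + toMX y. Proof. exact: tmaprD. Qed.
Let toMXR x a : toMX (x <* a) = toMX x <* caut_rho g a.
Proof. exact: tmaprR. Qed.
Let ofMXE m x : ofMX (m ⊙ x) = m ⊙ ofX x. Proof. exact: tmaprE. Qed.
Let ofMXD x y : ofMX (x + y) = ofMX x + ofMX y. Proof. exact: tmaprD. Qed.

Let toMXK x : ofMX (toMX x) = x.
Proof.
elim/tensor_ind: x => [m c|x y hx hy]; last by rewrite toMXD ofMXD hx hy.
by rewrite toMXE ofMXE /ofX phiK.
Qed.
Let ofMXK x : toMX (ofMX x) = x.
Proof.
elim/tensor_ind: x => [m c|x y hx hy]; last by rewrite ofMXD toMXD hx hy.
by rewrite ofMXE toMXE /toX phiVK.
Qed.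

Let toCX : C ⊗ C -> C ⊗ X := tmapr (M := C) toX.
Let toCXE c d : toCX (c ⊙ d) = c ⊙ toX d. Proof. exact: tmaprE. Qed.
Let toCXD x y : toCX (x + y) = toCX x + toCX y. Proof. exact: tmaprD. Qed.
Let toCXL a x : toCX (a *> x) = a *> toCX x.
Proof.
elim/tensor_ind: x => [m c|x y hx hy]; last by rewrite lactDr !toCXD hx hy lactDr.
by rewrite lact_pure !toCXE lact_pure.
Qed.
Let toMCX : M ⊗ (C ⊗ C) -> M ⊗ (C ⊗ X) := tmapr (M := M) toCX.
Let toMCXE m x : toMCX (m ⊙ x) = m ⊙ toCX x. Proof. exact: tmaprE. Qed.
Let toMCXD x y : toMCX (x + y) = toMCX x + toMCX y. Proof. exact: tmaprD. Qed.

Let lam_toX c : bc_lam X (toX c) = toCX (cor_delta C c).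
Proof.
rewrite [LHS]twist_lamE cor_delta_phi.
elim/tensor_ind: (cor_delta C c) => [d e|x y hx hy].
  by rewrite (tlift_pure (caut_tensP (cautP g))) twist_tensE phiK toCXE.
by rewrite (tliftD (caut_tensP (cautP g))) twist_tensD hx hy toCXD.
Qed.

Let cotE_f x : cot_f (rc_rho M) X (toMX x) = toMCX (cot_f (rc_rho M) C x).
Proof.
elim/tensor_ind: x => [m c|x y hx hy]; last by rewrite toMXD !bhomD hx hy toMCXD.
rewrite toMXE /cot_f !bcompE !tmapE !bidE.
elim/tensor_ind: (rc_rho M m) => [m' c'|x y hx hy].
  by rewrite !tassocE toMCXE toCXE.
by rewrite !(pureDl, bhomD) hx hy toMCXD.
Qed.

Let cotE_g x : cot_g M (bc_lam X) (toMX x) = toMCX (cot_g M (cor_delta C) x).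
Proof.
elim/tensor_ind: x => [m c|x y hx hy]; last by rewrite toMXD !bhomD hx hy toMCXD.
by rewrite toMXE /cot_g !tmapE lam_toX toMCXE.
Qed.

Let ofCX : C ⊗ X -> C ⊗ C := tmapr (M := C) ofX.
Let ofCXE c x : ofCX (c ⊙ x) = c ⊙ ofX x. Proof. exact: tmaprE. Qed.
Let ofCXD x y : ofCX (x + y) = ofCX x + ofCX y. Proof. exact: tmaprD. Qed.
Let ofCXL a x : ofCX (a *> x) = a *> ofCX x.
Proof.
elim/tensor_ind: x => [m c|x y hx hy]; last by rewrite lactDr !ofCXD hx hy lactDr.
by rewrite lact_pure !ofCXE lact_pure.
Qed.
Let toCXK x : ofCX (toCX x) = x.
Proof.
elim/tensor_ind: x => [m c|x y hx hy]; last by rewrite toCXD ofCXD hx hy.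
by rewrite toCXE ofCXE /ofX phiK.
Qed.
Let toMCX_inj : injective toMCX.
Proof.
apply: (can_inj (g := tmapr (M := M) ofCX)).
elim/tensor_ind=> [m x|x y hx hy]; last by rewrite toMCXD tmaprD ?hx ?hy.
by rewrite toMCXE tmaprE // toCXK.
Qed.

Let alpha_ex m : exists e, io e = toMX (rc_rho M m).
Proof.
apply: bincl_ex; rewrite cotE_f cotE_g; congr (toMCX _).
rewrite /cot_f bcompE; exact: (rcoact_assoc (rc_rhoP M)).
Qed.

(* The semilinear map m |-> sum m_(0) ⊗ phi_g(m_(1)). *)
Definition twist_alpha (m : M) : cot_ob hC X M := projT1 (cid (alpha_ex m)).
Let alpha := twist_alpha.

Lemma twist_alphaE m : io (alpha m) = toMX (rc_rho M m).
Proof. exact: (projT2 (cid (alpha_ex m))). Qed.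

Lemma twist_alphaD m n : alpha (m + n) = alpha m + alpha n.
Proof.
apply: (@cot_incl_inj _ _ _ _ _ _ (rc_rho M) _ (bc_lam X)).
by rewrite -/io bhomD !twist_alphaE bhomD toMXD.
Qed.

Lemma twist_alphaR m a : alpha (m <* a) = alpha m <* caut_rho g a.
Proof.
apply: (@cot_incl_inj _ _ _ _ _ _ (rc_rho M) _ (bc_lam X)).
by rewrite -/io bhomR !twist_alphaE bhomR toMXR.
Qed.

Lemma twist_alpha_bij : bijective alpha.
Proof.
apply: inj_surj_bij => [m n|e].
  move/(congr1 io); rewrite !twist_alphaE => /(congr1 ofMX); rewrite !toMXK => e.
  by rewrite -(rcoact_counit (rc_rhoP M) m) e (rcoact_counit (rc_rhoP M) n).
have [e' he'] : exists e', cot_incl (rc_rho M) (bc_lam (regular_bicomod C)) e' =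
    ofMX (io e).
  apply: bincl_ex; apply: toMCX_inj.
  rewrite -[LHS]cotE_f -[RHS]cotE_g ofMXK; exact: binclP.
have [v _ vK] := cot_unitr_bij (rc_rhoP M).
exists (v e'); apply: (@cot_incl_inj _ _ _ _ _ _ (rc_rho M) _ (bc_lam X)).
by rewrite -/io twist_alphaE -(cot_unitrE (rc_rhoP M)) vK he' ofMXK.
Qed.

Lemma twist_alpha_bal : balanced (@ract k _ A M) (@lact k A A C)
  (fun m c => alpha m ⊙ caut_phi g c).
Proof.
split=> [m n c|m c d|m a c]; first by rewrite twist_alphaD pureDl.
  by rewrite (caut_phiD (cautP g)) pureDr.
by rewrite twist_alphaR pure_bal (caut_linl (cautP g)).
Qed.

Let p (x : C ⊗ C) : X ⊗ C := tlift (fun c d => toX c ⊙ caut_phi g d) x.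
Let p_bal : balanced (@ract k A A C) (@lact k A A C)
  (fun c d => toX c ⊙ caut_phi g d).
Proof.
split=> [c c' d|c d d'|c a d]; first by rewrite toXD pureDl.
  by rewrite (caut_phiD (cautP g)) pureDr.
by rewrite toXR pure_bal (caut_linl (cautP g)).
Qed.
Let pE c d : p (c ⊙ d) = toX c ⊙ caut_phi g d.
Proof. exact: (tlift_pure p_bal). Qed.
Let pD x y : p (x + y) = p x + p y. Proof. exact: (tliftD p_bal). Qed.
Let pL a x : p (a *> x) = a *> p x.
Proof.
elim/tensor_ind: x => [c d|x y hx hy]; last by rewrite lactDr !pD hx hy lactDr.
by rewrite lact_pure !pE toXL lact_pure.
Qed.

Lemma twist_alpha_rho m : rc_rho (cot_ob hC X M) (alpha m) =
  tlift (fun m c => alpha m ⊙ caut_phi g c) (rc_rho M m).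
Proof.
have inj : injective (tmap io (bid C)).
  by apply: left_flat_inj => //; apply: cot_incl_inj.
apply: inj; rewrite [LHS]cotr_rhoE -/io twist_alphaE.
transitivity (tassocV M X C (tmapr (M := M) p (cot_g M (cor_delta C) (rc_rho M m)))).
  elim/tensor_ind: (rc_rho M m) => [m' c|x y hx hy]; last first.
    by rewrite toMXD !bhomD hx hy tmaprD // bhomD.
  rewrite toMXE /cot_g !tmapE tmaprE //; congr (tassocV _ _ _ (_ ⊙ _)).
  exact: cor_delta_phi.
have -> : cot_g M (cor_delta C) (rc_rho M m) = cot_f (rc_rho M) C (rc_rho M m).
  rewrite /cot_f bcompE; apply: esym; exact: (rcoact_assoc (rc_rhoP M)).
elim/tensor_ind: (rc_rho M m) => [m' c|x y hx hy]; last first.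
  by rewrite !bhomD tmaprD // (tliftD twist_alpha_bal) !bhomD hx hy.
rewrite (tlift_pure twist_alpha_bal) tmapE bidE twist_alphaE /cot_f bcompE tmapE bidE.
elim/tensor_ind: (rc_rho M m') => [m'' c'|x y hx hy]; last first.
  by rewrite !pureDl !bhomD tmaprD // toMXD pureDl bhomD hx hy.
by rewrite tassocE tmaprE // pE tassocVE toMXE.
Qed.

End OneComodule.
Lemma twist_alpha_nat (M M' : rcomod C) (h : rcomod_hom M M') m :
  twist_alpha (h m) = cot_hom hC X h (twist_alpha m).
Proof.
apply: (@cot_incl_inj _ _ _ _ _ _ (rc_rho M') _ (bc_lam X)).
rewrite twist_alphaE [RHS](cot_hom_bhomE (X := X) h) twist_alphaE rch_colinear.
elim/tensor_ind: (rc_rho M m) => [m' c|x y hx hy].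
  by rewrite tmapE !tmaprE // tmapE.
by rewrite bhomD !(tmaprD toXD toXL) bhomD hx hy.
Qed.

End TwistInvertible.

Section TwistInverse.
Variables (k : comPzRingType) (A : kalg k) (C : coring A) (hC : left_flat C).
Variables f g : Aut C.
Hypotheses (fg : gmul f g = gone) (gf : gmul g f = gone).

Section OneComodule.
Variable M : rcomod C.

Let X := twist f.
Let Y := twist g.
Let N := cot_ob hC X M.
Let io := cot_incl (rc_rho N) (bc_lam Y).
Let alpha : M -> N := @twist_alpha _ _ _ hC _ _ fg M.

(** The first bijection is semilinear over [rho_g] and the second over [rho_f], so their composite
    is linear. *)
Definition twist_beta_fun (m : M) : cot_ob hC Y N := @twist_alpha _ _ _ hC _ _ gf N (alpha m).
Let beta := twist_beta_fun.

Let u_bal : balanced (@ract k _ A M) (@lact k A A C)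
  (fun m c => alpha m ⊙ (c : Y)).
Proof.
split=> [m n c|m c d|m a c]; first by rewrite [alpha _]twist_alphaD pureDl.
  exact: pureDr.
rewrite [alpha (m <* a)]twist_alphaR pure_bal; congr (_ ⊙ _).
apply: etrans (twist_lactE gf (caut_rho g a) c) _; congr (@lact k A A C _ c).
exact: (congr1 (fun h : Aut C => caut_rho h a) fg).
Qed.
Let u (x : M ⊗ C) : N ⊗ Y := tlift (fun m c => alpha m ⊙ (c : Y)) x.
Let uE m c : u (m ⊙ c) = alpha m ⊙ (c : Y). Proof. exact: (tlift_pure u_bal). Qed.
Let uD x y : u (x + y) = u x + u y. Proof. exact: (tliftD u_bal). Qed.

Let uR x a : u (x <* a) = u x <* a.
Proof.
elim/tensor_ind: x => [m c|x y hx hy]; last by rewrite ractDl !uD hx hy ractDl.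
by rewrite ract_pure !uE ract_pure.
Qed.
Let ub : bhom (M ⊗ C) (N ⊗ Y) := @rbhom k A (M ⊗ C) (N ⊗ Y) u uD uR.

(** The second bijection applies [phi_f] to the [phi_g (m_(1))] in the coaction of [alpha m],
    leaving [sum alpha (m_(0)) ⊗ m_(1)]. *)
Lemma twist_betaE m : io (beta m) = u (rc_rho M m).
Proof.
rewrite [LHS]twist_alphaE [X in tmapr _ X]twist_alpha_rho.
have fD : forall c d : C, caut_phi f (c + d) = caut_phi f c + caut_phi f d.
  exact: (caut_phiD (cautP f)).
have fL a (c : C) : (caut_phi f (a *> c) : Y) = a *> (caut_phi f c : Y).
  by rewrite [RHS](twist_lactE gf); exact: (caut_linl (cautP f)).
elim/tensor_ind: (rc_rho M m) => [m' c|x y hx hy].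
  rewrite (tlift_pure (twist_alpha_bal hC fg M)) tmaprE // uE; congr (_ ⊙ _).
  exact: (congr1 (fun h : Aut C => caut_phi h c) fg).
by rewrite (tliftD (twist_alpha_bal hC fg M)) tmaprD // hx hy uD.
Qed.

Lemma twist_betaD m n : beta (m + n) = beta m + beta n.
Proof. by rewrite /beta /twist_beta_fun [alpha _]twist_alphaD twist_alphaD. Qed.

Lemma twist_betaR m a : beta (m <* a) = beta m <* a.
Proof.
rewrite /beta /twist_beta_fun [alpha _]twist_alphaR twist_alphaR; congr (_ <* _).
exact: (congr1 (fun h : Aut C => caut_rho h a) fg).
Qed.

Definition twist_beta_bhom : bhom M (cot_ob hC Y N) :=
  @rbhom k A M (cot_ob hC Y N) beta twist_betaD twist_betaR.

Lemma twist_beta_colinear :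
  colinear (rc_rho M) (rc_rho (cot_ob hC Y N)) twist_beta_bhom.
Proof.
have inj : injective (tmap io (bid C)).
  by apply: left_flat_inj => //; apply: cot_incl_inj.
move=> m; apply: inj; rewrite [LHS]cotr_rhoE -/io [io _]twist_betaE.
rewrite -tmap_compl; have -> : bcomp io twist_beta_bhom = bcomp ub (rc_rho M).
  by apply: bhom_ext => n; apply: twist_betaE.
rewrite tmap_compl.
have -> : tmap (rc_rho M) (bid C) (rc_rho M m) =
    tassocV M C C (tmap (bid M) (cor_delta C) (rc_rho M m)).
  by apply: tassoc_inj; rewrite tassocVK (rcoact_assoc (rc_rhoP M)).
elim/tensor_ind: (rc_rho M m) => [m' c|x y hx hy]; last first.
  by rewrite uD !bhomD hx hy.
rewrite uE !tmapE !bidE -[bc_rho Y c]/(cor_delta C c).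
elim/tensor_ind: (cor_delta C c) => [d e|x y hx hy]; last first.
  by rewrite !pureDr !bhomD -hx -hy -bhomD -pureDr.
rewrite tassocVE tmapE bidE [ub _]uE; exact: tassocVE.
Qed.

Definition twist_beta : rcomod_hom M (cot_ob hC Y N) := RComodHom twist_beta_colinear.

Lemma twist_beta_bij : bijective twist_beta.
Proof. by apply: bij_comp; apply: twist_alpha_bij. Qed.

End OneComodule.

Lemma twist_comp_iso : natural_iso
  (functor_comp (cot_functor hC (twist g)) (cot_functor hC (twist f)))
  (functor_id (comod C)).
Proof.
apply: natural_iso_sym.
have b_bij M : exists v : rcomod_hom (cot_ob hC (twist g) (cot_ob hC (twist f) M)) M,
    cancel (twist_beta M) v /\ cancel v (twist_beta M).
  exact/rcomod_hom_bij/twist_beta_bij.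
exists twist_beta, (fun M => projT1 (cid (b_bij M))); split=> [M M' h|M|M].
- apply: rcomod_hom_ext => m.
  rewrite [LHS](congr1 (@twist_alpha _ _ _ hC _ _ gf _) (twist_alpha_nat hC fg h m)).
  exact: twist_alpha_nat.
- by apply: rcomod_hom_ext; apply: (proj1 (projT2 (cid (b_bij M)))).
- by apply: rcomod_hom_ext; apply: (proj2 (projT2 (cid (b_bij M)))).
Qed.

End TwistInverse.

Lemma twist_rinv (k : comPzRingType) (A : kalg k) (C : coring A)
    (hC : left_flat C) (f : Aut C) : right_invertible hC (twist f).
Proof.
exists (cot_functor hC (twist (ginv f))).
by split; apply: twist_comp_iso; rewrite ?gmulVl ?gmulVr.
Qed.

Section TwistProduct.
Variables (k : comPzRingType) (A : kalg k) (C : coring A).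
Variables (hCl : left_flat C) (hCr : right_flat C) (f g : Aut C).

Let X := twist f.
Let Y := twist g.
Let Z := twist (gmul f g).
Let E := cot hCr hCl X Y.
Let io : bhom E (X ⊗ Y) := cot_incl (bc_rho X) (bc_lam Y).

(* As a group, X ⊗ Y is C ⊗ Y, and t is the coaction x |-> sum phi_g(x_(1)) ⊗ x_(2). *)
Let t_fun (x : Z) : X ⊗ Y := bc_lam Y x.
Let tD x y : t_fun (x + y) = t_fun x + t_fun y. Proof. exact: (bhomD (bc_lam Y)). Qed.
Let tR x a : t_fun (x <* a) = t_fun x <* a. Proof. exact: (bhomR (bc_lam Y)). Qed.
Let tL a x : t_fun (a *> x) = a *> t_fun x.
Proof.
set b := caut_rhoV (gmul f g) a.
have e1 : t_fun (a *> x) = caut_rho g b *> twist_tens g (cor_delta C x) :> C ⊗ Y.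
  rewrite -twist_tensL -bhomL; exact: twist_lamE.
(* As [a = rho_f (rho_g b)], the scalar [rho_g b] produced by the coaction is the one through which
   [a] acts on [twist f]. *)
have e2 : caut_rho g b = caut_rhoV f a.
  apply: (can_inj (binvK (caut_rho_bij (cautP f)))).
  rewrite [in RHS]binvVK; exact: (binvVK (caut_rho_bij (cautP (gmul f g)))).
rewrite [LHS]e1 e2 -[t_fun x]/(twist_tens g (cor_delta C x)).
elim/tensor_ind: (twist_tens _ _) => [c d|y z hy hz].
  rewrite lact_pure; apply: esym; exact: (lact_pure a (c : X) d).
rewrite lactDr hy hz; apply: esym; exact: (@lactDr _ _ _ (X ⊗ Y) a y z).
Qed.
Let t : bhom Z (X ⊗ Y) := BHom tD tL tR.

Let t_ex x : exists e, io e = t x.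
Proof.
apply: bincl_ex; rewrite /cot_f bcompE; exact: (lcoact_assoc (bc_lamP Y) x).
Qed.

Let m : bhom Z E := bfactor (@cot_incl_inj _ _ _ _ _ _ _ _ _) t_ex.
Let mE x : io (m x) = t x. Proof. exact: bfactorE. Qed.

Let m_bij : bijective m.
Proof.
apply: inj_surj_bij => [x y e|e].
  have {}e : bc_lam Y x = bc_lam Y y by rewrite -[LHS]/(t x) -[RHS]/(t y) -!mE e.
  by rewrite -[x](lcoact_counit (bc_lamP Y)) e; apply: (lcoact_counit (bc_lamP Y)).
have [e' he'] : exists e', cot_incl (bc_rho (regular_bicomod C)) (bc_lam Y) e' = io e.
  apply: bincl_ex; exact: (binclP e).
have [v _ vK] := cot_unitl_bij hCr hCl Y.
exists (v e'); apply: (@cot_incl_inj _ _ _ _ _ _ (bc_rho X) _ (bc_lam Y)).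
rewrite -/io mE -he' -[in RHS](vK e'); apply: esym; exact: cot_unitlE.
Qed.

(** [phi_f ⊗ id] is balanced because the left action on [X ⊗ Y], unlike that on [C ⊗ Y], is twisted
    by the inverse of [rho_f]. *)
Let q_bal : balanced (@ract k A A C) (@lact k A A (C ⊗ Y))
  (fun c y => (caut_phi f c : C) ⊙ (y : X ⊗ Y)).
Proof.
split=> [c d y|c y z|c a y].
- by rewrite (caut_phiD (cautP f)) pureDl.
- exact: pureDr.
- rewrite (caut_linr (cautP f)) pure_bal; congr (_ ⊙ _).
  elim/tensor_ind: y => [d e|y z hy hz].
    rewrite [LHS](lact_pure (caut_rho f a) (d : X)) lact_pure.
    by rewrite lact_twist /caut_rhoV binvK.
  rewrite [RHS]lactDr -hy -hz; exact: (@lactDr _ _ _ (X ⊗ Y) _ y z).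
Qed.
Let q (x : C ⊗ (C ⊗ Y)) : C ⊗ (X ⊗ Y) := tlift (fun c y => caut_phi f c ⊙ (y : X ⊗ Y)) x.
Let qE c y : q (c ⊙ y) = caut_phi f c ⊙ (y : X ⊗ Y).
Proof. exact: (tlift_pure q_bal). Qed.
Let qD x y : q (x + y) = q x + q y. Proof. exact: (tliftD q_bal). Qed.

Let m_lcolinear : lcolinear (bc_lam Z) (bc_lam E) m.
Proof.
have inj : injective (tmap (bid C) io).
  by apply: right_flat_inj => //; apply: cot_incl_inj.
move=> x; apply: inj; rewrite [LHS]cotl_lamE -/io mE -tmap_compr.
have -> : bcomp io m = t by apply: bhom_ext => y; apply: mE.
(* Both sides are [sum phi_f (phi_g x_(1)) ⊗ phi_g x_(2) ⊗ x_(3)]. *)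
transitivity (q (tassoc C C Y (tmap (cor_delta C) (bid Y) (bc_lam Y x)))).
  rewrite -[t x]/(bc_lam Y x).
  elim/tensor_ind: (bc_lam Y x) => [c d|y z hy hz]; last first.
    by rewrite !bhomD qD -hy -hz -bhomD; congr (tassoc _ _ _ _); exact: bhomD.
  rewrite [tmap (cor_delta C) _ _]tmapE.
  apply: etrans (congr1 (tassoc C X Y) (tmapE (bc_lam X) (bid Y) (c : X) d)) _.
  rewrite [bc_lam X c]twist_lamE !bidE.
  elim/tensor_ind: (cor_delta C c) => [c1 c2|y z hy hz]; last first.
    by rewrite twist_tensD !pureDl !bhomD qD hy hz.
  by rewrite twist_tensE !tassocE qE.
rewrite (lcoact_assoc (bc_lamP Y)) [bc_lam Y x]twist_lamE [bc_lam Z x]twist_lamE.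
elim/tensor_ind: (cor_delta C x) => [c d|y z hy hz]; last first.
  by rewrite !twist_tensD !bhomD qD hy hz.
by rewrite !twist_tensE !tmapE qE.
Qed.

Let m_colinear : colinear (bc_rho Z) (bc_rho E) m.
Proof.
have inj : injective (tmap io (bid C)).
  by apply: left_flat_inj => //; apply: cot_incl_inj.
move=> x; apply: inj; rewrite [LHS]cotr_rhoE -/io mE -tmap_compl.
have -> : bcomp io m = t by apply: bhom_ext => y; apply: mE.
apply: tassoc_inj; rewrite tassocVK.
exact: (esym (@bc_compat _ _ _ _ _ Y x)).
Qed.

Lemma twist_mul_iso : bicomod_iso (twist (gmul f g)) (cot hCr hCl (twist f) (twist g)).
Proof. by exists m; split. Qed.

End TwistProduct.

(** * Inner automorphisms and colinear endomorphisms of the coring *)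

Section InnerAutomorphisms.
Variables (k : comPzRingType) (A : kalg k) (C : coring A).
Local Notation "X ≅ Y" := (bicomod_iso X Y) (at level 70).

Lemma cor_eps_act (p : cdual C) c : cor_eps C (cdual_act p c) = p c :> A.
Proof.
rewrite -[in RHS](cor_counitr c) [cdual_act p c]/(cdual_act_fun p c) /cdual_act_fun.
elim/tensor_ind: (cor_delta C c) => [d e|x y hx hy].
  rewrite (tlift_pure (cdual_act_bal p)) (bhomL (cor_eps C) (p d) e).
  rewrite tmapE runitE bidE; exact: (esym (bhomR p d (cor_eps C e))).
by rewrite (tliftD (cdual_act_bal p)) !bhomD hx hy.
Qed.

Lemma cdual_act_sweedler (p : cdual C) c s : sweedler c s ->
  cdual_act p c = \sum_(u <- s) (p u.1 : A) *> u.2.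
Proof.
rewrite /sweedler -(tens_sum (@ract k A A C) (@lact k A A C)) => e.
rewrite [LHS]/(cdual_act_fun p c) /cdual_act_fun e.
exact: (tlift_pi (cdual_act_bal p)).
Qed.

Section Endomorphism.
Variable h : bhom (rmod_of C) (rmod_of C).

Lemma end_bal : balanced (@ract k A A C) (@lact k A A C) (fun c d => (h c : C) ⊙ d).
Proof.
split=> [x y z|x y z|x a z]; first by rewrite (bhomD h) pureDl.
  exact: pureDr.
by rewrite (bhomR h) pure_bal.
Qed.

(** Written with [tlift] because [h] is only right linear: [tmap h (bid C)] lives on
    [rmod_of C ⊗ C]. *)
Definition rcolinear_end : Prop := forall c,
  cor_delta C (h c) = tlift (fun c d => (h c : C) ⊙ d) (cor_delta C c).

(** Apply [eps ⊗ C] to [Delta (h c) = sum h c_(1) ⊗ c_(2)]. A right colinear endomorphism of [C] is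
    thus determined by its composite with [eps]. *)
Lemma colinear_cdual_act (p : cdual C) : rcolinear_end ->
  (forall c, p c = cor_eps C (h c)) -> forall c, h c = cdual_act p c.
Proof.
move=> hC hp c; rewrite -[LHS](cor_counitl (h c : C)) hC.
rewrite [RHS]/(cdual_act_fun p c) /cdual_act_fun.
elim/tensor_ind: (cor_delta C c) => [d e|x y hx hy].
  by rewrite (tlift_pure end_bal) (tlift_pure (cdual_act_bal p)) tmapE lunitE bidE hp.
by rewrite (tliftD end_bal) (tliftD (cdual_act_bal p)) !bhomD hx hy.
Qed.

End Endomorphism.

Lemma rcolinear_comp (h h' : bhom (rmod_of C) (rmod_of C)) :
  rcolinear_end h -> rcolinear_end h' -> rcolinear_end (bcomp h h').
Proof.
move=> hC h'C c; rewrite bcompE hC h'C.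
elim/tensor_ind: (cor_delta C c) => [d e|x y hx hy].
  by rewrite (tlift_pure (end_bal h')) (tlift_pure (end_bal h))
    (tlift_pure (end_bal (bcomp h h'))) bcompE.
rewrite (tliftD (end_bal h')) (tliftD (end_bal h)) hx hy.
by rewrite (tliftD (end_bal (bcomp h h'))).
Qed.

Lemma cdual_act_colinear (p : cdual C) : rcolinear_end (cdual_act p).
Proof.
move=> c; set h := cdual_act p.
have bal : balanced (@ract k A A C) (@lact k A A (C ⊗ C))
    (fun c y => (p c : A) *> y).
  split=> [x y z|x y z|x a z]; first by rewrite (bhomD p) lactDl.
    exact: lactDr.
  by rewrite (bhomR p) lactA.
transitivity (tlift (fun c y => (p c : A) *> y) (tmap (bid C) (cor_delta C) (cor_delta C c))).
  rewrite [h c]/(cdual_act_fun p c) /cdual_act_fun.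
  elim/tensor_ind: (cor_delta C c) => [d e|x y hx hy].
    by rewrite (tlift_pure (cdual_act_bal p)) tmapE (tlift_pure bal) bhomL.
  by rewrite (tliftD (cdual_act_bal p)) !bhomD hx hy (tliftD bal).
rewrite -cor_coassoc.
elim/tensor_ind: (cor_delta C c) => [d e|x y hx hy]; last first.
  by rewrite !bhomD (tliftD bal) (tliftD (end_bal h)) hx hy.
rewrite tmapE bidE (tlift_pure (end_bal h)) [h d]/(cdual_act_fun p d) /cdual_act_fun.
elim/tensor_ind: (cor_delta C d) => [d1 d2|x y hx hy]; last first.
  by rewrite pureDl !bhomD (tliftD bal) (tliftD (cdual_act_bal p)) pureDl hx hy.
by rewrite tassocE (tlift_pure bal) (tlift_pure (cdual_act_bal p)) lact_pure.
Qed.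

(** Both sides are right colinear in [c], so it suffices to compare them after [eps]. The product of
    the dual corresponds to composition in reverse order. *)
Lemma cdual_actM (p q : cdual C) c :
  cdual_act (cdual_mul p q) c = cdual_act q (cdual_act p c).
Proof.
apply: esym; apply: (@colinear_cdual_act (bcomp (cdual_act q) (cdual_act p))).
  by apply: rcolinear_comp; apply: cdual_act_colinear.
by move=> d; rewrite bcompE cor_eps_act.
Qed.

Lemma cdual_act1 c : cdual_act (cdual_one C) c = c.
Proof.
apply: esym; apply: (@colinear_cdual_act (bid _)) => // d.
elim/tensor_ind: (cor_delta C d) => [d1 d2|x y hx hy].
  by rewrite (tlift_pure (end_bal (bid _))).
by rewrite (tliftD (end_bal (bid _))) -hx -hy.
Qed.

Lemma cdual_act_bij (p : cdual C) : cdual_invertible p -> bijective (cdual_act p).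
Proof.
by move=> [q [pq qp]]; exists (cdual_act q) => c; rewrite -cdual_actM ?pq ?qp cdual_act1.
Qed.

Lemma Inn_iso (f : Aut C) : Inn f -> twist f ≅ regular_bicomod C.
Proof.
move=> [p p_inv pE]; pose h := cdual_act p; pose phi := caut_phi f; pose rho := caut_rho f.
have hE c s : sweedler c s -> h c = \sum_(u <- s) phi u.1 <* (p u.2 : A).
  by move=> hs; rewrite (pE c s hs); apply: cdual_act_sweedler.
(* Semilinearity on the left is visible in the expression [sum phi c_(1) p(c_(2))] of [h], supplied
   by the identity defining [Inn]. *)
have hL a (c : C) : h (a *> c) = rho a *> (h c : C) :> C.
  have [s hs] := sweedler_ex (cor_delta C c).
  rewrite (hE c s hs) (hE (a *> c) [seq (a *> u.1, u.2) | u <- s]).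
    rewrite big_map (big_morph _ (lactDr _) (lact0 _ _)); apply: eq_bigr => u _ /=.
    by rewrite /phi (caut_linl (cautP f)) lractA.
  rewrite /sweedler bhomL hs big_map (big_morph _ (lactDr _) (lact0 _ _)).
  by apply: eq_bigr => u _; rewrite lact_pure.
have pL a (c : C) : p (a *> c) = rho a * (p c : A) :> A.
  by rewrite -!cor_eps_act hL bhomL.
have phiD : forall c d, phi (c + d) = phi c + phi d := caut_phiD (cautP f).
have phiR : forall c a, phi (c <* a) = phi c <* rho a := caut_linr (cautP f).
have phiL : forall a c, phi (a *> c) = rho a *> phi c := caut_linl (cautP f).
(* The identity defining [Inn] speaks of expansions of [Delta c] only; semilinearity of [p] extends
   its left side to a map [kk] on all of [C ⊗ C]. *)
have bal : balanced (@ract k A A C) (@lact k A A C) (fun c d => phi c <* (p d : A)).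
  split=> [x y z|x y z|x a z]; first by rewrite phiD ractDl.
    by rewrite (bhomD p) ractDr.
  by rewrite phiR pL ractA.
pose kk (x : C ⊗ C) : C := tlift (fun c d => phi c <* (p d : A)) x.
have hkk c : h c = kk (cor_delta C c).
  have [s hs] := sweedler_ex (cor_delta C c); rewrite (hE c s hs) hs.
  rewrite -(tens_sum (@ract k A A C) (@lact k A A C)).
  exact: (esym (tlift_pi bal s)).
have kkE c d : kk (c ⊙ d) = phi c <* (p d : A) by apply: (tlift_pure bal).
have kkD x y : kk (x + y) = kk x + kk y by apply: (tliftD bal).
have kkL a x : kk (a *> x) = rho a *> kk x.
  elim/tensor_ind: x => [c d|x y hx hy]; last by rewrite lactDr !kkD hx hy lactDr.
  by rewrite lact_pure !kkE phiL lractA.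
have bal2 : balanced (@ract k A A C) (@lact k A A (C ⊗ C)) (fun c y => phi c ⊙ kk y).
  split=> [x y z|x y z|x a z]; first by rewrite phiD pureDl.
    by rewrite kkD pureDr.
  by rewrite phiR pure_bal kkL.
pose T (x : C ⊗ (C ⊗ C)) : C ⊗ C := tlift (fun c y => phi c ⊙ kk y) x.
have TE c y : T (c ⊙ y) = phi c ⊙ kk y by apply: (tlift_pure bal2).
have TD x y : T (x + y) = T x + T y by apply: (tliftD bal2).
have h_tw a (c : twist f) : h (a *> c) = a *> (h c : C) :> C.
  rewrite [a *> c]lact_twist hL; congr (_ *> _).
  exact: (binvVK (caut_rho_bij (cautP f))).
pose hb : bhom (twist f) (regular_bicomod C) :=
  @BHom k A A (twist f) (regular_bicomod C) h (bhomD h) h_tw (bhomR h).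
exists hb; split; first exact: cdual_act_bij.
- move=> c; rewrite [bc_lam (twist f) c]twist_lamE.
  rewrite [LHS](congr1 (cor_delta C) (hkk c)).
  (* Both sides are [sum phi c_(1) ⊗ phi c_(2) p(c_(3))]. *)
  transitivity (T (tassoc C C C (tmap (cor_delta C) (bid C) (cor_delta C c)))).
    elim/tensor_ind: (cor_delta C c) => [d e|x y hx hy]; last first.
      by rewrite kkD !bhomD hx hy TD.
    rewrite kkE tmapE bhomR [cor_delta C (phi d)]cor_delta_phi bidE.
    elim/tensor_ind: (cor_delta C d) => [d1 d2|x y hx hy].
      by rewrite (tlift_pure (caut_tensP (cautP f))) tassocE TE kkE ract_pure.
    by rewrite (tliftD (caut_tensP (cautP f))) ractDl pureDl bhomD hx hy TD.
  rewrite cor_coassoc.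
  elim/tensor_ind: (cor_delta C c) => [d e|x y hx hy]; last first.
    by rewrite twist_tensD !bhomD TD hx hy.
  by rewrite twist_tensE !tmapE TE -hkk.
- move=> c; rewrite [LHS](cdual_act_colinear p c).
  have e x : tlift (fun c d => (h c : C) ⊙ d) x = tmap hb (bid C) (x : twist f ⊗ C).
    elim/tensor_ind: x => [d e|x y hx hy].
      rewrite (tlift_pure (end_bal h)); exact: (esym (tmapE hb (bid C) (d : twist f) e)).
    rewrite (tliftD (end_bal h)) hx hy.
    exact: (esym (bhomD (tmap hb (bid C)) (x : twist f ⊗ C) (y : twist f ⊗ C))).
  exact: e.
Qed.

Lemma iso_Inn (f : Aut C) : twist f ≅ regular_bicomod C -> Inn f.
Proof.
move=> /bicomod_iso_inv [h [h' [hK h'K [hL h'L] [hR h'R]]]].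
pose hr : bhom (rmod_of C) (rmod_of C) :=
  @rbhom k A (rmod_of C) (rmod_of C) h (bhomD h) (bhomR h).
pose hr' : bhom (rmod_of C) (rmod_of C) :=
  @rbhom k A (rmod_of C) (rmod_of C) h' (bhomD h') (bhomR h').
pose p : cdual C := bcomp (rhom_of (cor_eps C)) hr.
pose p' : cdual C := bcomp (rhom_of (cor_eps C)) hr'.
have hrC : rcolinear_end hr.
  move=> c; rewrite [LHS](hR c) -[bc_rho (twist f) c]/(cor_delta C c).
  elim/tensor_ind: (cor_delta C c) => [d e|x y hx hy].
    rewrite (tlift_pure (end_bal hr)); exact: (tmapE h (bid C) (d : twist f) e).
  rewrite (tliftD (end_bal hr)) -hx -hy.
  exact: (bhomD (tmap h (bid C)) (x : twist f ⊗ C) (y : twist f ⊗ C)).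
have hr'C : rcolinear_end hr'.
  move=> c; rewrite [LHS](h'R c) -[bc_rho (regular_bicomod C) c]/(cor_delta C c).
  elim/tensor_ind: (cor_delta C c) => [d e|x y hx hy].
    rewrite (tlift_pure (end_bal hr')) tmapE; exact: erefl.
  by rewrite (tliftD (end_bal hr')) -hx -hy bhomD.
have hp : forall c, hr c = cdual_act p c by apply: colinear_cdual_act.
have hp' : forall c, hr' c = cdual_act p' c by apply: colinear_cdual_act.
exists p.
  exists p'; split; apply: bhom_ext => c.
    apply: etrans (congr1 p' (esym (hp c))) _; congr (cor_eps C _); exact: hK.
  apply: etrans (congr1 p (esym (hp' c))) _; congr (cor_eps C _); exact: h'K.
(* Right colinearity has given [h c = sum p(c_(1)) c_(2)]. Left colinearity, followed by [C ⊗ eps],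
   gives [h c = sum phi c_(1) p(c_(2))]. *)
move=> c s hs; rewrite -(cdual_act_sweedler p hs) -hp.
rewrite -[RHS](cor_counitr (h c : C)) [cor_delta C _](hL c) [bc_lam (twist f) c]twist_lamE hs.
elim: s {hs} => [|u s ih].
  have t0 : twist_tens f 0 = 0.
    by apply: (addrI (twist_tens f 0)); rewrite -twist_tensD !addr0.
  by rewrite !big_nil t0 !bhom0.
by rewrite !big_cons twist_tensD !bhomD -ih twist_tensE !tmapE runitE.
Qed.

End InnerAutomorphisms.

(** * Kernels of group homomorphisms *)

Section Kernel.
Variables (G K : group) (p : G -> K) (N : G -> Prop).
Hypotheses (pM : group_hom p) (pN : forall x, p x = gone <-> N x).

Lemma group_hom1 : p gone = gone.
Proof.
by rewrite -[LHS]gmul1l -(gmulVl (p gone)) -gmulA -pM gmul1l gmulVl.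
Qed.

Lemma group_homV x : p (ginv x) = ginv (p x).
Proof.
by rewrite -[LHS]gmul1r -(gmulVr (p x)) gmulA -pM gmulVl group_hom1 gmul1l.
Qed.

(** Applied to [Omega], this replaces a direct verification that [Inn] is closed under products,
    inverses and conjugation. *)
Lemma kernel_normal : normal_subgroup N.
Proof.
split=> [|x y|x|x y]; rewrite -?pN ?pM ?group_homV ?group_hom1 //.
- by move=> -> ->; rewrite gmul1l.
- by move=> ->; rewrite -[LHS]gmul1r gmulVl.
- by move=> ->; rewrite gmul1r gmulVl.
Qed.

Lemma kernel_exact (hN : normal_subgroup N) :
  left_exact_groups (@subgroup_incl G N hN) p.
Proof.
split=> // [x y|y]; first exact: sig_eq.
by rewrite pN; split=> [hy|[[x hx] <-]] //; exists (exist N y hy).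
Qed.

Lemma kernel_quotient (hN : normal_subgroup N) : exists omega : quotient hN -> K,
  [/\ group_hom omega, injective omega &
      forall x, omega (quotient_map N x) = p x].
Proof.
have pE x y : p x = p y <-> N (gmul (ginv x) y).
  rewrite -pN pM group_homV; split=> [->|e]; first exact: gmulVl.
  by rewrite -[LHS]gmul1r -e gmulA gmulVr gmul1l.
pose omega (P : quotient hN) := p (quotient_repr P).
have omegaE x : omega (quotient_map N x) = p x.
  by apply/pE/(quotient_mapP hN)/quotient_reprK.
exists omega; split=> // [P Q|P Q].
  rewrite -(quotient_reprK P) -(quotient_reprK Q) [gmul _ _](quotient_mulE hN).
  by rewrite !omegaE pM.
rewrite -(quotient_reprK P) -(quotient_reprK Q) !omegaE => /pE h.
exact/(quotient_mapP hN).
Qed.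

End Kernel.

Theorem theorem4p1p6 (k : comPzRingType) (A : kalg k) (C : coring A)
    (hCl : left_flat C) (hCr : right_flat C) :
  exists hC : pic_laws hCl hCr,
    (exists (hInn : normal_subgroup (@Inn k A C)) (Omega : Aut C -> Pic hC),
        (forall f : Aut C, exists hf : right_invertible hCl (twist f),
            Omega f = pic_class hf)
        /\ left_exact_groups (@subgroup_incl (Aut C) (@Inn k A C) hInn) Omega
        /\ exists omega : quotient hInn -> Pic hC,
             [/\ group_hom omega, injective omega &
                 forall f : Aut C, omega (quotient_map (@Inn k A C) f) = Omega f])
    /\
    (forall (B : kalg k) (D : coring B) (hDl : left_flat D) (hDr : right_flat D),
        MT_right_equivalent C hDl ->
        exists hD : pic_laws hDl hDr, group_isomorphic (Pic hC) (Pic hD)).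
Proof.
pose hC := rinv_pic_laws hCl hCr; exists hC; split; last first.
  move=> B D hDl hDr e; exists (rinv_pic_laws hDl hDr).
  exact: MT_equivalent_pic.
pose Omega (f : Aut C) : Pic hC := pic_class (twist_rinv hCl f).
have OmegaM : group_hom Omega.
  move=> f g; rewrite [RHS]pic_mulE; apply/pic_classP; exact: twist_mul_iso.
have OmegaN f : Omega f = gone <-> Inn f.
  apply: iff_trans (pic_classP _ _) _.
  by split; [apply: iso_Inn | apply: Inn_iso].
exists (kernel_normal OmegaM OmegaN), Omega; split.
  by move=> f; exists (twist_rinv hCl f).
by split; [apply: kernel_exact | apply: kernel_quotient].
Qed.
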